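(* Let $\alpha>0$ and $\varphi(z)=\alpha(\log^+|z|)^2$. Let $\gamma_n=e^{\frac{n+1}{2\alpha}}$, $n\ge 0$, and let $\Lambda=\{\lambda_n\}_{n\ge 0}$ be a sequence of pairwise distinct points of $\mathbb{C}$ written as $\lambda_n=\gamma_n e^{\delta_n}e^{i\theta_n}$ with $\delta_n,\theta_n\in\mathbb{R}$ and $|\lambda_n|\le|\lambda_{n+1}|$ for all $n\ge 0$. Then the family of normalized reproducing kernels $\{\Bbbk_\lambda\}_{\lambda\in\Lambda}$ is a Riesz basis for $\mathcal{F}^2_\varphi$ if and only if the following three conditions hold: (a) $\Lambda$ is $d_\rho$-separated; (b) $(\delta_n)_{n\ge0}\in\ell^\infty$; (c) there exist an integer $N\ge 1$ and $\delta>0$ such that $$\sup_{n}\frac1N\Big|\sum_{k=n+1}^{n+N}\delta_k\Big|\le\delta<\frac{1}{4\alpha}.$$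
   Context: Here $\log^+ t=\max(\log t,0)$ and $m$ is planar Lebesgue measure. $\mathcal{F}^2_\varphi$ is the Hilbert space of entire functions $f$ with $\|f\|_{\varphi,2}^2=\int_{\mathbb{C}}|f(z)|^2e^{-2\varphi(z)}\,dm(z)<\infty$. $\mathbf{k}_z$ denotes its reproducing kernel at $z$: $\langle f,\mathbf{k}_z\rangle=f(z)$ for all $f\in\mathcal{F}^2_\varphi$; the normalized kernel is $\Bbbk_\lambda=\mathbf{k}_\lambda/\|\mathbf{k}_\lambda\|_{\varphi,2}$. The family $\{\Bbbk_\lambda\}_{\lambda\in\Lambda}$ is a Riesz basis of $\mathcal{F}^2_\varphi$ if its linear span is dense in $\mathcal{F}^2_\varphi$ and there is $C>0$ such that for every finite sequence $\{a_\lambda\}$, $\frac1C\sum|a_\lambda|^2\le\|\sum a_\lambda\Bbbk_\lambda\|_{\varphi,2}^2\le C\sum|a_\lambda|^2$. Put $d_\rho(z,w)=\sqrt{2\alpha}\,\frac{|z-w|}{\sqrt{2\alpha}+\min(|z|,|w|)}$ for $z,w\in\mathbb{C}$; a sequence $\Lambda\subset\mathbb{C}$ is $d_\rho$-separated if $\inf\{d_\rho(z,w): z,w\in\Lambda,\ z\ne w\}>0$. *)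

(* Defs.v *)
From HB Require Import structures.
From mathcomp Require Import all_boot all_order all_algebra.
From mathcomp Require Import complex.
From mathcomp Require Import all_classical all_reals all_analysis.

Set Implicit Arguments.
Unset Strict Implicit.
Unset Printing Implicit Defensive.

Import Order.TTheory GRing.Theory Num.Theory.
Import numFieldNormedType.Exports.

Local Open Scope classical_set_scope.
Local Open Scope ring_scope.
Local Open Scope complex_scope.

(* The norm [`|z|] of z : R[i] is a (real) element of R[i]; [modulus z] is the
   same number as an element of R. *)
Definition modulus (R : realType) (z : R[i]) : R := ComplexField.Normc.normc z.

(* Planar Lebesgue measure lives on R * R, identified with R[i] by [cplx]. *)
Definition planar_measure (R : realType) :
    {measure set (measurableTypeR R * measurableTypeR R) -> \bar R} :=
  (@lebesgue_measure R \x @lebesgue_measure R)%E.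

Definition cplx (R : realType)
  (p : measurableTypeR R * measurableTypeR R) : R[i] := p.1 +i* p.2.

Definition entire (R : realType) (f : R[i] -> R[i]) : Prop :=
  forall z : R[i], derivable (f : (R[i])^o -> (R[i])^o) z 1.

Definition fock_sqnorm (R : realType) (phi : R[i] -> R) (f : R[i] -> R[i]) :
    \bar R :=
  (\int[planar_measure R]_p
     (modulus (f (cplx p)) ^+ 2 * expR (- (2 * phi (cplx p))))%:E)%E.

Definition fock_norm (R : realType) (phi : R[i] -> R) (f : R[i] -> R[i]) : R :=
  Num.sqrt (fine (fock_sqnorm phi f)).

Definition fock_space (R : realType) (phi : R[i] -> R) : set (R[i] -> R[i]) :=
  [set f | entire f /\ (fock_sqnorm phi f < +oo)%E].

Definition fock_inner (R : realType) (phi : R[i] -> R)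
    (f g : R[i] -> R[i]) : R[i] :=
  let h p := f (cplx p) * (g (cplx p))^* in
  (\int[planar_measure R]_p (complex.Re (h p) * expR (- (2 * phi (cplx p)))))
  +i*
  (\int[planar_measure R]_p (complex.Im (h p) * expR (- (2 * phi (cplx p))))).

Definition reproduces_at (R : realType) (phi : R[i] -> R) (z : R[i])
    (k : R[i] -> R[i]) : Prop :=
  fock_space phi k /\
  forall f, fock_space phi f -> fock_inner phi f k = f z.

(* The reproducing kernel at z is unique when it exists; the default value 0
   is only used when point evaluation at z is unbounded. *)
Definition repr_kernel (R : realType) (phi : R[i] -> R) (z : R[i]) :
    R[i] -> R[i] :=
  xget (fun=> 0) [set k | reproduces_at phi z k].

Definition normalized_kernel (R : realType) (phi : R[i] -> R) (l : R[i]) :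
    R[i] -> R[i] :=
  fun w => repr_kernel phi l w / (fock_norm phi (repr_kernel phi l))%:C.

(* Finite linear combinations of the family (e l) are indexed by
   duplicate-free sequences of indices. *)
Definition lin_comb (R : realType) (e : R[i] -> R[i] -> R[i])
    (s : seq R[i]) (a : R[i] -> R[i]) : R[i] -> R[i] :=
  fun w => \sum_(l <- s) a l * e l w.

Definition finite_in (R : realType) (L : set R[i]) (s : seq R[i]) : Prop :=
  uniq s /\ forall l, l \in s -> L l.

Definition dense_span (R : realType) (phi : R[i] -> R) (L : set R[i])
    (e : R[i] -> R[i] -> R[i]) : Prop :=
  forall f, fock_space phi f -> forall eps : R, 0 < eps ->
    exists s a, finite_in L s /\
      (fock_sqnorm phi (fun w => f w - lin_comb e s a w)%R < (eps ^+ 2)%:E)%E.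

Definition riesz_basis (R : realType) (phi : R[i] -> R) (L : set R[i])
    (e : R[i] -> R[i] -> R[i]) : Prop :=
  (forall l, L l -> fock_space phi (e l)) /\
  dense_span phi L e /\
  exists2 C : R, 0 < C &
    forall s a, finite_in L s ->
      ((C^-1 * \sum_(l <- s) modulus (a l) ^+ 2)%:E
         <= fock_sqnorm phi (lin_comb e s a))%E /\
      (fock_sqnorm phi (lin_comb e s a)
         <= (C * \sum_(l <- s) modulus (a l) ^+ 2)%:E)%E.

(* [ln] vanishes on nonpositive reals, so [logp 0 = 0]. *)
Definition logp (R : realType) (t : R) : R := Num.max (ln t) 0.

Definition log_weight (R : realType) (alpha : R) (z : R[i]) : R :=
  alpha * logp (modulus z) ^+ 2.

Definition d_rho (R : realType) (alpha : R) (z w : R[i]) : R :=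
  Num.sqrt (2 * alpha) * modulus (z - w) /
  (Num.sqrt (2 * alpha) + Num.min (modulus z) (modulus w)).

Definition d_rho_separated (R : realType) (alpha : R) (L : set R[i]) : Prop :=
  (0 < ereal_inf
    [set r | exists z w, [/\ L z, L w, z != w & r = (d_rho alpha z w)%:E]])%E.

Definition gamma_ (R : realType) (alpha : R) (n : nat) : R :=
  expR (n.+1%:R / (2 * alpha)).

Definition expi (R : realType) (theta : R) : R[i] := cos theta +i* sin theta.

(* Main.v *)
(* Taylor coefficients identify the Fock space with a weighted l2 space: since
   phi is radial, ||sum a_m z^m||^2 = sum |a_m|^2 c_m, and the moments c_m are
   comparable to E_m = exp((m+1)^2/(2 alpha)).  In the coordinates sqrt(c_m) a_m
   the normalized kernel at lambda_n becomes the row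
   V n m = conj(lambda_n)^m / (sqrt(c_m) ||k_(lambda_n)||), a Gaussian bump
   centred at m + 1 = 2 alpha log |lambda_n|.

   Necessity.  A dimension count with finite sections of V shows that the bump
   of row n lies at bounded distance from n, which is (b).  Two rows with
   lambda_n / lambda_k close to 1 would be almost parallel, whence (a).  For (c)
   put X_n = E_n / prod_(k <= n) |lambda_k|^2 and
   Y_n = E_n / prod_(k < n) |lambda_k|^2.  Testing the frame bound on the
   polynomials prod_(k < n) (z - lambda_k), estimated from below by Landau's
   inequality on the circles |z| = |lambda_m|, gives sum_(m <= n) Y_m <= C Y_n;
   testing the lower Riesz bound on divided differences gives
   sum_(k <= n) 1/X_k <= C/X_n.  So Y and 1/X grow geometrically, and as
   Y_n = exp((n+1)/(2 alpha) - 2 sum_(k < n) delta_k) and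
   X_n = exp(-(n+1)/(2 alpha) - 2 sum_(k <= n) delta_k), this is the two-sided
   bound on the averages of delta.

   Sufficiency.  The finite section of V is inverted by the coefficients of the
   Lagrange polynomials at the nodes lambda_k; their size is governed by the
   ratios X_m / X_n (m >= n) and Y_m / Y_n (m < n), so by (c) the inverses decay
   geometrically off the diagonal, uniformly in the size of the section, and
   Schur's test applies. *)
Require Import Defs.
From HB Require Import structures.
From mathcomp Require Import all_boot all_order all_algebra.
From mathcomp Require Import complex.
From mathcomp Require Import all_classical all_reals all_analysis.
From mathcomp Require Import measurable_realfun.
From mathcomp Require Import ring lra.
Import Order.TTheory GRing.Theory Num.Theory.
Import numFieldNormedType.Exports.
Local Open Scope classical_set_scope.
Local Open Scope ring_scope.
Local Open Scope complex_scope.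
Set Implicit Arguments.
Unset Strict Implicit.
Unset Printing Implicit Defensive.

(** * Moduli and epsilon-delta differentiability in R[i] *)

Section ModulusTheory.
Context {R : realType}.
Implicit Types (z w : R[i]) (x y : R).

(** The threshold 1/(4 alpha) is half the drift of the lattice. For delta = 0, Y_n grows and X_n
    decays at the same rate exp(1/(2 alpha)) per step, while a mean value d of delta adds -2 d per
    step to both exponents: Y still grows when d < 1/(4 alpha), and X still decays when d > -1/(4
    alpha). The ratios of Y govern the entries of the inverse sections with m < n and those of X the
    entries with m >= n, which is why (c) bounds the means on both sides. Boundedness (b) comes
    before (a) and (c). Once row n is centred near column n, the ratios rho_k / rho_m of the moduli,
    k <= m, decay geometrically in m - k, so that their sums are bounded by one constant H and a
    product of distances |lambda_k - lambda_i| is at most exp(H) times the product of the larger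
    radii. The matching lower bound is where separation enters, in the sufficiency part; in the
    necessity part polynomials are bounded below by Landau's inequality, which sees the zeros
    through their moduli. *)

Lemma normcE_modulus z : `|z| = (modulus z)%:C.
Proof. by rewrite normc_def /modulus; case: z => a b. Qed.

Lemma modulusE z : modulus z = Num.sqrt (complex.Re z ^+ 2 + complex.Im z ^+ 2).
Proof. by case: z. Qed.

Lemma modulus_sqr z : modulus z ^+ 2 = complex.Re z ^+ 2 + complex.Im z ^+ 2.
Proof. by rewrite modulusE sqr_sqrtr // addr_ge0 ?sqr_ge0. Qed.

Lemma modulus_ge0 z : 0 <= modulus z.
Proof. by rewrite modulusE sqrtr_ge0. Qed.

Lemma modulus0 : modulus (0 : R[i]) = 0.
Proof. exact: ComplexField.Normc.normc0. Qed.

Lemma modulus1 : modulus (1 : R[i]) = 1.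
Proof. exact: ComplexField.Normc.normc1. Qed.

Lemma modulus_eq0 z : (modulus z == 0) = (z == 0).
Proof.
apply/eqP/eqP => [|->]; last exact: modulus0.
exact: ComplexField.Normc.eq0_normc.
Qed.

Lemma modulus_gt0 z : (0 < modulus z) = (z != 0).
Proof. by rewrite lt_def modulus_eq0 modulus_ge0 andbT. Qed.

Lemma modulusM z w : modulus (z * w) = modulus z * modulus w.
Proof. exact: ComplexField.Normc.normcM. Qed.

Lemma modulusV z : modulus z^-1 = (modulus z)^-1.
Proof. exact: ComplexField.Normc.normcV. Qed.

Lemma modulus_div z w : modulus (z / w) = modulus z / modulus w.
Proof. by rewrite modulusM modulusV. Qed.

Lemma modulusX z n : modulus (z ^+ n) = modulus z ^+ n.
Proof. by elim: n => [|n IH]; rewrite ?expr0 ?modulus1 // !exprS modulusM IH. Qed.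

Lemma modulusN z : modulus (- z) = modulus z.
Proof. by rewrite !modulusE; case: z => a b /=; rewrite !sqrrN. Qed.

Lemma modulusB z w : modulus (z - w) = modulus (w - z).
Proof. by rewrite -modulusN opprB. Qed.

Lemma modulusJ z : modulus (z^*)%R = modulus z.
Proof. by rewrite !modulusE; case: z => a b /=; rewrite sqrrN. Qed.

Lemma modulus_real x : modulus (x%:C) = `|x|.
Proof. by rewrite modulusE /= expr0n /= addr0 sqrtr_sqr. Qed.

Lemma modulusi : modulus ('i : R[i]) = 1.
Proof. by rewrite modulusE /= expr0n /= add0r expr1n sqrtr1. Qed.

Lemma modulusD_le z w : modulus (z + w) <= modulus z + modulus w.
Proof. exact: le_normcD. Qed.

Lemma modulusB_le z w : modulus (z - w) <= modulus z + modulus w.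
Proof. by rewrite -(modulusN w) modulusD_le. Qed.

Lemma modulusB_ge z w : modulus z - modulus w <= modulus (z - w).
Proof. by rewrite lerBlDr (le_trans _ (modulusD_le _ _)) // subrK. Qed.

Lemma modulus_sum (I : Type) (r : seq I) (P : pred I) (F : I -> R[i]) :
  modulus (\sum_(i <- r | P i) F i) <= \sum_(i <- r | P i) modulus (F i).
Proof.
elim/big_rec2: _ => [|i y x _ H]; first by rewrite modulus0.
exact: le_trans (modulusD_le _ _) (lerD _ _).
Qed.

Lemma modulus_prod (I : Type) (r : seq I) (P : pred I) (F : I -> R[i]) :
  modulus (\prod_(i <- r | P i) F i) = \prod_(i <- r | P i) modulus (F i).
Proof. by elim/big_rec2: _ => [|i y x _ <-]; rewrite ?modulus1 ?modulusM. Qed.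

Lemma Re_le_modulus z : `|complex.Re z| <= modulus z.
Proof.
by rewrite modulusE -sqrtr_sqr ler_wsqrtr // lerDl sqr_ge0.
Qed.

Lemma Im_le_modulus z : `|complex.Im z| <= modulus z.
Proof.
by rewrite modulusE -sqrtr_sqr ler_wsqrtr // lerDr sqr_ge0.
Qed.

Lemma modulus_le_ReIm z : modulus z <= `|complex.Re z| + `|complex.Im z|.
Proof.
rewrite modulusE -[leRHS]ger0_norm ?addr_ge0 // -sqrtr_sqr ler_wsqrtr //.
rewrite sqrrD !real_normK ?num_real // -addrA (addrC (_ *+ 2)) addrA lerDl.
by rewrite mulrn_wge0 // mulr_ge0.
Qed.

Lemma modulus_expi x : modulus (expi x) = 1.
Proof. by rewrite modulusE /= cos2Dsin2 sqrtr1. Qed.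

Lemma mulJ z : z * z^* = (modulus z ^+ 2)%:C.
Proof.
rewrite modulus_sqr; case: z => a b /=.
by apply/eqP; rewrite eq_complex /=; apply/andP; split; apply/eqP; ring.
Qed.

Lemma expiD x y : expi (x + y) = expi x * expi y :> R[i].
Proof.
rewrite /expi cosD sinD; apply/eqP; rewrite eq_complex /=.
by apply/andP; split; apply/eqP; ring.
Qed.

Lemma expi0 : expi 0 = 1 :> R[i].
Proof. by rewrite /expi cos0 sin0. Qed.

Lemma cReD z w : complex.Re (z + w) = complex.Re z + complex.Re w.
Proof. by case: z; case: w. Qed.

Lemma cImD z w : complex.Im (z + w) = complex.Im z + complex.Im w.
Proof. by case: z; case: w. Qed.

Lemma cReN z : complex.Re (- z) = - complex.Re z.
Proof. by case: z. Qed.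

Lemma cImN z : complex.Im (- z) = - complex.Im z.
Proof. by case: z. Qed.

Lemma cReM z w : complex.Re (z * w) =
  complex.Re z * complex.Re w - complex.Im z * complex.Im w.
Proof. by case: z; case: w. Qed.

Lemma cImM z w : complex.Im (z * w) =
  complex.Re z * complex.Im w + complex.Im z * complex.Re w.
Proof. by case: z; case: w. Qed.

Lemma complex_eq z w : complex.Re z = complex.Re w ->
  complex.Im z = complex.Im w -> z = w.
Proof. by case: z => a b; case: w => c d /= -> ->. Qed.

Lemma cRe_sum (I : Type) (r : seq I) (P : pred I) (F : I -> R[i]) :
  complex.Re (\sum_(i <- r | P i) F i) = \sum_(i <- r | P i) complex.Re (F i).
Proof. by elim/big_rec2: _ => [|i y x _ <-]; rewrite ?cReD. Qed.

Lemma cIm_sum (I : Type) (r : seq I) (P : pred I) (F : I -> R[i]) :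
  complex.Im (\sum_(i <- r | P i) F i) = \sum_(i <- r | P i) complex.Im (F i).
Proof. by elim/big_rec2: _ => [|i y x _ <-]; rewrite ?cImD. Qed.

Lemma cReJ z : complex.Re (z^*)%R = complex.Re z.
Proof. by case: z. Qed.

Lemma cImJ z : complex.Im (z^*)%R = - complex.Im z.
Proof. by case: z. Qed.

Lemma cJM z w : ((z * w)^* = z^* * w^*)%R.
Proof. exact: rmorphM. Qed.

Lemma cJD z w : ((z + w)^* = z^* + w^*)%R.
Proof. exact: rmorphD. Qed.

Lemma cJX z n : ((z ^+ n)^* = z^* ^+ n)%R.
Proof. exact: rmorphXn. Qed.

Lemma cJ_sum (I : Type) (r : seq I) (P : pred I) (F : I -> R[i]) :
  ((\sum_(i <- r | P i) F i)^* = \sum_(i <- r | P i) (F i)^*)%R.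
Proof. exact: rmorph_sum. Qed.

Lemma cJK z : ((z^*)^* = z)%R.
Proof. exact: conjCK. Qed.

Lemma cJ_real x : (x%:C ^* = x%:C :> R[i])%R.
Proof. by apply: complex_eq; rewrite ?cReJ ?cImJ //= oppr0. Qed.

Lemma modulus_le0_eq0 z : (forall e, 0 < e -> modulus z <= e) -> z = 0.
Proof.
move=> H; apply/eqP; rewrite -modulus_eq0 eq_le modulus_ge0 andbT.
by apply/ler_addgt0Pr => e e0; rewrite add0r H.
Qed.

(** Differentiability in remainder form, with real epsilon and delta. A positive element of R[i] has
    imaginary part 0, so quantifying over the positive elements of R[i], as [derivable] does,
    amounts to the same. *)
Definition cdiff (f : R[i] -> R[i]) (z l : R[i]) : Prop :=
  forall eps : R, 0 < eps -> exists2 d : R, 0 < d & forall h,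
    modulus h < d -> modulus (f (z + h) - f z - l * h) <= eps * modulus h.

Definition ccont (f : R[i] -> R[i]) (z : R[i]) : Prop :=
  forall eps : R, 0 < eps -> exists2 d : R, 0 < d & forall w,
    modulus (w - z) < d -> modulus (f w - f z) <= eps.

Lemma derivable_cdiff (f : R[i] -> R[i]) z :
  derivable (f : (R[i])^o -> (R[i])^o) z 1 <-> exists l, cdiff f z l.
Proof.
split.
- move=> /cvg_ex [l /cvgrPdist_le Hl]; exists l => eps eps0.
  have /Hl : (0 : R[i]) < eps%:C by rewrite ltcR.
  rewrite /prop_near1 /= => /nbhs_ballP [d /= d0 Hd].
  move: d d0 Hd => [d di] d0 Hd.
  have [d0' di0] : 0 < d /\ di = 0.
    by move: d0; rewrite ltcE /= => /andP[/eqP <- ->].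
  exists d => // h hd.
  have [->|h0] := eqVneq h 0; first by rewrite addr0 subrr mulr0 subrr modulus0 mulr0.
  have := Hd h; rewrite /ball /= sub0r normrN normcE_modulus di0 ltcR => /(_ hd h0).
  rewrite normcE_modulus lecR => H.
  have -> : f (z + h) - f z - l * h = - ((l - h^-1 * (f (h * 1 + z) - f z)) * h).
    by rewrite mulrBl mulrAC mulVf // mul1r mulr1 (addrC h) opprB.
  rewrite modulusN modulusM ler_wpM2r ?modulus_ge0 //.
- move=> [l Hl]; apply/cvg_ex; exists l; apply/cvgrPdist_le => e e0.
  have [e0' ee] : 0 < complex.Re e /\ e = (complex.Re e)%:C.
    by case: e e0 => a b; rewrite ltcE /= => /andP[/eqP -> ->].
  have [d d0 Hd] := Hl _ e0'.
  apply/nbhs_ballP; exists d%:C; first by rewrite /= ltcR.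
  move=> h; rewrite /ball /= sub0r normrN normcE_modulus ltcR => hd h0.
  rewrite ee normcE_modulus lecR.
  have := Hd _ hd.
  have -> : f (z + h) - f z - l * h = - ((l - h^-1 * (f (h * 1 + z) - f z)) * h).
    by rewrite mulrBl mulrAC mulVf // mul1r mulr1 (addrC h) opprB.
  by rewrite modulusN modulusM ler_pM2r // modulus_gt0.
Qed.

Lemma cdiff_ccont f z l : cdiff f z l -> ccont f z.
Proof.
move=> H eps eps0; have [d d0 Hd] := H 1 ltr01.
have l1 : 0 < 1 + modulus l by rewrite ltr_pwDl // modulus_ge0.
exists (Num.min d (eps / (1 + modulus l))); first by rewrite lt_min d0 divr_gt0.
move=> w; rewrite lt_min => /andP[/Hd A B].
move: A; rewrite mul1r (addrC z) subrK => A.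
have -> : f w - f z = (f w - f z - l * (w - z)) + l * (w - z) by rewrite subrK.
apply: le_trans (modulusD_le _ _) _; apply: le_trans (lerD A (lexx _)) _.
by rewrite modulusM -{1}[modulus (w - z)]mul1r -mulrDl -ler_pdivlMl // mulrC ltW.
Qed.

End ModulusTheory.

(** * Taylor expansion of entire functions *)

Section Subdivision.
Context {R : realType}.
Variables (a b : R) (a0 : 0 <= a) (b0 : 0 <= b).
Variable Psi : R -> R -> R -> R.
Hypothesis Psi_subdiv : forall x y s : R, 0 < s -> Psi x y (s + s) <=
  Psi x y s + Psi (x + a * s) y s + Psi x (y + b * s) s
  + Psi (x + a * s) (y + b * s) s.

(** Selects a quarter on which Psi is still at least e s^2. By subadditivity the fourth quarter
    qualifies whenever the first three fail, so it is taken without a test. *)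
Let quarter (e s : R) (p : R * R) : R * R :=
  if e * s ^+ 2 <= Psi p.1 p.2 s then p
  else if e * s ^+ 2 <= Psi (p.1 + a * s) p.2 s then (p.1 + a * s, p.2)
  else if e * s ^+ 2 <= Psi p.1 (p.2 + b * s) s then (p.1, p.2 + b * s)
  else (p.1 + a * s, p.2 + b * s).

Let quarterP (e s : R) p : 0 < s -> e * (s + s) ^+ 2 <= Psi p.1 p.2 (s + s) ->
  e * s ^+ 2 <= Psi (quarter e s p).1 (quarter e s p).2 s.
Proof.
move=> s0 H; have := le_trans H (Psi_subdiv p.1 p.2 s0).
have -> : e * (s + s) ^+ 2 = 4 * (e * s ^+ 2) by ring.
rewrite /quarter; case: ifPn => //; rewrite -ltNge => H1.
case: ifPn => //; rewrite -ltNge => H2.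
case: ifPn => //; rewrite -ltNge => H3 /=.
move: (e * s ^+ 2) H1 H2 H3 => u; lra.
Qed.

Let quarter_bnd (e s : R) p : 0 < s ->
  [/\ p.1 <= (quarter e s p).1, (quarter e s p).1 <= p.1 + a * s,
      p.2 <= (quarter e s p).2 & (quarter e s p).2 <= p.2 + b * s].
Proof.
move=> s0; have as0 : 0 <= a * s by rewrite mulr_ge0 // ltW.
have bs0 : 0 <= b * s by rewrite mulr_ge0 // ltW.
by rewrite /quarter; do !case: ifPn => _ /=; split; lra.
Qed.

(* Abstract Goursat argument: [Psi x y s] plays the role of the modulus of the
   boundary integral over the rectangle with corner (x, y) and sides a s, b s. *)
Lemma subdivision_le0 (x0 y0 s0 : R) : 0 < s0 ->
  (forall x1 y1 : R, x0 <= x1 <= x0 + a * s0 -> y0 <= y1 <= y0 + b * s0 ->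
   forall e : R, 0 < e -> exists2 eta : R, 0 < eta & forall x y s : R, 0 < s < eta ->
    x <= x1 <= x + a * s -> y <= y1 <= y + b * s ->
    x0 <= x -> x + a * s <= x0 + a * s0 -> y0 <= y -> y + b * s <= y0 + b * s0 ->
    Psi x y s <= e * s ^+ 2) ->
  Psi x0 y0 s0 <= 0.
Proof.
move=> s00 Hloc; rewrite leNgt; apply/negP => P0.
(* The initial ratio Psi / s^2; it is preserved as a lower bound along the nested rectangles. *)
pose e := Psi x0 y0 s0 / s0 ^+ 2.
have e0 : 0 < e by rewrite divr_gt0 // exprn_gt0.
pose s n : R := s0 / 2 ^+ n.
have s_gt0 n : 0 < s n by rewrite divr_gt0 // exprn_gt0.
have sS n : s n = s n.+1 + s n.+1.
  by rewrite /s exprS; field; rewrite expf_neq0.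
pose p := fix p n := if n is m.+1 then quarter e (s n) (p m) else (x0, y0).
have pS n : p n.+1 = quarter e (s n.+1) (p n) by [].
have Pp n : e * s n ^+ 2 <= Psi (p n).1 (p n).2 (s n).
  elim: n => [|n IH].
    by rewrite /s expr0 divr1 /e /= divfK // expf_neq0 // gt_eqF.
  by rewrite pS; apply: quarterP => //; rewrite -sS.
have bnd n : [/\ (p n).1 <= (p n.+1).1, (p n.+1).1 + a * s n.+1 <= (p n).1 + a * s n,
   (p n).2 <= (p n.+1).2 & (p n.+1).2 + b * s n.+1 <= (p n).2 + b * s n].
  have [h1 h2 h3 h4] := quarter_bnd e (p n) (s_gt0 n.+1).
  by rewrite pS; split => //; rewrite (sS n) mulrDr; lra.
have mono k n : [/\ (p n).1 <= (p (n + k)%N).1,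
    (p (n + k)%N).1 + a * s (n + k)%N <= (p n).1 + a * s n,
   (p n).2 <= (p (n + k)%N).2 & (p (n + k)%N).2 + b * s (n + k)%N <= (p n).2 + b * s n].
  elim: k => [|k [i1 i2 i3 i4]]; first by rewrite addn0; split.
  have [h1 h2 h3 h4] := bnd (n + k)%N.
  by rewrite addnS; split; lra.
have cross m n : (p m).1 <= (p n).1 + a * s n /\ (p m).2 <= (p n).2 + b * s n.
  have am k : 0 <= a * s k by rewrite mulr_ge0 // ltW.
  have bm k : 0 <= b * s k by rewrite mulr_ge0 // ltW.
  have [mn|nm] := leqP m n.
    have [i1 i2 i3 i4] := mono (n - m)%N m; rewrite subnKC // in i1 i2 i3 i4.
    have := am n; have := bm n; lra.
  have [i1 i2 i3 i4] := mono (m - n)%N n; rewrite subnKC 1?ltnW // in i1 i2 i3 i4.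
  have := am m; have := bm m; lra.
pose X := [set (p n).1 | n in setT]; pose Y := [set (p n).2 | n in setT].
have Xle n : (p n).1 <= sup X.
  apply: ub_le_sup; last by exists n.
  by exists ((p 0%N).1 + a * s 0%N) => _ [k _ <-]; case: (cross k 0%N).
have Yle n : (p n).2 <= sup Y.
  apply: ub_le_sup; last by exists n.
  by exists ((p 0%N).2 + b * s 0%N) => _ [k _ <-]; case: (cross k 0%N).
have Xge n : sup X <= (p n).1 + a * s n.
  apply: ge_sup; first by exists (p 0%N).1, 0%N.
  by move=> _ [k _ <-]; case: (cross k n).
have Yge n : sup Y <= (p n).2 + b * s n.
  apply: ge_sup; first by exists (p 0%N).2, 0%N.
  by move=> _ [k _ <-]; case: (cross k n).
have s0E : s 0%N = s0 by rewrite /s expr0 divr1.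
(* The point ([sup X], [sup Y]) lies in every nested rectangle, so the local estimate with e / 2
   contradicts the lower bound e. *)
have [|||eta eta0 He] := Hloc (sup X) (sup Y) _ _ (e / 2) _.
- by have := Xle 0%N; have := Xge 0%N; rewrite s0E => -> ->.
- by have := Yle 0%N; have := Yge 0%N; rewrite s0E => -> ->.
- by rewrite divr_gt0.
have [n sn] : exists n, s n < eta.
  have : (fun n => s0 * 2^-1 ^+ n) @ \oo --> s0 * 0.
    by apply: cvgMr; apply: cvg_expr; rewrite ger0_norm ?invr_ge0 // invf_lt1 // ltr1n.
  rewrite mulr0 => /cvgrPdist_lt /(_ _ eta0) [n _ /(_ n (leqnn n))] /=.
  rewrite sub0r normrN ger0_norm ?mulr_ge0 ?exprn_ge0 ?invr_ge0 // ?(ltW s00) // => H.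
  by exists n; rewrite /s -exprVn.
have [i1 i2 i3 i4] := mono n 0%N; rewrite add0n s0E in i1 i2 i3 i4.
have := He (p n).1 (p n).2 (s n).
rewrite (s_gt0 n) sn Xle Xge Yle Yge => /(_ isT isT isT i1 i2 i3 i4) H.
have := le_trans (Pp n) H.
by rewrite ler_pM2r ?exprn_gt0 // leNgt ltr_pdivrMr // mulr2n mulrDr mulr1 ltrDl e0.
Qed.

End Subdivision.

(** * Integrals of complex-valued functions over segments *)

Section ContourIntegral.
Context {R : realType}.
Local Notation mu := (@lebesgue_measure R).
Implicit Types (F G : R -> R[i]) (a b c : R) (k : R[i]).

Lemma continuous_integrable (u : R -> R) a b : continuous u ->
  mu.-integrable `[a, b] (EFin \o u).
Proof.
move=> uc; apply: continuous_compact_integrable; first exact: segment_compact.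
exact: continuous_subspaceT.
Qed.

Definition ccurve F := continuous (fun t => complex.Re (F t)) /\ continuous (fun t => complex.Im (F t)).

Definition cint F a b : R[i] :=
  (\int[mu]_(t in `[a, b]) complex.Re (F t)) +i*
  (\int[mu]_(t in `[a, b]) complex.Im (F t)).

Lemma eq_cint F G a b : F =1 G -> cint F a b = cint G a b.
Proof. by move=> /funext ->. Qed.

Lemma ccurveD F G : ccurve F -> ccurve G -> ccurve (fun t => F t + G t).
Proof.
move=> [F1 F2] [G1 G2]; split.
- under eq_fun do rewrite cReD.
  by move=> x; apply: cvgD; [exact: F1|exact: G1].
- under eq_fun do rewrite cImD.
  by move=> x; apply: cvgD; [exact: F2|exact: G2].
Qed.

Lemma ccurveZ k F : ccurve F -> ccurve (fun t => k * F t).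
Proof.
move=> [F1 F2]; split.
- under eq_fun do rewrite cReM.
  by move=> x; apply: cvgB; apply: cvgMr; [exact: F1|exact: F2].
- under eq_fun do rewrite cImM.
  by move=> x; apply: cvgD; apply: cvgMr; [exact: F2|exact: F1].
Qed.

Lemma ccurve_cst k : ccurve (fun=> k).
Proof. by split; apply: cst_continuous. Qed.

Lemma cintD F G a b : ccurve F -> ccurve G ->
  cint (fun t => F t + G t) a b = cint F a b + cint G a b.
Proof.
move=> [F1 F2] [G1 G2]; rewrite /cint; apply: complex_eq; rewrite ?cReD ?cImD /=.
- rewrite -RintegralD //; try exact: continuous_integrable.
  by apply: eq_Rintegral => t _; rewrite cReD.
- rewrite -RintegralD //; try exact: continuous_integrable.
  by apply: eq_Rintegral => t _; rewrite cImD.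
Qed.

Lemma cintZ k F a b : ccurve F -> cint (fun t => k * F t) a b = k * cint F a b.
Proof.
move=> [F1 F2]; have ZF (u : R) (v : R -> R) : continuous v ->
    \int[mu]_(t in `[a, b]) (u * v t) = u * \int[mu]_(t in `[a, b]) v t.
  by move=> vc; rewrite RintegralZl //; exact: continuous_integrable.
have Zc (u : R) (v : R -> R) : continuous v -> mu.-integrable `[a, b] (EFin \o (fun t => u * v t)).
  by move=> vc; apply: continuous_integrable => x; apply: cvgMr; exact: vc.
rewrite /cint; apply: complex_eq; rewrite ?cReM ?cImM /=.
- rewrite -(ZF _ _ F1) -(ZF _ _ F2) -RintegralB //; try exact: Zc.
  by apply: eq_Rintegral => t _; rewrite cReM.
- rewrite -(ZF _ _ F1) -(ZF _ _ F2) -RintegralD //; try exact: Zc.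
  by apply: eq_Rintegral => t _; rewrite cImM.
Qed.

Lemma cintB F G a b : ccurve F -> ccurve G ->
  cint (fun t => F t - G t) a b = cint F a b - cint G a b.
Proof.
move=> cF cG; rewrite -mulN1r -cintZ // -cintD //; last exact: ccurveZ.
by apply: eq_cint => t; rewrite mulN1r.
Qed.

Lemma cint_cst k a b : a <= b -> cint (fun=> k) a b = k * (b - a)%:C.
Proof.
move=> ab; rewrite /cint !Rintegral_cst //= lebesgue_measure_itv /= lte_fin.
have -> : (fine (if a < b then (b%:E - a%:E)%E else 0%E) = b - a).
  by move: ab; rewrite le_eqVlt => /predU1P[->|->] //; rewrite ltxx subrr.
by apply: complex_eq; rewrite ?cReM ?cImM /= mulr0 ?subr0 // add0r.
Qed.

Lemma cint_split F a b c : ccurve F -> a <= b -> b <= c ->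
  cint F a c = cint F a b + cint F b c.
Proof.
move=> [F1 F2] ab bc; have H (v : R -> R) : continuous v ->
    \int[mu]_(t in `[a, c]) v t =
    \int[mu]_(t in `[a, b]) v t + \int[mu]_(t in `[b, c]) v t.
  move=> vc; have iv x y := continuous_integrable x y vc.
  have := @Rintegral_itvB R v (BLeft a) (BRight c) b (iv _ _).
  rewrite !bnd_simp => /(_ ab bc) /eqP; rewrite subr_eq addrC => /eqP ->.
  congr (_ + _); apply: Rintegral_itv_obnd_cbnd.
  apply: integrableS (iv b c) => //; exact: subset_itv_oc_cc.
by rewrite /cint; apply: complex_eq; rewrite ?cReD ?cImD /= (H _ F1, H _ F2).
Qed.

(** The factor 2 comes from bounding the real and the imaginary part separately. *)
Lemma cint_bound F a b M : ccurve F -> a <= b ->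
  (forall t, a <= t <= b -> modulus (F t) <= M) ->
  modulus (cint F a b) <= 2 * M * (b - a).
Proof.
move=> [F1 F2] ab FM; have H (v : R -> R) : continuous v ->
    (forall t, a <= t <= b -> `|v t| <= M) ->
    `|\int[mu]_(t in `[a, b]) v t| <= M * (b - a).
  move=> vc vM; apply: le_trans (le_normr_Rintegral _ _) _ => //.
    exact: continuous_integrable.
  have -> : M * (b - a) = \int[mu]_(t in `[a, b]) M.
    rewrite Rintegral_cst //= lebesgue_measure_itv /= lte_fin.
    by move: ab; rewrite le_eqVlt => /predU1P[->|->] //; rewrite ltxx subrr.
  apply: le_Rintegral => //.
  - by apply: continuous_integrable => x; apply: cvg_norm; exact: vc.
  - by apply: continuous_integrable => x; exact: cvg_cst.
have := modulus_le_ReIm (cint F a b); rewrite /cint /= => /le_trans -> //.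
have := H _ F1 (fun t tab => le_trans (Re_le_modulus _) (FM t tab)).
have := H _ F2 (fun t tab => le_trans (Im_le_modulus _) (FM t tab)).
by move=> A B; rewrite -mulrA mulr_natl mulr2n; apply: lerD.
Qed.

Lemma ccont_ccurve (g : R[i] -> R[i]) (p : R -> R[i]) :
  (forall s t, modulus (p t - p s) <= `|t - s|) ->
  (forall t, ccont g (p t)) -> ccurve (fun t => g (p t)).
Proof.
move=> pL gc; have H (u : R[i] -> R) : (forall z w, u (z - w) = u z - u w) ->
   (forall z, `|u z| <= modulus z) -> continuous (fun t => u (g (p t))).
  move=> uB uM t; apply/cvgrPdist_le => e e0.
  have [d d0 Hd] := gc t _ e0.
  near=> s; rewrite /= distrC -uB; apply: le_trans (uM _) _; apply: Hd.
  apply: le_lt_trans (pL _ _) _; rewrite distrC.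
  by near: s; apply: nbhs_dnbhs_neq || (apply/nbhs_ballP; exists d => //=).
split; apply: H.
- by move=> z w; rewrite cReD cReN.
- exact: Re_le_modulus.
- by move=> z w; rewrite cImD cImN.
- exact: Im_le_modulus.
Unshelve. all: by end_near. Qed.

End ContourIntegral.

(** * Goursat's theorem on rectangles *)

Section Goursat.
Context {R : realType}.
Variable g : R[i] -> R[i].
Hypothesis g_cont : forall z, ccont g z.
Implicit Types (x y w h : R).

Let hint y x1 x2 := cint (fun t => g (t +i* y)) x1 x2.
Let vint x y1 y2 := cint (fun t => g (x +i* t)) y1 y2.

Lemma ccurve_horizontal y : ccurve (fun t => g (t +i* y)).
Proof.
apply: (@ccont_ccurve R g (fun t => t +i* y)) => // s t.
rewrite (_ : _ - _ = (t - s)%:C) ?modulus_real //.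
by apply: complex_eq; rewrite ?cReD ?cImD ?cReN ?cImN //= subrr.
Qed.

Lemma ccurve_vertical x : ccurve (fun t => g (x +i* t)).
Proof.
apply: (@ccont_ccurve R g (fun t => x +i* t)) => // s t.
rewrite (_ : _ - _ = 'i * (t - s)%:C) ?modulusM ?modulusi ?mul1r ?modulus_real //.
apply: complex_eq; rewrite ?cReD ?cImD ?cReN ?cImN ?cReM ?cImM /= ?subrr; ring.
Qed.

Definition rect_int x y w h : R[i] :=
  hint y x (x + w) - hint (y + h) x (x + w)
  + 'i * (vint (x + w) y (y + h) - vint x y (y + h)).

Lemma rect_int_subdiv x y w h : 0 <= w -> 0 <= h ->
  rect_int x y (w + w) (h + h) =
  rect_int x y w h + rect_int (x + w) y w h + rect_int x (y + h) w h
  + rect_int (x + w) (y + h) w h.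
Proof.
move=> w0 h0; rewrite /rect_int !(addrA _ w w) !(addrA _ h h).
have Hs y' : hint y' x (x + w + w) = hint y' x (x + w) + hint y' (x + w) (x + w + w).
  by apply: cint_split; [exact: ccurve_horizontal|lra|lra].
have Vs x' : vint x' y (y + h + h) = vint x' y (y + h) + vint x' (y + h) (y + h + h).
  by apply: cint_split; [exact: ccurve_vertical|lra|lra].
by rewrite !Hs !Vs; ring.
Qed.

(** Opposite sides are paired. On each pair the affine function c + l z contributes a constant
    integrand, -i l h on the horizontal and l w on the vertical sides; the two constants cancel in
    [rect_int], and only the remainder g - c - l z is left. *)
Lemma rect_int_bound x y w h (c l : R[i]) M : 0 <= w -> 0 <= h ->
  (forall z, x <= complex.Re z <= x + w -> y <= complex.Im z <= y + h ->
     modulus (g z - c - l * z) <= M) ->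
  modulus (rect_int x y w h) <= 4 * M * (w + h).
Proof.
move=> w0 h0 H; have xw : x <= x + w by lra.
have yh : y <= y + h by lra.
pose r z := g z - c - l * z.
have Hh : modulus (hint y x (x + w) - hint (y + h) x (x + w) + 'i * l * (h * w)%:C)
    <= 2 * (2 * M) * (x + w - x).
  have -> : 'i * l * (h * w)%:C = cint (fun=> 'i * l * h%:C) x (x + w).
    rewrite cint_cst // addrAC subrr add0r.
    by rewrite rmorphM /= mulrA.
  rewrite -cintB; try exact: ccurve_horizontal.
  rewrite -cintD; last exact: ccurve_cst.
    apply: cint_bound => //.
      apply: ccurveD; last exact: ccurve_cst.
      apply: ccurveD; first exact: ccurve_horizontal.
      have := ccurveZ (-1) (ccurve_horizontal (y + h)).
      by under eq_fun do rewrite mulN1r.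
    move=> t xt; rewrite (_ : _ + _ = r (t +i* y) - r (t +i* (y + h))).
      apply: le_trans (modulusB_le _ _) _; rewrite mulr2n mulrDl mul1r.
      by apply: lerD; apply: H => //=; rewrite lexx ?yh.
    rewrite /r (_ : t +i* (y + h) = t +i* y + 'i * h%:C); first by ring.
    by apply: complex_eq; rewrite ?cReD ?cImD ?cReM ?cImM /=; ring.
  apply: ccurveD; first exact: ccurve_horizontal.
  have := ccurveZ (-1) (ccurve_horizontal (y + h)).
  by under eq_fun do rewrite mulN1r.
have Hv : modulus (vint (x + w) y (y + h) - vint x y (y + h) - l * (w * h)%:C)
    <= 2 * (2 * M) * (y + h - y).
  have -> : l * (w * h)%:C = cint (fun=> l * w%:C) y (y + h).
    rewrite cint_cst // addrAC subrr add0r.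
    by rewrite rmorphM /= mulrA.
  rewrite -cintB; try exact: ccurve_vertical.
  have cB : ccurve (fun t => g ((x + w) +i* t) - g (x +i* t)).
    apply: ccurveD; first exact: ccurve_vertical.
    have := ccurveZ (-1) (ccurve_vertical x).
    by under eq_fun do rewrite mulN1r.
  rewrite -cintB //; last exact: ccurve_cst.
  apply: cint_bound => //.
    by apply: ccurveD => //; exact: ccurve_cst.
  move=> t yt; rewrite (_ : _ - _ = r ((x + w) +i* t) - r (x +i* t)).
    apply: le_trans (modulusB_le _ _) _; rewrite mulr2n mulrDl mul1r.
    by apply: lerD; apply: H => //=; rewrite lexx ?xw.
  rewrite /r (_ : (x + w) +i* t = x +i* t + w%:C); first by ring.
  by apply: complex_eq; rewrite ?cReD ?cImD /=; ring.
rewrite /rect_int.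
have -> : hint y x (x + w) - hint (y + h) x (x + w) +
    'i * (vint (x + w) y (y + h) - vint x y (y + h)) =
    (hint y x (x + w) - hint (y + h) x (x + w) + 'i * l * (h * w)%:C) +
    'i * (vint (x + w) y (y + h) - vint x y (y + h) - l * (w * h)%:C).
  by rewrite (mulrC h w); ring.
apply: le_trans (modulusD_le _ _) _; rewrite modulusM modulusi mul1r.
apply: le_trans (lerD Hh Hv) _; nra.
Qed.

Lemma goursat x y w h : 0 <= w -> 0 <= h ->
  (forall z, x <= complex.Re z <= x + w -> y <= complex.Im z <= y + h ->
    exists l, cdiff g z l) ->
  rect_int x y w h = 0.
Proof.
move=> w0 h0 Hd; apply/eqP; rewrite -modulus_eq0 eq_le modulus_ge0 andbT.
pose Psi x y s := modulus (rect_int x y (w * s) (h * s)).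
have -> : modulus (rect_int x y w h) = Psi x y 1 by rewrite /Psi !mulr1.
apply: (@subdivision_le0 R w h) => //.
- move=> x' y' s s0; rewrite /Psi !mulrDr.
  rewrite (rect_int_subdiv _ _ (mulr_ge0 w0 (ltW s0)) (mulr_ge0 h0 (ltW s0))).
  apply: le_trans (modulusD_le _ _) _; rewrite lerD2r.
  by apply: le_trans (modulusD_le _ _) _; rewrite lerD2r modulusD_le.
- move=> x1 y1 xx1 yy1 e e0.
  rewrite !mulr1 in xx1 yy1.
  (* The remainder is at most e' (w + h + 1) s on a rectangle of half-perimeter (w + h) s, and
     [rect_int_bound] contributes the factor 4; the summand 1 keeps the denominator positive for
     degenerate rectangles. *)
  have [l /(_ (e / (4 * (w + h + 1) ^+ 2))) []] := Hd (x1 +i* y1) xx1 yy1.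
    by rewrite divr_gt0 // mulr_gt0 // exprn_gt0 //; lra.
  move=> d d0 Hl; exists (d / (w + h + 1)); first by rewrite divr_gt0 //; lra.
  move=> x' y' s /andP[s0 sd] xx' yy' _ _ _ _.
  set e' := e / _ in Hl.
  have e'0 : 0 < e' by rewrite divr_gt0 // mulr_gt0 // exprn_gt0 //; lra.
  have sd' : (w + h + 1) * s < d by rewrite mulrC -ltr_pdivlMr //; lra.
  have := @rect_int_bound x' y' (w * s) (h * s) (g (x1 +i* y1) - l * (x1 +i* y1)) l
    (e' * ((w + h + 1) * s)).
  move=> /(_ (mulr_ge0 w0 (ltW s0)) (mulr_ge0 h0 (ltW s0))) H.
  apply: le_trans (H _) _ => {H}.
    move=> z xz yz.
    have zd : modulus (z - (x1 +i* y1)) <= (w + h) * s.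
      apply: le_trans (modulus_le_ReIm _) _.
      rewrite cReD cImD cReN cImN /= mulrDl; apply: lerD; rewrite ler_norml; lra.
    have zd' : modulus (z - (x1 +i* y1)) <= (w + h + 1) * s by lra.
    have := Hl (z - (x1 +i* y1)) (le_lt_trans zd' sd').
    rewrite [x1 +i* y1 + _]addrC subrK => Hz.
    rewrite (_ : _ - _ = g z - g (x1 +i* y1) - l * (z - (x1 +i* y1))); last by ring.
    by apply: le_trans Hz _; rewrite ler_wpM2l // ltW.
  rewrite -mulrDl.
  have -> : e * s ^+ 2 = 4 * (e' * ((w + h + 1) * s)) * ((w + h + 1) * s).
    by rewrite /e'; field; lra.
  have s0' := ltW s0; apply: ler_wpM2l.
    apply: mulr_ge0 => //; apply: mulr_ge0; first exact: ltW.
    by apply: mulr_ge0 => //; lra.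
  by apply: ler_wpM2r => //; lra.
Qed.

End Goursat.

(** * Complex derivatives and the exponential *)

Section ComplexDerivatives.
Context {R : realType}.
Implicit Types (f g : R[i] -> R[i]) (z w : R[i]).

Definition cderivable f z := exists l, cdiff f z l.

Lemma cderivableE f z :
  cderivable f z <-> differentiable (f : (R[i])^o -> (R[i])^o) (z : (R[i])^o).
Proof. by rewrite -derivable1_diffP; split=> /derivable_cdiff. Qed.

Lemma cderivable_ccont f z : cderivable f z -> ccont f z.
Proof. by case=> l; exact: cdiff_ccont. Qed.

Lemma cderivable_id z : cderivable id z.
Proof. by apply/cderivableE; apply/derivable1_diffP; apply: derivable_id. Qed.

Lemma cderivable_cst (k : R[i]) z : cderivable (fun=> k) z.
Proof. by apply/cderivableE; apply: differentiable_cst. Qed.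

Lemma cderivableM f g z : cderivable f z -> cderivable g z ->
  cderivable (fun w => f w * g w) z.
Proof. by move=> /cderivableE df /cderivableE dg; apply/cderivableE; exact: differentiableM. Qed.

Lemma cderivableB f g z : cderivable f z -> cderivable g z ->
  cderivable (fun w => f w - g w) z.
Proof. by move=> /cderivableE df /cderivableE dg; apply/cderivableE; exact: differentiableB. Qed.

Lemma cderivableX f n z : cderivable f z -> cderivable (fun w => f w ^+ n) z.
Proof.
move=> df; elim: n => [|n IH]; first exact: cderivable_cst.
by under eq_fun do rewrite exprS; exact: cderivableM.
Qed.

Lemma cderivableV f z : f z != 0 -> cderivable f z -> cderivable (fun w => (f w)^-1) z.
Proof.
move=> f0 /cderivableE df; apply/cderivableE/derivable1_diffP.
by apply: derivableV => //; apply/derivable1_diffP.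
Qed.

Lemma cderivable_comp f g z : cderivable f z -> cderivable g (f z) ->
  cderivable (fun w => g (f w)) z.
Proof. move=> /cderivableE df /cderivableE dg; apply/cderivableE.
exact: (@differentiable_comp _ (R[i])^o (R[i])^o (R[i])^o f g z df dg). Qed.

Lemma cderivable_local f g z (d : R) : 0 < d ->
  (forall w, modulus (w - z) < d -> f w = g w) -> cderivable g z -> cderivable f z.
Proof.
move=> d0 fg [l Hl]; exists l => eps eps0; have [d' d'0 Hd'] := Hl _ eps0.
exists (Num.min d d'); first by rewrite lt_min d0.
move=> h; rewrite lt_min => /andP[hd hd'].
rewrite !fg ?subrr ?modulus0 //; first exact: Hd'.
by rewrite addrC addKr.
Qed.

Definition cexp w : R[i] := (expR (complex.Re w))%:C * expi (complex.Im w).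

Lemma cexpD z w : cexp (z + w) = cexp z * cexp w.
Proof. by rewrite /cexp cReD cImD expRD expiD rmorphM /=; ring. Qed.

Lemma modulus_cexp w : modulus (cexp w) = expR (complex.Re w).
Proof. by rewrite modulusM modulus_expi mulr1 modulus_real ger0_norm ?expR_ge0. Qed.

Lemma cexp0 : cexp 0 = 1.
Proof. by rewrite /cexp /= expR0 expi0 mulr1. Qed.

Lemma cexp_neq0 w : cexp w != 0.
Proof. by rewrite -modulus_gt0 modulus_cexp expR_gt0. Qed.

Lemma is_derive_eps (u : R -> R) (x l : R) : is_derive x 1 u l ->
  forall eps, 0 < eps -> exists2 d : R, 0 < d & forall h,
    `|h| < d -> `|u (x + h) - u x - l * h| <= eps * `|h|.
Proof.
move=> [du <-] eps eps0; move: du => /cvg_ex [l' Hl'].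
have -> : 'D_1 u x = l' by apply/cvg_lim.
move: Hl' => /cvgrPdist_le /(_ _ eps0).
rewrite /prop_near1 /= => /nbhs_ballP [d /= d0 Hd]; exists d => // h hd.
have [->|h0] := eqVneq h 0; first by rewrite addr0 subrr mulr0 subrr normr0 mulr0.
have := Hd h; rewrite /ball /= sub0r normrN => /(_ hd h0) H.
have -> : u (x + h) - u x - l' * h = - ((l' - h^-1 * (u (h * 1 + x) - u x)) * h).
  by rewrite mulrBl mulrAC mulVf // mul1r mulr1 (addrC h) opprB.
by rewrite normrN normrM ler_wpM2r.
Qed.

Lemma cderivable_cexp w : cderivable cexp w.
Proof.
(* The functional equation transports differentiability from the origin to any point. *)
suff [l Hl] : cderivable cexp 0.
  exists (cexp w * l) => eps eps0.
  have M0 : 0 < modulus (cexp w) by rewrite modulus_gt0 cexp_neq0.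
  have [d d0 Hd] := Hl (eps / modulus (cexp w)) (divr_gt0 eps0 M0).
  exists d => // h /Hd; rewrite add0r cexp0 cexpD => H.
  have -> : cexp w * cexp h - cexp w - cexp w * l * h =
    cexp w * (cexp h - 1 - l * h) by ring.
  by rewrite modulusM mulrC -ler_pdivlMr // mulrAC.
exists 1 => eps eps0.
(* Seven is the total of the coefficients in the bounds T1 to T5 below; the cap 1 gives |1 + x| <=
   2. *)
pose e := Num.min 1 (eps / 7).
have e0 : 0 < e by rewrite lt_min ltr01 divr_gt0.
have e1 : e <= 1 by rewrite ge_min lexx.
have ee : 7 * e <= eps.
  by rewrite mulrC -ler_pdivlMr // ge_min lexx orbT.
have [d1 d10 H1] := is_derive_eps (is_derive_expR 0) e0.
have [d2 d20 H2] := is_derive_eps (is_derive_cos 0) e0.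
have [d3 d30 H3] := is_derive_eps (is_derive_sin 0) e0.
clearbody e.
exists (Num.min e (Num.min d1 (Num.min d2 d3))); first by rewrite !lt_min e0 d10 d20.
case=> x y; rewrite !lt_min => /and4P[he h1 h2 h3].
have xh : `|x| <= modulus (x +i* y) := Re_le_modulus (x +i* y).
have yh : `|y| <= modulus (x +i* y) := Im_le_modulus (x +i* y).
set m := modulus _ in he h1 h2 h3 xh yh *.
have := H1 x (le_lt_trans xh h1); have := H2 y (le_lt_trans yh h2).
have := H3 y (le_lt_trans yh h3).
rewrite !add0r expR0 cos0 sin0 !oppr0 !addr0 !mul0r !subr0 !mul1r => S C E.
rewrite cexp0; apply: le_trans (modulus_le_ReIm _) _.
rewrite /cexp !cReD !cImD !cReN !cImN !cReM !cImM /= !mul0r !subr0 !addr0.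
have -> : expR x * cos y - 1 - x =
  (expR x - 1 - x) * cos y + (1 + x) * (cos y - 1) by ring.
have -> : expR x * sin y - y =
  (expR x - 1 - x) * sin y + ((1 + x) * (sin y - y) + x * y) by ring.
have c1 : `|cos y| <= 1 by rewrite ler_norml cos_geN1 cos_le1.
have s1 : `|sin y| <= 1 by rewrite ler_norml sin_geN1 sin_le1.
have x1 : `|1 + x| <= 2.
  apply: le_trans (ler_normD _ _) _; rewrite normr1; lra.
have m0 : 0 <= m := modulus_ge0 _.
have T1 : `|(expR x - 1 - x) * cos y| <= e * m.
  rewrite normrM -[leRHS]mulr1; apply: ler_pM => //.
  by apply: le_trans E _; rewrite ler_wpM2l // ltW.
have T2 : `|(1 + x) * (cos y - 1)| <= 2 * (e * m).
  rewrite normrM; apply: ler_pM => //.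
  by apply: le_trans C _; rewrite ler_wpM2l // ltW.
have T3 : `|(expR x - 1 - x) * sin y| <= e * m.
  rewrite normrM -[leRHS]mulr1; apply: ler_pM => //.
  by apply: le_trans E _; rewrite ler_wpM2l // ltW.
have T4 : `|(1 + x) * (sin y - y)| <= 2 * (e * m).
  rewrite normrM; apply: ler_pM => //.
  by apply: le_trans S _; rewrite ler_wpM2l // ltW.
have T5 : `|x * y| <= e * m.
  by rewrite normrM; apply: ler_pM => //; apply: le_trans xh _; exact: ltW.
apply: le_trans (lerD (ler_normD _ _) (ler_normD _ _)) _.
apply: le_trans (lerD (lerD T1 T2) (lerD T3 (ler_normD _ _))) _.
apply: le_trans (lerD (lexx _) (lerD (lexx _) (lerD T4 T5))) _.
have := ler_wpM2r m0 ee; lra.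
Qed.

Lemma cexp_2pi : cexp (0 +i* (pi *+ 2)) = 1.
Proof. by rewrite /cexp /= expR0 /expi cos2pi sin2pi mul1r. Qed.

End ComplexDerivatives.

Lemma ccontM {R : realType} (f g : R[i] -> R[i]) z : ccont f z -> ccont g z ->
  ccont (fun w => f w * g w) z.
Proof.
move=> cf cg eps eps0.
have e1 : 0 < eps / (2 * (1 + modulus (g z))).
  by rewrite divr_gt0 // mulr_gt0 // ltr_pwDl // modulus_ge0.
have e2 : 0 < Num.min 1 (eps / (2 * (1 + modulus (f z)))).
  by rewrite lt_min ltr01 divr_gt0 // mulr_gt0 // ltr_pwDl // modulus_ge0.
have [d1 d10 Hd1] := cf _ e1; have [d2 d20 Hd2] := cg _ e2.
exists (Num.min d1 d2); first by rewrite lt_min d10.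
move=> u; rewrite lt_min => /andP[/Hd1 h1 /Hd2]; rewrite le_min => /andP[h2 h3].
have -> : f u * g u - f z * g z = (f u - f z) * g u + f z * (g u - g z) by ring.
apply: le_trans (modulusD_le _ _) _; rewrite !modulusM (splitr eps); apply: lerD.
  have -> : eps / 2 = eps / (2 * (1 + modulus (g z))) * (1 + modulus (g z)).
    by field; rewrite gt_eqF // ltr_pwDl // modulus_ge0.
  apply: ler_pM; rewrite ?modulus_ge0 //.
  rewrite -{1}(subrK (g z) (g u)); apply: le_trans (modulusD_le _ _) _.
  by rewrite lerD2r.
have -> : eps / 2 = (1 + modulus (f z)) * (eps / (2 * (1 + modulus (f z)))).
  by field; rewrite gt_eqF // ltr_pwDl // modulus_ge0.
by apply: ler_pM; rewrite ?modulus_ge0 // lerDr.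
Qed.

(** * Cauchy integrals over circles and convergence of the Taylor series *)

Section Taylor.
Context {R : realType}.
Implicit Types (G : R[i] -> R[i]) (z w : R[i]) (x : R).

Lemma bounded_curve (F : R -> R[i]) a b : a <= b -> ccurve F ->
  exists2 M : R, 0 <= M & forall t, a <= t <= b -> modulus (F t) <= M.
Proof.
move=> ab [F1 F2].
have [c _ Hc] : exists2 c : R, c \in `[a, b] & forall t : R, t \in `[a, b] ->
   `|complex.Re (F t)| + `|complex.Im (F t)| <=
   `|complex.Re (F c)| + `|complex.Im (F c)|.
  apply: (@EVT_max R (fun t => `|complex.Re (F t)| + `|complex.Im (F t)|)) => //.
  apply: continuous_subspaceT => t; apply: cvgD; apply: cvg_norm; [exact: F1|exact: F2].
exists (`|complex.Re (F c)| + `|complex.Im (F c)|); first by rewrite addr_ge0.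
move=> t tab; apply: le_trans (modulus_le_ReIm _) _; apply: Hc.
by rewrite in_itv.
Qed.

(** Compactness of the segment makes continuity in the abscissa uniform in t; this gives continuity
    of vertical integrals as functions of x. *)
Lemma uniform_ccont G (x a b : R) : (forall z, ccont G z) ->
  forall e : R, 0 < e -> exists2 d : R, 0 < d & forall y t : R, `|y - x| < d ->
    a <= t <= b -> modulus (G (y +i* t) - G (x +i* t)) <= e.
Proof.
move=> Gc e e0.
have /compact_near_coveringP cov := @segment_compact R a b.
have /nbhs_ballP [d d0 Hd] : \forall y \near x, `[a, b]%classic `<=`
    [set t | modulus (G (y +i* t) - G (x +i* t)) <= e].
  apply: (cov R (nbhs x) (fun y t => modulus (G (y +i* t) - G (x +i* t)) <= e)) => t _.
  have [d d0 Hd] := Gc (x +i* t) _ (divr_gt0 e0 (ltr0Sn R 1)).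
  have d2 : 0 < d / 2 by rewrite divr_gt0.
  exists (ball t (d / 2), ball x (d / 2)).
    by split; apply: nbhsx_ballx.
  move=> [t' y'] [/= ht hy]; rewrite /ball /= in ht hy.
  have E (u : R) : `|x - u| < d / 2 -> modulus (G (u +i* t') - G (x +i* t)) <= e / 2.
    move=> ux; apply: Hd; apply: le_lt_trans (modulus_le_ReIm _) _.
    by rewrite cReD cImD cReN cImN /= (distrC u) (distrC t') (splitr d) ltrD.
  rewrite (_ : _ - _ = (G (y' +i* t') - G (x +i* t)) - (G (x +i* t') - G (x +i* t))).
    apply: le_trans (modulusB_le _ _) _; rewrite (splitr e); apply: lerD; apply: E => //.
    by rewrite subrr normr0.
  by ring.
exists d => // y t yx tab; apply: (Hd y); last by rewrite /= in_itv.
by rewrite /ball /= distrC.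
Qed.

Let vint G x := cint (fun t => G (x +i* t)) 0 (pi *+ 2).

Let twopi_gt0 : 0 < pi *+ 2 :> R.
Proof. by rewrite mulrn_wgt0 // pi_gt0. Qed.

(** By periodicity the two horizontal sides of a rectangle of height 2 pi cancel, so Goursat's
    theorem equates the two vertical ones. *)
Lemma strip_const G x1 x2 : x1 <= x2 -> (forall z, ccont G z) ->
  (forall z, x1 <= complex.Re z <= x2 -> cderivable G z) ->
  (forall z, G (z + 0 +i* (pi *+ 2)) = G z) -> vint G x1 = vint G x2.
Proof.
move=> x12 Gc Gd Gp.
have w0 : 0 <= x2 - x1 by rewrite subr_ge0.
have := @goursat R G Gc x1 0 (x2 - x1) (pi *+ 2) w0 (ltW twopi_gt0).
rewrite [x1 + _]addrC subrK => /(_ _).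
have H z : x1 <= complex.Re z <= x2 -> 0 <= complex.Im z <= 0 + pi *+ 2 ->
    exists l, cdiff G z l by move=> /Gd.
move=> /(_ H); rewrite /rect_int [x1 + _]addrC subrK add0r.
rewrite (_ : cint (fun t => G (t +i* (pi *+ 2))) _ _ = cint (fun t => G (t +i* 0)) x1 x2).
  rewrite subrr add0r => /eqP; rewrite mulf_eq0 => /orP[|].
    by rewrite -modulus_eq0 modulusi oner_eq0.
  by rewrite subr_eq0 => /eqP E; rewrite /vint E.
apply: eq_cint => t; rewrite -[RHS]Gp; congr G.
by apply: complex_eq; rewrite ?cReD ?cImD /= ?addr0 ?add0r.
Qed.

Lemma vint_bound G x M : (forall z, ccont G z) ->
  (forall t, modulus (G (x +i* t)) <= M) -> modulus (vint G x) <= 2 * M * (pi *+ 2).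
Proof.
move=> Gc GM; rewrite -[X in _ * X]subr0; apply: cint_bound => //.
- exact: ccurve_vertical.
- exact: ltW.
Qed.

Lemma cexp_periodic z : cexp (z + 0 +i* (pi *+ 2)) = cexp z.
Proof. by rewrite cexpD cexp_2pi mulr1. Qed.

Let cexpVX n w : R[i] := (cexp w)^-1 ^+ n.

Let modulus_cexpVX n w : modulus (cexpVX n w) = (expR (complex.Re w))^-1 ^+ n.
Proof. by rewrite modulusX modulusV modulus_cexp. Qed.

Let cderivable_cexpVX n w : cderivable (cexpVX n) w.
Proof.
apply: cderivableX; apply: cderivableV; first exact: cexp_neq0.
exact: cderivable_cexp.
Qed.

(** For n > 0 the integral is independent of x and becomes arbitrarily small as x grows, hence it
    vanishes. *)
Lemma vint_cexpVX n x : vint (cexpVX n) x = if n == 0%N then (pi *+ 2)%:C else 0.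
Proof.
have cn w := cderivable_ccont (cderivable_cexpVX n w).
case: n cn => [|n] cn /=.
  rewrite /vint /cexpVX (eq_cint (G := fun=> 1)) ?cint_cst ?subr0 ?mul1r //.
  exact: ltW.
have const x1 x2 : vint (cexpVX n.+1) x1 = vint (cexpVX n.+1) x2.
  wlog x12 : x1 x2 / x1 <= x2.
    move=> W; have [/W //|/ltW/W -> //] := leP x1 x2.
  apply: (strip_const x12) => [//|z _|z]; first exact: cderivable_cexpVX.
  by rewrite /cexpVX cexp_periodic.
apply: modulus_le0_eq0 => e e0.
pose k := 2 * (pi *+ 2) : R.
have k0 : 0 < k by rewrite mulr_gt0.
pose e' := Num.min 1 (e / k).
have e'0 : 0 < e' by rewrite lt_min ltr01 divr_gt0.
have e'1 : e' <= 1 by rewrite ge_min lexx.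
have e'e : e' * k <= e by rewrite -ler_pdivlMr // ge_min lexx orbT.
rewrite (const x (- ln e')).
have := @vint_bound (cexpVX n.+1) (- ln e') e' cn.
move=> /(_ _)/le_trans -> //.
  by move=> t; rewrite modulus_cexpVX /= expRN invrK lnK // exprS ler_piMr ?exprn_ile1 // ltW.
by rewrite mulrC mulrA -/k mulrC (mulrC _ 2) -/k.
Qed.

Variable f : R[i] -> R[i].
Hypothesis f_der : forall z, cderivable f z.

(* The exponential maps vertical segments to circles, so Goursat's theorem on
   rectangles shows that the Fourier coefficients do not depend on the radius. *)
Let G n w := f (cexp w) * cexpVX n w.

Let G_der n w : cderivable (G n) w.
Proof.
apply: cderivableM; last exact: cderivable_cexpVX.
apply: cderivable_comp; [exact: cderivable_cexp|exact: f_der].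
Qed.

Let G_const n x1 x2 : vint (G n) x1 = vint (G n) x2.
Proof.
wlog x12 : x1 x2 / x1 <= x2.
  move=> W; have [/W //|/ltW/W -> //] := leP x1 x2.
apply: (strip_const x12) => [z|z _|z].
- exact: cderivable_ccont (G_der n z).
- exact: G_der.
- by rewrite /G /cexpVX cexp_periodic.
Qed.

(** Cauchy's integral over the unit circle, the image of abscissa 0 under the exponential. *)
Definition taylor_coef n : R[i] := vint (G n) 0 / (pi *+ 2)%:C.

Lemma taylor_coef_rapid r : 0 < r ->
  exists M, forall n, modulus (taylor_coef n) * r ^+ n <= M.
Proof.
move=> r0; have cf w : cderivable (fun w => f (cexp w)) w.
  by apply: cderivable_comp; [exact: cderivable_cexp|exact: f_der].
have cc w := cderivable_ccont (cf w).
have [M M0 HM] := bounded_curve (ltW twopi_gt0) (ccurve_vertical cc (ln r)).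
exists (2 * M) => n; rewrite /taylor_coef (G_const n 0 (ln r)) modulus_div modulus_real.
rewrite gtr0_norm // mulrAC ler_pdivrMr // -ler_pdivlMr ?exprn_gt0 //.
have -> : 2 * M * (pi *+ 2) / r ^+ n = 2 * (M * r^-1 ^+ n) * (pi *+ 2 - 0).
  by rewrite subr0 exprVn; field; rewrite expf_neq0 // gt_eqF.
apply: cint_bound => [||t tpi]; [|exact: ltW|].
  by apply: ccurve_vertical => z; apply: cderivable_ccont.
rewrite modulusM modulus_cexpVX /= lnK //; apply: ler_wpM2r; last exact: HM.
by rewrite exprn_ge0 // invr_ge0 ltW.
Qed.

(* At z0 the quotient is only known to be continuous, which is enough because its
   integrals over vertical segments are continuous in the abscissa; its Laurent
   coefficients then telescope to the Taylor sums of f. *)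
Let Q z0 l z := if z == z0 then l else (f z - f z0) / (z - z0).

Let Q_der z0 l z : z != z0 -> cderivable (Q z0 l) z.
Proof.
move=> zz0; apply: (@cderivable_local R _ (fun z => (f z - f z0) / (z - z0)) _ (modulus (z - z0))).
- by rewrite modulus_gt0 subr_eq0.
- move=> w; rewrite /Q; case: eqVneq => // ->.
  by rewrite modulusB ltxx.
- apply: cderivableM.
    by apply: cderivableB => //; exact: cderivable_cst.
  apply: cderivableV; first by rewrite subr_eq0.
  by apply: cderivableB; [exact: cderivable_id|exact: cderivable_cst].
Qed.

Let Q_cont z0 l z : cdiff f z0 l -> ccont (Q z0 l) z.
Proof.
move=> H; have [->|zz0] := eqVneq z z0; last exact/cderivable_ccont/Q_der.
move=> e e0; have [d d0 Hd] := H _ e0; exists d => // w /Hd.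
rewrite (addrC z0) subrK /Q eqxx; case: eqVneq => [->|wz0 Hw].
  by move=> _; rewrite subrr modulus0; exact: ltW.
have m0 : 0 < modulus (w - z0) by rewrite modulus_gt0 subr_eq0.
rewrite -(ler_pM2r m0) -modulusM mulrBl divfK // subr_eq0 //.
Qed.

Let QE z0 l z : f z - f z0 = (z - z0) * Q z0 l z.
Proof.
rewrite /Q; case: eqVneq => [->|zz0]; first by rewrite !subrr mul0r.
by rewrite mulrC divfK // subr_eq0.
Qed.

Lemma taylor_cvg z0 e : 0 < e -> exists N0, forall N, (N0 <= N)%N ->
  modulus (f z0 - \sum_(n < N) taylor_coef n * z0 ^+ n) <= e.
Proof.
move=> e0; have [l Hl] := f_der z0.
(* Under z = e^w, H dw is Q dz, so these vertical integrals are the circle integrals of Q up to the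
   factor i. *)
pose H w := Q z0 l (cexp w) * cexp w.
have Qexp_cont w : ccont (fun w => Q z0 l (cexp w)) w.
  move=> eps eps0; have [d d0 Hd] := Q_cont (cexp w) Hl eps0.
  have [d' d'0 Hd'] := cderivable_ccont (cderivable_cexp w) (divr_gt0 d0 (ltr0Sn R 1)).
  exists d' => // u /Hd' Hu; apply: Hd; apply: le_lt_trans Hu _.
  by rewrite ltr_pdivrMr // mulr2n mulrDr mulr1 ltrDl.
have H_cont w : ccont H w.
  by apply: ccontM => //; exact/cderivable_ccont/cderivable_cexp.
have H_per z : H (z + 0 +i* (pi *+ 2)) = H z by rewrite /H cexp_periodic.
(* For z0 = 0 this is the default value 0; since e^w is never 0, H is then differentiable everywhere
   and the excluded abscissa is harmless. *)
pose x0 := ln (modulus z0).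
have H_der z : complex.Re z != x0 -> cderivable H z.
  move=> zx0; apply: cderivableM; last exact: cderivable_cexp.
  apply: cderivable_comp; first exact: cderivable_cexp.
  apply: Q_der; apply: contra zx0 => /eqP E.
  by rewrite /x0 -E modulus_cexp expRK.
(* To the left of x0 the segment is pushed towards minus infinity, where Q stays bounded and the
   factor e^w tends to 0. *)
have Hl0 x : x < x0 -> vint H x = 0.
  move=> xx0; apply: modulus_le0_eq0 => eps eps0.
  have [d d0 Hd] := Q_cont 0 Hl ltr01.
  pose K := (1 + modulus (Q z0 l 0)).
  have K0 : 0 < K by rewrite ltr_pwDl // modulus_ge0.
  pose k := 2 * (pi *+ 2) * K : R.
  have k0 : 0 < k by rewrite !mulr_gt0.
  pose y := Num.min x (Num.min (ln (d / 2)) (ln (eps / k))).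
  have yx : y <= x by rewrite ge_min lexx.
  have yd : expR y <= d / 2.
    by rewrite -[leRHS]lnK ?posrE ?divr_gt0 // ler_expR !ge_min lexx ?orbT.
  have ye : expR y * k <= eps.
    rewrite -ler_pdivlMr //.
    by rewrite -[leRHS]lnK ?posrE ?divr_gt0 // ler_expR !ge_min lexx ?orbT.
  rewrite -(@strip_const H y x) // => [|z /andP[_ zx]]; last first.
    by apply: H_der; rewrite lt_eqF // (le_lt_trans zx).
  apply: le_trans (vint_bound (M := K * expR y) _ _) _ => //.
    move=> t; rewrite modulusM modulus_cexp /= ler_wpM2r ?expR_ge0 //.
    rewrite -(subrK (Q z0 l 0) (Q z0 l (cexp _))); apply: le_trans (modulusD_le _ _) _.
    rewrite /K lerD2r; apply: Hd; rewrite subr0 modulus_cexp /=.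
    by apply: le_lt_trans yd _; rewrite ltr_pdivrMr // mulr2n mulrDr mulr1 ltrDl.
  by apply: le_trans ye; rewrite /k le_eqVlt; apply/orP; left; apply/eqP; ring.
have H_close eps : 0 < eps -> exists2 d : R, 0 < d & forall y, `|y - x0| < d ->
    modulus (vint H y - vint H x0) <= eps.
  move=> eps0; have k0 : 0 < 2 * (pi *+ 2) :> R by rewrite mulr_gt0.
  have [d d0 Hd] := uniform_ccont x0 0 (pi *+ 2) H_cont (divr_gt0 eps0 k0).
  exists d => // y yx0; rewrite /vint -cintB; try exact: ccurve_vertical.
  have -> : eps = 2 * (eps / (2 * (pi *+ 2))) * (pi *+ 2 - 0).
    by rewrite subr0 mulrAC mulrC divfK // gt_eqF.
  apply: cint_bound; last by move=> t; exact: Hd.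
    apply: ccurveD; first exact: ccurve_vertical.
    have := ccurveZ (-1) (ccurve_vertical H_cont x0).
    by under eq_fun do rewrite mulN1r.
  exact: ltW.
have H00 : vint H x0 = 0.
  apply: modulus_le0_eq0 => eps eps0; have [d d0 Hd] := H_close _ eps0.
  have := Hd (x0 - d / 2); rewrite Hl0; last by rewrite gtrBl divr_gt0.
  rewrite sub0r modulusN; apply.
  by rewrite addrAC subrr add0r normrN gtr0_norm ?divr_gt0 // ltr_pdivrMr // mulr2n mulrDr mulr1 ltrDl.
have Hr0 x : x0 < x -> vint H x = 0.
  move=> x0x; apply: modulus_le0_eq0 => eps eps0; have [d d0 Hd] := H_close _ eps0.
  pose y := Num.min x (x0 + d / 2).
  have d2 : 0 < d / 2 by rewrite divr_gt0.
  have yx : y <= x by rewrite ge_min lexx.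
  have x0y : x0 < y by rewrite lt_min x0x ltrDl.
  have yd : y <= x0 + d / 2 by rewrite ge_min lexx orbT.
  rewrite -(@strip_const H y x) // => [|z /andP[yz _]]; last first.
    by apply: H_der; rewrite gt_eqF // (lt_le_trans x0y).
  have := Hd y; rewrite H00 subr0; apply.
  rewrite gtr0_norm ?subr_gt0 // ltrBlDl; apply: le_lt_trans yd _.
  by rewrite ltrD2l ltr_pdivrMr // mulr2n mulrDr mulr1 ltrDl.
(* The first entry keeps x to the right of x0; the second makes r = exp x larger than |z0|, so that
   the remainder z0^(N+1) q_N decays like (|z0| / r)^N. *)
pose x := Num.max (x0 + 1) (ln (modulus z0 + 1)).
have x0x : x0 < x by rewrite lt_max ltrDl ltr01.
have z01 : 0 < modulus z0 + 1 by rewrite ltr_wpDl // modulus_ge0.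
pose r := expR x.
have r0 : 0 < r by rewrite expR_gt0.
have rz0 : modulus z0 < r.
  rewrite (@lt_le_trans _ _ (modulus z0 + 1)) ?ltrDl // /r -[leLHS]lnK ?posrE //.
  by rewrite ler_expR le_max lexx orbT.
pose q n := vint (fun w => Q z0 l (cexp w) * cexpVX n w) x.
have q_cont n w : ccont (fun w => Q z0 l (cexp w) * cexpVX n w) w.
  by apply: ccontM => //; exact/cderivable_ccont/cderivable_cexpVX.
have coefE n : taylor_coef n * (pi *+ 2)%:C = vint (G n) x.
  rewrite /taylor_coef divfK; first exact: G_const.
  by rewrite -modulus_eq0 modulus_real normr_eq0 gt_eqF.
have GE n w : G n w = f z0 * cexpVX n w
      + (cexp w * (Q z0 l (cexp w) * cexpVX n w) - z0 * (Q z0 l (cexp w) * cexpVX n w)).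
  have := QE z0 l (cexp w); rewrite /G; set u := f _; set v := f z0.
  by move=> /eqP; rewrite subr_eq => /eqP ->; ring.
(* Recurrence for the Laurent coefficients of Q. The term q_(-1) would be the integral of H, which
   is 0 by [Hr0]; hence the value 0 at n = 0. *)
have qS n : taylor_coef n * (pi *+ 2)%:C =
    f z0 * vint (cexpVX n) x + (if n is m.+1 then q m else 0) - z0 * q n.
  have c1 := ccurve_vertical (fun w => cderivable_ccont (cderivable_cexpVX n w)) x.
  have c2 := ccurve_vertical (q_cont n) x.
  have c3 : ccurve (fun t => cexp (x +i* t) *
      (Q z0 l (cexp (x +i* t)) * cexpVX n (x +i* t))).
    apply: (@ccurve_vertical R (fun w => cexp w * (Q z0 l (cexp w) * cexpVX n w))) => w.
    by apply: ccontM; [exact/cderivable_ccont/cderivable_cexp|exact: q_cont].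
  rewrite coefE {1}/vint (eq_cint _ _ (fun t => GE n (x +i* t))).
  rewrite cintD; [|exact: ccurveZ|]; last first.
    apply: ccurveD => //; have := ccurveZ (- z0) c2.
    by under eq_fun do rewrite mulNr.
  rewrite cintB //; last exact: ccurveZ.
  rewrite !cintZ // -/(vint _ x) -/(vint _ x) -/(q n) addrA; congr (_ + _ - _).
  case: n {c1 c2 c3} => [|n].
    rewrite -(Hr0 _ x0x) /vint; apply: eq_cint => t.
    by rewrite /cexpVX expr0 mulr1 mulrC.
  apply: eq_cint => t; rewrite /cexpVX exprS mulrC -mulrA; congr (_ * _).
  by rewrite mulrAC mulVf ?mul1r // cexp_neq0.
have sumE N : (\sum_(n < N.+1) taylor_coef n * z0 ^+ n) * (pi *+ 2)%:C =
    f z0 * (pi *+ 2)%:C - z0 ^+ N.+1 * q N.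
  elim: N => [|N IH].
    by rewrite big_ord1 expr0 mulr1 qS vint_cexpVX /= addr0 expr1.
  rewrite big_ord_recr /= mulrDl IH mulrAC qS vint_cexpVX /= mulr0 add0r (exprS _ N.+1).
  by ring.
have [M M0 HM] := bounded_curve (ltW twopi_gt0) (ccurve_vertical Qexp_cont x).
have qb N : modulus (q N) <= 2 * (M * r^-1 ^+ N) * (pi *+ 2 - 0).
  apply: cint_bound => [||t tpi]; [exact: (ccurve_vertical (q_cont N))|exact: ltW|].
  rewrite modulusM modulus_cexpVX /=; apply: ler_wpM2r; last exact: HM.
  by rewrite exprn_ge0 // invr_ge0 ltW.
pose s := modulus z0 / r.
have s0 : 0 <= s by rewrite divr_ge0 ?modulus_ge0 ?ltW.
have s1 : `|s| < 1 by rewrite ger0_norm // ltr_pdivrMr // mul1r.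
have : (fun n => (2 * M * modulus z0) * s ^+ n) @ \oo --> (2 * M * modulus z0) * 0.
  by apply: cvgMr; apply: cvg_expr.
rewrite mulr0 => /cvgrPdist_lt /(_ _ e0) [N0 _ HN0].
exists N0.+1 => -[//|N] /= N0N.
have := HN0 N N0N; rewrite /= sub0r normrN => HN.
have tp : modulus ((pi *+ 2)%:C : R[i]) = pi *+ 2 by rewrite modulus_real gtr0_norm.
rewrite -(ler_pM2r twopi_gt0) -{1}tp -modulusM mulrBl sumE subKr modulusM modulusX.
apply: le_trans (ler_wpM2l _ (qb N)) _; first by rewrite exprn_ge0 // modulus_ge0.
have -> : modulus z0 ^+ N.+1 * (2 * (M * r^-1 ^+ N) * (pi *+ 2 - 0)) =
    2 * M * modulus z0 * s ^+ N * (pi *+ 2).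
  by rewrite /s exprMn subr0 exprS; ring.
rewrite (ler_pM2r twopi_gt0); apply: ltW.
by apply: le_lt_trans HN; rewrite ler_norm.
Qed.

End Taylor.

(** * The Fock norm of a radial weight in terms of Taylor coefficients *)

Section PlanarMeasure.
Context {R : realType}.
Local Notation mu := (@lebesgue_measure R).
Local Notation T := (measurableTypeR R).

Lemma integral_translation (f : T -> \bar R) (c : R) : measurable_fun [set: T] f ->
  (forall x, 0 <= f x)%E -> (\int[mu]_x f (x + c)%R = \int[mu]_x f x)%E.
Proof.
move=> mf f0; pose phi (x : T) : T := x + c.
have mphi : measurable_fun [set: T] phi.
  by apply: measurable_funD => //; exact: measurable_id.
have H A : measurable A -> mu A = pushforward mu phi A.
  move=> mA.
  apply: (@lebesgue_measure_unique R
    (measure_function_pushforward__canonical__measure_function_Measure mu mphi)) => //.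
  move=> _ [[a b] _ <-] /=; rewrite /pushforward.
  have -> : phi @^-1` `]a, b] = `](a - c), (b - c)]%classic.
    apply/seteqP; split => x /=; rewrite !in_itv /= /phi.
      by rewrite ltrBlDr lerBrDr.
    by rewrite ltrBlDr lerBrDr.
  rewrite !lebesgue_measure_itv /= !lte_fin ltrD2r; case: ifP => // _.
  by rewrite -!EFinB; congr (_%:E); ring.
transitivity (\int[pushforward mu phi]_x f x)%E.
  rewrite (@ge0_integral_pushforward _ _ _ _ _ phi mphi mu setT f) //.
apply: (@eq_measure_integral _ T R setT mu
  (measure_function_pushforward__canonical__measure_function_Measure mu mphi)).
by move=> A mA _; exact: (esym (H A mA)).
Qed.

Local Notation P := (T * T)%type.
Local Notation mu2 := (planar_measure R).

Lemma measurable_shear1 (t : R) :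
  measurable_fun [set: P] (fun p : P => ((p.1 + t * p.2)%R, p.2) : P).
Proof.
apply: measurable_fun_pair; last exact: measurable_snd.
apply: measurable_funD; first exact: measurable_fst.
by apply: measurable_funM => //; exact: measurable_snd.
Qed.

Lemma measurable_shear2 (t : R) :
  measurable_fun [set: P] (fun p : P => (p.1, (p.2 + t * p.1)%R) : P).
Proof.
apply: measurable_fun_pair; first exact: measurable_fst.
apply: measurable_funD; first exact: measurable_snd.
by apply: measurable_funM => //; exact: measurable_fst.
Qed.

(** A shear translates each horizontal line, so Tonelli reduces it to translation invariance on the
    line. *)
Lemma integral_shear1 (F : P -> \bar R) (t : R) : measurable_fun [set: P] F ->
  (forall p, 0 <= F p)%E ->
  (\int[mu2]_p F ((p.1 + t * p.2)%R, p.2) = \int[mu2]_p F p)%E.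
Proof.
move=> mF F0.
have mFs : measurable_fun [set: P] (fun p : P => F ((p.1 + t * p.2)%R, p.2)).
  exact: (measurableT_comp mF (measurable_shear1 t)).
etransitivity; first exact: (@fubini_tonelli2 _ _ _ _ _ mu mu _ mFs (fun=> F0 _)).
etransitivity; last exact: esym (@fubini_tonelli2 _ _ _ _ _ mu mu F mF F0).
apply: eq_integral => y _; rewrite /fubini_G /=.
apply: (@integral_translation (fun x => F (x, y)) (t * y)%R) => //.
exact: (measurableT_comp mF (measurable_pair2 y)).
Qed.

Lemma integral_shear2 (F : P -> \bar R) (t : R) : measurable_fun [set: P] F ->
  (forall p, 0 <= F p)%E ->
  (\int[mu2]_p F (p.1, (p.2 + t * p.1)%R) = \int[mu2]_p F p)%E.
Proof.
move=> mF F0.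
have mFs : measurable_fun [set: P] (fun p : P => F (p.1, (p.2 + t * p.1)%R)).
  exact: (measurableT_comp mF (measurable_shear2 t)).
etransitivity; first exact: (@fubini_tonelli1 _ _ _ _ _ mu mu _ mFs (fun=> F0 _)).
etransitivity; last exact: esym (@fubini_tonelli1 _ _ _ _ _ mu mu F mF F0).
apply: eq_integral => x _; rewrite /fubini_F /=.
apply: (@integral_translation (fun y => F (x, y)) (t * x)%R) => //.
exact: (measurableT_comp mF (measurable_pair1 x)).
Qed.

(* A rotation whose matrix has b != 0 below the diagonal is a product of three
   shears. *)
Let rotation_shears (F : P -> \bar R) (a b : R) : b != 0 ->
  a ^+ 2 + b ^+ 2 = 1 -> measurable_fun [set: P] F -> (forall p, 0 <= F p)%E ->
  (\int[mu2]_p F ((a * p.1 - b * p.2)%R, (b * p.1 + a * p.2)%R) = \int[mu2]_p F p)%E.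
Proof.
move=> b0 ab mF F0; pose t := (a - 1) / b.
pose s1 (p : P) : P := ((p.1 + t * p.2)%R, p.2).
pose s2 (p : P) : P := (p.1, (p.2 + b * p.1)%R).
have m1 : measurable_fun [set: P] s1 := measurable_shear1 t.
have m2 : measurable_fun [set: P] s2 := measurable_shear2 b.
have mF1 : measurable_fun [set: P] ((F \o s1)) by exact: measurableT_comp.
have mF12 : measurable_fun [set: P] ((F \o s1 \o s2)) by exact: measurableT_comp.
rewrite -(integral_shear1 t mF F0) -(integral_shear2 b mF1 (fun=> F0 _)).
rewrite -(integral_shear1 t mF12 (fun=> F0 _)).
apply: eq_integral => p _; rewrite /s1 /s2 /=; congr (F (_, _)).
  have -> : p.1 + t * p.2 + t * (p.2 + b * (p.1 + t * p.2)) =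
    (1 + t * b) * p.1 + t * (2 + t * b) * p.2 by ring.
  rewrite /t divfK //; congr (_ + _); first by ring.
  rewrite -mulNr; congr (_ * _).
  have -> : (a - 1) / b * (2 + (a - 1)) = (a ^+ 2 + b ^+ 2 - 1 - b ^+ 2) / b by ring.
  by rewrite ab subrr sub0r expr2 mulNr mulfK.
have -> : p.2 + b * (p.1 + t * p.2) = b * p.1 + (1 + t * b) * p.2 by ring.
by rewrite /t divfK //; ring.
Qed.

Lemma integral_rotation (F : P -> \bar R) (a b : R) :
  a ^+ 2 + b ^+ 2 = 1 -> measurable_fun [set: P] F -> (forall p, 0 <= F p)%E ->
  (\int[mu2]_p F ((a * p.1 - b * p.2)%R, (b * p.1 + a * p.2)%R) = \int[mu2]_p F p)%E.
Proof.
move=> ab mF F0; have [b0|] := eqVneq b 0; last by move=> b0; exact: rotation_shears.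
have /orP[/eqP a1|/eqP aN1] : (a == 1) || (a == -1).
  by rewrite -eqf_sqr expr1n -ab b0 expr0n addr0.
  rewrite a1 b0; apply: eq_integral => -[x y] _ /=; congr F.
  by rewrite !mul1r !mul0r subr0 add0r.
(* The half turn has b = 0 and is obtained as the square of the quarter turn. *)
pose r (p : P) : P := ((0 * p.1 - 1 * p.2)%R, (1 * p.1 + 0 * p.2)%R).
have mr : measurable_fun [set: P] r.
  apply: measurable_fun_pair.
    by apply: measurable_funB; apply: measurable_funM.
  by apply: measurable_funD; apply: measurable_funM.
have rot0 : (0 : R) ^+ 2 + 1 ^+ 2 = 1 by rewrite expr0n expr1n add0r.
rewrite -(rotation_shears (oner_neq0 _) rot0 mF F0).
have mFr : measurable_fun [set: P] ((F \o r)) by exact: measurableT_comp.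
rewrite -(rotation_shears (oner_neq0 _) rot0 mFr (fun=> F0 _)).
apply: eq_integral => -[x y] _ /=; congr F; rewrite aN1 b0.
by rewrite /r /=; congr (_, _); ring.
Qed.

Lemma integral_mul_unimodular (H : R[i] -> \bar R) (u : R[i]) : modulus u = 1 ->
  measurable_fun [set: P] (fun p : P => H (cplx p)) -> (forall z, 0 <= H z)%E ->
  (\int[mu2]_p H (u * cplx p)%R = \int[mu2]_p H (cplx p))%E.
Proof.
case: u => a b u1 mH H0.
rewrite -(@integral_rotation (fun p => H (cplx p)) a b) //.
  apply: eq_integral => p _; congr H.
  by apply: complex_eq; rewrite ?cReM ?cImM /=; ring.
by have := modulus_sqr (a +i* b); rewrite u1 expr1n /= => <-.
Qed.

End PlanarMeasure.

(** * Finite Fourier analysis on roots of unity *)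

Section RootsOfUnityMean.
Context {R : realType}.
Implicit Types (z w : R[i]).

Definition unity_root (N : nat) : R[i] := expi ((pi *+ 2) / N%:R).

Lemma expi_natM (x : R) n : expi (x * n%:R) = expi x ^+ n :> R[i].
Proof.
elim: n => [|n IH]; first by rewrite mulr0 expi0 expr0.
by rewrite -natr1 mulrDr mulr1 expiD IH exprSr.
Qed.

Lemma expi_2pi : expi (pi *+ 2) = 1 :> R[i].
Proof. by rewrite /expi cos2pi sin2pi. Qed.

Lemma expi_neq1 (x : R) : 0 < x < pi *+ 2 -> expi x != 1 :> R[i].
Proof.
move=> /andP[x0 x2]; apply/eqP => -[c1 _].
have : 0 < sin (x / 2) by apply: sin_gt0_pi; rewrite divr_gt0 //= ltr_pdivrMr // mulr_natr.
have : cos x = 1 - 2 * sin (x / 2) ^+ 2.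
  rewrite {1}(splitr x) cosD; have := cos2Dsin2 (x / 2); nra.
rewrite c1 => H1 H2; have := exprn_gt0 2 H2; nra.
Qed.

Lemma unity_rootX N : (0 < N)%N -> unity_root N ^+ N = 1.
Proof.
by move=> N0; rewrite -expi_natM divfK ?expi_2pi // pnatr_eq0 -lt0n.
Qed.

Lemma modulus_unity_root N : modulus (unity_root N) = 1.
Proof. exact: modulus_expi. Qed.

Lemma unity_root_neq1 N m : (0 < m < N)%N -> unity_root N ^+ m != 1.
Proof.
move=> /andP[m0 mN]; have N0 : 0 < N%:R :> R by rewrite ltr0n (leq_trans _ mN).
rewrite -expi_natM; apply: expi_neq1.
have p0 : 0 < pi *+ 2 :> R by rewrite mulrn_wgt0 // pi_gt0.
have -> : 0 < pi *+ 2 / N%:R * m%:R :> R by rewrite mulr_gt0 ?(divr_gt0 p0 N0) ?ltr0n.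
by rewrite /= mulrAC ltr_pdivrMr // ltr_pM2l // ltr_nat.
Qed.

Lemma unity_root_sum N k : (0 < N)%N ->
  \sum_(j < N) unity_root N ^+ k ^+ j = if (N %| k)%N then N%:R else 0.
Proof.
move=> N0; case: ifPn => [/dvdnP [q ->]|Nk].
  rewrite mulnC exprM unity_rootX // expr1n.
  under eq_bigr do rewrite expr1n.
  by rewrite sumr_const card_ord.
have k1 : unity_root N ^+ k != 1.
  rewrite (divn_eq k N) exprD mulnC exprM unity_rootX // expr1n mul1r.
  by apply: unity_root_neq1; rewrite ltn_mod N0 andbT lt0n.
have := subrX1 (unity_root N ^+ k) N.
rewrite -exprM mulnC exprM unity_rootX // expr1n subrr => /eqP.
by rewrite eq_sym mulf_eq0 subr_eq0 (negbTE k1) => /eqP.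
Qed.

Lemma unity_rootJ N : (0 < N)%N -> ((unity_root N)^* = unity_root N ^+ N.-1)%R.
Proof.
move=> N0; have u0 : unity_root N != 0 by rewrite -modulus_gt0 modulus_unity_root.
apply: (mulfI u0); rewrite mulJ modulus_unity_root expr1n -exprS prednK //.
by rewrite unity_rootX.
Qed.

Lemma sqr_modulusE z : ((modulus z ^+ 2)%:C = z * z^*)%R.
Proof. by rewrite mulJ. Qed.

(** Exact for polynomials of degree below N, whose frequencies are distinct modulo N. Conjugation is
    written as the power N - 1, so that all exponents remain natural numbers. *)
Lemma parseval_unity_root N (b : nat -> R[i]) : (0 < N)%N ->
  \sum_(j < N) modulus (\sum_(m < N) b m * (unity_root N ^+ j) ^+ m) ^+ 2
  = N%:R * \sum_(m < N) modulus (b m) ^+ 2.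
Proof.
move=> N0; apply: (@complexI R); rewrite rmorphM /= rmorph_nat !rmorph_sum /=.
have E (j : 'I_N) : (modulus (\sum_(m < N) b m * (unity_root N ^+ j) ^+ m) ^+ 2)%:C =
    \sum_(m < N) \sum_(k < N) b m * (b k)^* * (unity_root N ^+ (m + N.-1 * k)) ^+ j.
  rewrite sqr_modulusE cJ_sum big_distrlr /=.
  apply: eq_bigr => m _; apply: eq_bigr => k _.
  rewrite cJM !cJX unity_rootJ // mulrACA; congr (_ * _).
  by rewrite -!exprM -exprD; congr (_ ^+ _); rewrite mulnDl (mulnC j m) -!mulnA (mulnC j k).
rewrite (eq_bigr _ (fun j _ => E j)).
rewrite exchange_big /= mulr_sumr; apply: eq_bigr => m _.
rewrite exchange_big /= (bigD1 m) //= -mulr_sumr.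
rewrite unity_root_sum // ifT; last first.
  by rewrite -mulSn prednK // dvdn_mulr.
rewrite [X in _ + X]big1 ?addr0; first by rewrite sqr_modulusE mulrC.
move=> k km; rewrite -mulr_sumr unity_root_sum // ifF ?mulr0 //.
apply/negbTE; apply: contra km => Nk.
have : (m + N.-1 * k == k + N.-1 * k %[mod N])%N.
  by rewrite (eqP Nk) -mulSn prednK // modnMr.
by rewrite eqn_modDr !modn_small // => /eqP/val_inj ->.
Qed.

End RootsOfUnityMean.

(** * Everywhere convergent power series *)

Section Expansion.
Context {R : realType}.
Implicit Types (f g h : R[i] -> R[i]) (a b : nat -> R[i]) (z w : R[i]).
Local Notation T := (measurableTypeR R).
Local Notation P := (T * T)%type.

Definition psum a K z : R[i] := \sum_(m < K) a m * z ^+ m.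

(** The first clause is Cauchy's estimate at every radius; with it, pointwise convergence improves
    to geometric convergence on discs. *)
Definition expansion f a : Prop :=
  (forall r : R, 0 < r -> exists M : R, forall n, modulus (a n) * r ^+ n <= M) /\
  (forall z (e : R), 0 < e -> exists N0, forall N, (N0 <= N)%N ->
     modulus (f z - psum a N z) <= e).

Lemma entire_cderivable f : entire f <-> forall z, cderivable f z.
Proof.
split=> H z; have [A B] := derivable_cdiff f z; first exact: A (H z).
exact: B (H z).
Qed.

Lemma entire_expansion f : entire f -> exists a, expansion f a.
Proof.
move=> /entire_cderivable fd; exists (taylor_coef f); split.
- by move=> r; exact: taylor_coef_rapid.
- by move=> z e; exact: taylor_cvg.
Qed.

(** Cauchy's estimate at radius 2 r bounds the m-th term on the disc of radius r by M / 2^m. *)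
Lemma expansion_tail f a : expansion f a -> forall r : R, 0 < r ->
  exists2 M : R, 0 <= M & forall N z, modulus z <= r ->
    modulus (f z - psum a N z) <= M * 2^-1 ^+ N.
Proof.
move=> [Ha Hf] r r0.
have [M HM] := Ha (2 * r) (mulr_gt0 (ltr0Sn R 1) r0).
have M0 : 0 <= M.
  by apply: le_trans (HM 0%N); rewrite mulr_ge0 ?modulus_ge0 // exprn_ge0 // mulr_ge0 // ltW.
exists (2 * M); first by rewrite mulr_ge0.
move=> N z zr; apply/ler_addgt0Pr => e e0.
have [N0 HN0] := Hf z e e0.
pose L := maxn N0 N.
rewrite -(subrK (psum a L z) (f z)) -addrA; apply: le_trans (modulusD_le _ _) _.
rewrite [leRHS]addrC; apply: lerD; first by apply: HN0; rewrite leq_maxl.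
have term m : modulus (a m * z ^+ m) <= M * 2^-1 ^+ m.
  rewrite modulusM modulusX.
  have r2 : 0 < 2 ^+ m :> R by rewrite exprn_gt0.
  rewrite exprVn ler_pdivlMr // -mulrA.
  apply: le_trans (HM m); rewrite exprMn (mulrC (2 ^+ m)).
  rewrite ler_wpM2l ?modulus_ge0 // ler_wpM2r ?(ltW r2) //.
  by apply: lerXn2r; rewrite ?nnegrE ?modulus_ge0 ?(ltW r0).
suff H k : modulus (psum a (N + k) z - psum a N z) <= 2 * M * 2^-1 ^+ N - 2 * M * 2^-1 ^+ (N + k).
  have NL : (N <= L)%N by rewrite leq_maxr.
  rewrite -(subnKC NL); apply: le_trans (H _) _.
  by rewrite gerBl !mulr_ge0 // exprn_ge0 // invr_ge0.
elim: k => [|k IH]; first by rewrite addn0 !subrr modulus0.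
rewrite addnS {1}/psum big_ord_recr /= -/(psum a (N + k) z) addrAC.
apply: le_trans (modulusD_le _ _) _; apply: le_trans (lerD IH (term _)) _.
rewrite exprS; set x := 2^-1 ^+ (N + k); set y := 2^-1 ^+ N.
by rewrite le_eqVlt; apply/orP; left; apply/eqP; field.
Qed.

Definition mcomplex h : Prop :=
  measurable_fun [set: P] (fun p : P => complex.Re (h (cplx p))) /\
  measurable_fun [set: P] (fun p : P => complex.Im (h (cplx p))).

Lemma mcomplex_id : mcomplex id.
Proof. by split; [exact: measurable_fst|exact: measurable_snd]. Qed.

Lemma mcomplex_cst (k : R[i]) : mcomplex (fun=> k).
Proof. by split; exact: measurable_cst. Qed.

Lemma mcomplexD g h : mcomplex g -> mcomplex h -> mcomplex (fun z => g z + h z).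
Proof.
move=> [g1 g2] [h1 h2]; split.
- by under eq_fun do rewrite cReD; exact: measurable_funD.
- by under eq_fun do rewrite cImD; exact: measurable_funD.
Qed.

Lemma mcomplexM g h : mcomplex g -> mcomplex h -> mcomplex (fun z => g z * h z).
Proof.
move=> [g1 g2] [h1 h2]; split.
- under eq_fun do rewrite cReM.
  by apply: measurable_funB; exact: measurable_funM.
- under eq_fun do rewrite cImM.
  by apply: measurable_funD; exact: measurable_funM.
Qed.

Lemma mcomplexX h n : mcomplex h -> mcomplex (fun z => h z ^+ n).
Proof.
move=> mh; elim: n => [|n IH]; first exact: mcomplex_cst.
by under eq_fun do rewrite exprS; exact: mcomplexM.
Qed.

Lemma mcomplex_psum a K : mcomplex (psum a K).
Proof.
elim: K => [|K IH].
  rewrite (_ : psum a 0 = fun=> 0); first exact: mcomplex_cst.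
  by apply/funext => z; rewrite /psum big_ord0.
rewrite (_ : psum a K.+1 = fun z => psum a K z + a K * z ^+ K); last first.
  by apply/funext => z; rewrite /psum big_ord_recr.
apply: mcomplexD => //; apply: mcomplexM; first exact: mcomplex_cst.
by apply: mcomplexX; exact: mcomplex_id.
Qed.

Lemma expansion_cvg_Re f a z : expansion f a ->
  (fun K => complex.Re (psum a K z)) @ \oo --> complex.Re (f z).
Proof.
move=> [_ Hf]; apply/cvgrPdist_le => e e0; have [N0 HN0] := Hf z e e0.
exists N0 => // N /= /HN0; apply: le_trans.
by rewrite -cReN -cReD Re_le_modulus.
Qed.

Lemma expansion_cvg_Im f a z : expansion f a ->
  (fun K => complex.Im (psum a K z)) @ \oo --> complex.Im (f z).
Proof.
move=> [_ Hf]; apply/cvgrPdist_le => e e0; have [N0 HN0] := Hf z e e0.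
exists N0 => // N /= /HN0; apply: le_trans.
by rewrite -cImN -cImD Im_le_modulus.
Qed.

Lemma expansion_cvg_modulus2 f a z : expansion f a ->
  (fun K => modulus (psum a K z) ^+ 2) @ \oo --> modulus (f z) ^+ 2.
Proof.
move=> fa; under eq_fun do rewrite modulus_sqr; rewrite modulus_sqr.
rewrite !expr2; under eq_fun do rewrite !expr2.
by apply: cvgD; apply: cvgM; (exact: expansion_cvg_Re || exact: expansion_cvg_Im).
Qed.

Lemma mcomplex_expansion f a : expansion f a -> mcomplex f.
Proof.
move=> fa; split.
- apply: (measurable_fun_cvg (h := fun K p => complex.Re (psum a K (cplx p)))).
    by move=> K; case: (mcomplex_psum a K).
  by move=> p _; exact: expansion_cvg_Re.
- apply: (measurable_fun_cvg (h := fun K p => complex.Im (psum a K (cplx p)))).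
    by move=> K; case: (mcomplex_psum a K).
  by move=> p _; exact: expansion_cvg_Im.
Qed.

Lemma measurable_modulus2 h : mcomplex h ->
  measurable_fun [set: P] (fun p : P => modulus (h (cplx p)) ^+ 2).
Proof.
move=> [h1 h2]; under eq_fun do rewrite modulus_sqr.
by apply: measurable_funD; exact: measurable_funX.
Qed.

End Expansion.

Lemma mcomplex_comp {R : realType} (g h : R[i] -> R[i]) :
  mcomplex g -> mcomplex h -> mcomplex (fun z => h (g z)).
Proof.
move=> [g1 g2] [h1 h2]; have mg := measurable_fun_pair g1 g2.
have E z : h (g z) = h (cplx (complex.Re (g z), complex.Im (g z))).
  by rewrite /cplx /=; case: (g z).
split; under eq_fun do rewrite E.
- exact: (measurableT_comp h1 mg).
- exact: (measurableT_comp h2 mg).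
Qed.

(** * Norms for a rotation-invariant weight *)

Section RadialFock.
Context {R : realType}.
Local Notation T := (measurableTypeR R).
Local Notation P := (T * T)%type.
Local Notation mu2 := (planar_measure R).
Variable phi : R[i] -> R.
Hypothesis phi_rot : forall u z, modulus u = 1 -> phi (u * z) = phi z.
Hypothesis phi_meas : measurable_fun [set: P] (fun p : P => expR (- (2 * phi (cplx p)))).
Implicit Types (f g h : R[i] -> R[i]) (a b : nat -> R[i]) (z w : R[i]).

Definition moment m : \bar R := fock_sqnorm phi (fun z => z ^+ m).

Hypothesis moment_fin : forall m, (moment m < +oo)%E.

Let wt z : R := expR (- (2 * phi z)).

Let wt_ge0 z : 0 <= wt z. Proof. exact: expR_ge0. Qed.

Lemma fock_sqnorm_ge0 h : (0 <= fock_sqnorm phi h)%E.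
Proof.
by apply: integral_ge0 => p _; rewrite lee_fin mulr_ge0 ?expR_ge0 // exprn_ge0 // modulus_ge0.
Qed.

Lemma measurable_density (u : R[i] -> R) :
  measurable_fun [set: P] (fun p : P => u (cplx p)) ->
  measurable_fun [set: P] (fun p : P => (u (cplx p) * wt (cplx p))%:E).
Proof. by move=> mu; apply/measurable_EFinP; exact: measurable_funM. Qed.

Lemma measurable_density2 h : mcomplex h ->
  measurable_fun [set: P] (fun p : P => (modulus (h (cplx p)) ^+ 2 * wt (cplx p))%:E).
Proof.
move=> mh; exact: (measurable_density (u := fun z => modulus (h z) ^+ 2) (measurable_modulus2 mh)).
Qed.

Let mean h N z : R := N%:R^-1 * \sum_(j < N) modulus (h (unity_root N ^+ j * z)) ^+ 2.

Let mean_le N (x : nat -> R) (B : R) : (forall j, x j <= B) ->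
  N.+1%:R^-1 * \sum_(j < N.+1) x j <= B.
Proof.
move=> xB; rewrite ler_pdivrMl // mulr_natl -[X in _ *+ X](card_ord N.+1).
by rewrite -sumr_const; apply: ler_sum.
Qed.

(* Averaging over rotations by roots of unity replaces polar coordinates. *)
Lemma fock_sqnorm_mean h N : (0 < N)%N -> mcomplex h ->
  fock_sqnorm phi h = (\int[mu2]_p (mean h N (cplx p) * wt (cplx p))%:E)%E.
Proof.
move=> N0 mh; pose H z := (modulus (h z) ^+ 2 * wt z)%:E.
have H0 z : (0 <= H z)%E by rewrite lee_fin mulr_ge0 // exprn_ge0 // modulus_ge0.
have mH : measurable_fun [set: P] (fun p : P => H (cplx p)).
  exact: (measurable_density (u := fun z => modulus (h z) ^+ 2) (measurable_modulus2 mh)).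
have uj j : modulus (unity_root N ^+ j : R[i]) = 1.
  by rewrite modulusX modulus_unity_root expr1n.
have rot (j : 'I_N) : (\int[mu2]_p H (unity_root N ^+ j * cplx p)%R = fock_sqnorm phi h)%E.
  by rewrite (integral_mul_unimodular (uj j) mH H0).
have mhj (j : nat) : mcomplex (fun z => h (unity_root N ^+ j * z)).
  apply: mcomplex_comp mh.
  by apply: mcomplexM; [exact: mcomplex_cst|exact: mcomplex_id].
have mHj (j : nat) : measurable_fun [set: P] (fun p : P => H (unity_root N ^+ j * cplx p)).
  have := measurable_density (u := fun z => modulus (h (unity_root N ^+ j * z)) ^+ 2)
    (measurable_modulus2 (mhj j)).
  by congr measurable_fun; apply/funext => p; rewrite /H /wt phi_rot.
have Ni : 0 <= N%:R^-1 :> R by rewrite invr_ge0.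
transitivity (\int[mu2]_p (\sum_(j < N) (N%:R^-1%:E * H (unity_root N ^+ j * cplx p)%R)))%E.
  rewrite ge0_integral_sum //; last 2 first.
  - by move=> j; apply: measurable_funeM; exact: mHj.
  - by move=> j p _; rewrite mule_ge0 // lee_fin.
  have E (j : 'I_N) : (\int[mu2]_p (N%:R^-1%:E * H (unity_root N ^+ j * cplx p)%R) =
      N%:R^-1%:E * fock_sqnorm phi h)%E.
    rewrite -(rot j); apply: (ge0_integralZl mu2 measurableT (mHj j)) => //.
  rewrite (eq_bigr _ (fun j _ => E j)).
  rewrite -ge0_sume_distrl => [|i _]; last by rewrite lee_fin.
  rewrite sumEFin sumr_const card_ord -[N%:R^-1 *+ N]mulr_natl mulfV ?mul1e //.
  by rewrite pnatr_eq0 -lt0n.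
apply: eq_integral => p _; rewrite sumEFin; congr (_%:E).
rewrite /mean -mulrA mulr_suml mulr_sumr; apply: eq_bigr => j _.
by rewrite /wt phi_rot.
Qed.

Lemma mean_psum a N z : (0 < N)%N ->
  mean (psum a N) N z = \sum_(m < N) modulus (a m) ^+ 2 * modulus (z ^+ m) ^+ 2.
Proof.
move=> N0; rewrite /mean /psum.
under eq_bigr => j _.
  under eq_bigr => m _ do rewrite exprMn mulrCA mulrA (mulrC _ (a m)) mulrAC.
  over.
have := @parseval_unity_root R N (fun m => a m * z ^+ m) N0.
move=> ->; rewrite mulKf ?pnatr_eq0 -?lt0n //.
by apply: eq_bigr => m _; rewrite modulusM exprMn.
Qed.

Definition cmoment m : R := fine (moment m).

Lemma momentE m : moment m = (cmoment m)%:E.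
Proof.
by rewrite /cmoment fineK // ge0_fin_numE ?moment_fin // fock_sqnorm_ge0.
Qed.

Lemma cmoment_ge0 m : 0 <= cmoment m.
Proof. by rewrite fine_ge0 // fock_sqnorm_ge0. Qed.

Lemma integral_diagonal a N :
  (\int[mu2]_p ((\sum_(m < N) modulus (a m) ^+ 2 * modulus (cplx p ^+ m) ^+ 2)
      * wt (cplx p))%:E)%E = (\sum_(m < N) modulus (a m) ^+ 2 * cmoment m)%:E.
Proof.
transitivity (\int[mu2]_p (\sum_(m < N) ((modulus (a m) ^+ 2)%:E *
     (modulus (cplx p ^+ m) ^+ 2 * wt (cplx p))%:E)))%E.
  apply: eq_integral => p _; rewrite sumEFin; congr (_%:E).
  by rewrite mulr_suml; apply: eq_bigr => m _; rewrite -mulrA.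
have mm m : measurable_fun [set: P] (fun p : P => (modulus (cplx p ^+ m) ^+ 2 * wt (cplx p))%:E).
  exact: (measurable_density2 (h := fun z => z ^+ m) (mcomplexX m mcomplex_id)).
have m0 (z : R[i]) : 0 <= modulus z ^+ 2 by rewrite exprn_ge0 // modulus_ge0.
rewrite ge0_integral_sum //; last 2 first.
- by move=> m; apply: measurable_funeM; exact: mm.
- by move=> m p _; rewrite mule_ge0 // lee_fin ?m0 // mulr_ge0.
rewrite -sumEFin; apply: eq_bigr => m _.
rewrite [RHS]EFinM -momentE; apply: (ge0_integralZl mu2 measurableT (mm m)) => [p _|].
- by rewrite lee_fin mulr_ge0.
- by rewrite lee_fin m0.
Qed.

Lemma fock_sqnorm_psum a N :
  fock_sqnorm phi (psum a N) = (\sum_(m < N) modulus (a m) ^+ 2 * cmoment m)%:E.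
Proof.
rewrite -integral_diagonal; case: N => [|N].
  apply: eq_integral => p _.
  by rewrite /psum !big_ord0 modulus0 expr0n.
rewrite (@fock_sqnorm_mean _ N.+1) //; last exact: mcomplex_psum.
by apply: eq_integral => p _; rewrite mean_psum.
Qed.

(** Fatou's lemma along the partial sums, whose norms are explicit. *)
Lemma fock_sqnorm_le f a (B : R) : expansion f a ->
  (forall K, \sum_(m < K) modulus (a m) ^+ 2 * cmoment m <= B) ->
  (fock_sqnorm phi f <= B%:E)%E.
Proof.
move=> fa HB; pose g K (p : P) := (modulus (psum a K (cplx p)) ^+ 2 * wt (cplx p))%:E.
have mg K : measurable_fun [set: P] (g K).
  exact: measurable_density2 (mcomplex_psum a K).
have g0 K p : [set: P] p -> (0 <= g K p)%E.
  by move=> _; rewrite lee_fin mulr_ge0 // exprn_ge0 // modulus_ge0.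
have := fatou mu2 measurableT mg g0.
rewrite [X in (X <= _)%E -> _](_ : _ = fock_sqnorm phi f); last first.
  apply: eq_integral => p _.
  have gc : (g ^~ p) @ \oo --> (modulus (f (cplx p)) ^+ 2 * wt (cplx p))%:E.
    apply: cvg_EFin; first by near=> K.
    by apply: cvgMl; exact: expansion_cvg_modulus2.
  by rewrite (cvg_limn_einf_sup gc).1.
move=> /le_trans; apply.
pose s K := (\sum_(m < K) modulus (a m) ^+ 2 * cmoment m)%:E.
rewrite (_ : (fun n => _) = s); last first.
  by apply/funext => K; rewrite /s -fock_sqnorm_psum.
have nds : {homo s : m n / (m <= n)%N >-> (m <= n)%E}.
  apply/nondecreasing_seqP => K; rewrite lee_fin big_ord_recr /= lerDl.
  by rewrite mulr_ge0 ?cmoment_ge0 // exprn_ge0 // modulus_ge0.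
have cs := ereal_nondecreasing_is_cvgn nds.
rewrite is_cvg_limn_einfE //; apply: lime_le => //.
by near=> K; rewrite lee_fin HB.
Unshelve. all: by end_near. Qed.

(** Fatou's lemma along the root-of-unity averages of |f|^2: they all have the integral of |f|^2,
    and they converge pointwise to sum |a_m z^m|^2 because f and its partial sums differ by O(2^-N)
    on a circle. *)
Lemma fock_sqnorm_ge f a K : expansion f a ->
  ((\sum_(m < K) modulus (a m) ^+ 2 * cmoment m)%:E <= fock_sqnorm phi f)%E.
Proof.
move=> fa; have mf := mcomplex_expansion fa.
pose s N z := \sum_(m < N) modulus (a m) ^+ 2 * modulus (z ^+ m) ^+ 2.
pose g N (p : P) := (mean f N.+1 (cplx p) * wt (cplx p))%:E.
have mean_ge0 h N z : 0 <= mean h N z.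
  by rewrite mulr_ge0 ?invr_ge0 // sumr_ge0 // => j _; rewrite exprn_ge0 // modulus_ge0.
have mg N : measurable_fun [set: P] (g N).
  apply: (measurable_density (u := mean f N.+1)); apply: measurable_funM => //.
  apply: measurable_sum => j; apply: (measurable_modulus2 (h := fun z => f (unity_root N.+1 ^+ j * z))).
  apply: mcomplex_comp mf.
  by apply: mcomplexM; [exact: mcomplex_cst|exact: mcomplex_id].
have g0 N p : [set: P] p -> (0 <= g N p)%E by move=> _; rewrite lee_fin mulr_ge0.
have := fatou mu2 measurableT mg g0.
have -> : (fun n => \int[mu2]_(x in [set: P]) g n x)%E = fun=> fock_sqnorm phi f.
  by apply/funext => N; rewrite -(@fock_sqnorm_mean f N.+1).
rewrite (cvg_limn_einf_sup (cvg_cst _)).1; apply: le_trans.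
rewrite -integral_diagonal; apply: ge0_le_integral => //.
- move=> p _; rewrite lee_fin mulr_ge0 // sumr_ge0 // => m _.
  by rewrite mulr_ge0 // exprn_ge0 // modulus_ge0.
- apply: (measurable_density (u := s K)); apply: measurable_sum => m.
  apply: measurable_funM => //.
  exact: (measurable_modulus2 (h := fun z => z ^+ m) (mcomplexX m mcomplex_id)).
- under eq_fun => p do rewrite -[limn_einf _]oppeK -limn_esupN.
  apply: measurableT_comp; first exact: oppe_measurable.
  apply: (measurable_fun_limn_esup (f := fun n p => (- g n p)%E)) => n.
  by apply: measurableT_comp; [exact: oppe_measurable|exact: mg].
move=> p _; set z := cplx p.
pose r := modulus z + 1.
have r0 : 0 < r by rewrite ltr_wpDl // modulus_ge0.
have [M M0 HM] := expansion_tail fa r0.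
have nds : {homo s ^~ z : m n / (m <= n)%N >-> m <= n}.
  apply/nondecreasing_seqP => N; rewrite /s big_ord_recr /= lerDl.
  by rewrite mulr_ge0 // exprn_ge0 // modulus_ge0.
have ujr N j : modulus (unity_root N ^+ j * z) <= r.
  by rewrite modulusM modulusX modulus_unity_root expr1n mul1r lerDl.
have fM N j : modulus (f (unity_root N ^+ j * z)) <= M.
  by have := HM 0%N _ (ujr N j); rewrite /psum big_ord0 subr0 expr0 mulr1.
have half_le1 N : 2^-1 ^+ N <= 1 :> R.
  by rewrite exprn_ile1 ?invr_ge0 // invf_le1 // ler1n.
have pM K' N j : modulus (psum a K' (unity_root N ^+ j * z)) <= 2 * M.
  have := HM K' _ (ujr N j); rewrite modulusB => H.
  rewrite -(subrK (f (unity_root N ^+ j * z)) (psum _ _ _)).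
  apply: le_trans (modulusD_le _ _) _; rewrite mulrDl mul1r; apply: lerD (fM N j).
  by apply: le_trans H _; rewrite ler_piMr.
(* Difference of two squares: |f| <= M and |psum| <= 2 M give the factor 3 M, and the tail bound
   gives M / 2^(N+1). *)
have close N : `|s N.+1 z - mean f N.+1 z| <= 3 * M * M * 2^-1 ^+ N.+1.
  have -> : s N.+1 z = mean (psum a N.+1) N.+1 z by rewrite mean_psum.
  rewrite /mean -mulrBr -sumrB normrM ger0_norm ?invr_ge0 //.
  apply: le_trans (ler_wpM2l _ (ler_norm_sum _ _ _)) _; first by rewrite invr_ge0.
  apply: (@mean_le N (fun j => `|modulus (psum a N.+1 (unity_root N.+1 ^+ j * z)) ^+ 2
    - modulus (f (unity_root N.+1 ^+ j * z)) ^+ 2|)) => j.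
  rewrite subr_sqr normrM mulrC.
  set u := unity_root N.+1 ^+ j * z.
  rewrite -(mulrA (3 * M)); apply: ler_pM => //.
    rewrite ger0_norm ?addr_ge0 ?modulus_ge0 //.
    by have := lerD (pM N.+1 N.+1 j) (fM N.+1 j); rewrite -/u; lra.
  apply: le_trans (HM N.+1 u (ujr _ _)).
  rewrite ler_norml; apply/andP; split.
    rewrite lerNl opprB; exact: modulusB_ge.
  by rewrite modulusB; exact: modulusB_ge.
have sb N : s N.+1 z <= 7 * M ^+ 2.
  have := close N; rewrite ler_norml => /andP[_]; rewrite lerBlDr => /le_trans; apply.
  have mM : mean f N.+1 z <= M ^+ 2.
    apply: (@mean_le N (fun j => modulus (f (unity_root N.+1 ^+ j * z)) ^+ 2)) => j.
    by rewrite lerXn2r ?nnegrE ?modulus_ge0.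
  have : 3 * M * M * 2^-1 ^+ N.+1 <= 3 * M * M by rewrite ler_piMr // !mulr_ge0.
  have := sqr_ge0 M; rewrite expr2 in mM *; lra.
have cs : cvgn (s ^~ z).
  apply: nondecreasing_is_cvgn => //; exists (7 * M ^+ 2) => _ [N _ <-].
  exact: le_trans (nds _ _ (leqnSn N)) (sb N).
have gc : (g ^~ p) @ \oo --> (limn (s ^~ z) * wt z)%:E.
  apply: cvg_EFin; first by near=> N.
  apply: cvgMl.
  rewrite (_ : (fun x => mean f x.+1 z) = fun N => s N.+1 z - (s N.+1 z - mean f N.+1 z)).
    rewrite -[X in _ --> X]subr0; apply: cvgB; first by rewrite (cvg_shiftS (s ^~ z)).
    apply/cvgrPdist_le => e e0.
    have : (fun n => (3 * M * M) * 2^-1 ^+ n) @ \oo --> (3 * M * M) * 0.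
      by apply: cvgMr; apply: cvg_expr; rewrite ger0_norm ?invr_ge0 // invf_lt1 // ltr1n.
    rewrite mulr0 => /cvgrPdist_le /(_ _ e0) [N0 _ HN0].
    exists N0 => // N /= N0N; rewrite sub0r normrN; apply: le_trans (close N) _.
    have := HN0 N.+1 (leq_trans N0N (leqnSn _)); rewrite /= sub0r normrN.
    by apply: le_trans; rewrite ler_norm.
  by apply/funext => N; rewrite subKr.
rewrite (cvg_limn_einf_sup gc).1 lee_fin ler_wpM2r //.
exact: nondecreasing_cvgn_le.
Unshelve. all: by end_near. Qed.

End RadialFock.

(** * Moments of the logarithmic weight *)

Section CauchyDensity.
Context {R : realType}.
Local Notation mu := (@lebesgue_measure R).

Lemma integral_oneDsqrV : (\int[mu]_x ((@oneDsqr R x)^-1)%:E = (pi : R)%:E)%E.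
Proof.
rewrite ge0_symfun_integralT.
- rewrite -set_itvcy integral0y_oneDsqr -EFinM; congr (_%:E).
  by rewrite mulrC divfK.
- by move=> x; rewrite invr_ge0.
- exact: continuous_oneDsqrV.
- by move=> x; rewrite /= /oneDsqr sqrrN.
Qed.

Lemma integral_oneDsqrV_scaled (g : R) : 0 < g ->
  (\int[mu]_x ((oneDsqr (x / g))^-1)%:E = (g * pi)%:E)%E.
Proof.
move=> g0; have gV0 : 0 < g^-1 by rewrite invr_gt0.
pose F := fun x : R => g^-1 * x.
have dF (x : R) : is_derive x (1 : R) F g^-1.
  by apply: is_derive_eq; rewrite /GRing.scale /= mulr1.
have F'E : derive1 F = fun=> g^-1.
  by apply/funext => x; rewrite derive1E; apply: derive_val.
have := @increasing_ge0_integration_by_substitutionT R F (fun x => (oneDsqr x)^-1).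
rewrite F'E integral_oneDsqrV => H.
rewrite EFinM; have {H}-> : (pi : R)%:E = (\int[mu]_x ((oneDsqr (g^-1 * x))^-1 * g^-1)%:E)%E.
  apply: H.
  - by move=> x y xy; rewrite /F ltr_pM2l.
  - by move=> x; exact: cvg_cst.
  - exact: is_cvg_cst.
  - exact: is_cvg_cst.
  - by move=> x; case: (dF x).
  - by apply: gt0_cvgMrNy => //; exact: cvg_id.
  - by apply: gt0_cvgMry => //; exact: cvg_id.
  - exact: continuous_oneDsqrV.
  - by move=> x; rewrite invr_ge0.
rewrite -ge0_integralZl //.
- apply: eq_integral => x _; rewrite -EFinM; congr (_%:E).
  by rewrite [RHS]mulrC divfK ?gt_eqF // mulrC.
- apply/measurable_EFinP; apply: measurable_funM => //.
  apply: (measurableT_comp (f := fun x => (oneDsqr x)^-1)).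
    by apply: continuous_measurable_fun; exact: continuous_oneDsqrV.
  exact: measurable_funM.
- by move=> x _; rewrite lee_fin mulr_ge0 ?invr_ge0 // ltW.
- by rewrite lee_fin ltW.
Qed.

End CauchyDensity.

(** * Gaussian size of the moments *)

Section Moments.
Context {R : realType}.
Variables (alpha : R) (alpha_gt0 : 0 < alpha).
Local Notation T := (measurableTypeR R).
Local Notation P := (T * T)%type.
Local Notation mu := (@lebesgue_measure R).
Local Notation phi := (log_weight alpha).

Definition gauss (m : nat) : R := expR (m.+1%:R ^+ 2 / (2 * alpha)).

Lemma gamma_gt0 m : 0 < gamma_ alpha m. Proof. exact: expR_gt0. Qed.

Lemma gamma_ge1 m : 1 <= gamma_ alpha m.
Proof. by rewrite -expR0 ler_expR divr_ge0 // mulr_ge0 // ltW. Qed.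

Lemma log_weight_rot u z : modulus u = 1 -> phi (u * z) = phi z.
Proof. by move=> u1; rewrite /log_weight modulusM u1 mul1r. Qed.

Lemma measurable_log_weight :
  measurable_fun [set: P] (fun p : P => expR (- (2 * phi (cplx p)))).
Proof.
apply: measurableT_comp; first exact: measurable_expR.
apply: measurableT_comp; first exact: oppr_measurable.
apply: measurable_funM => //; apply: measurable_funM => //; apply: measurable_funX.
rewrite /logp; apply: measurable_maxr => //.
apply: measurableT_comp; first exact: measurable_ln.
under eq_fun do rewrite modulusE.
have ms : measurable_fun [set: R] (@Num.sqrt R).
  by apply: continuous_measurable_fun; exact: sqrt_continuous.
have mr : measurable_fun [set: P] (fun p : P => p.1 ^+ 2 + p.2 ^+ 2).
  by apply: measurable_funD; apply: measurable_funX; [exact: measurable_fst|exact: measurable_snd].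
exact: (measurableT_comp ms mr).
Qed.

Let mid (m : nat) : R := m.+1%:R / (2 * alpha).

Let a2_gt0 : 0 < 2 * alpha. Proof. by rewrite mulr_gt0. Qed.

Lemma log_weight_outer z : 1 <= modulus z -> phi z = alpha * ln (modulus z) ^+ 2.
Proof. by move=> z1; rewrite /log_weight /logp max_l // ln_ge0. Qed.

Lemma log_weight_inner z : modulus z <= 1 -> phi z = 0.
Proof.
by move=> z1; rewrite /log_weight /logp max_r ?expr0n ?mulr0 // ln_le0.
Qed.

(** Completing the square in log|z|: a Gaussian centred at log gamma_m, times |z|^-2. *)
Let densityE m z : 1 <= modulus z ->
  modulus (z ^+ m) ^+ 2 * expR (- (2 * phi z)) =
  gauss m * expR (- 2 * alpha * (ln (modulus z) - mid m) ^+ 2 - 2 * ln (modulus z)).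
Proof.
move=> z1; have z0 : 0 < modulus z by apply: lt_le_trans z1.
rewrite log_weight_outer // modulusX -{1}(lnK z0) -!expRM_natl -!expRD.
congr expR; rewrite /gauss /mid; set t := ln _.
rewrite -!natr1; field.
by rewrite gt_eqF.
Qed.

(** A product of two Cauchy densities at scale gamma_m. It dominates (1 + (|z| / gamma_m)^2)^-2, and
    its planar integral factors by Tonelli. *)
Let majorant (m : nat) (p : P) : R :=
  (oneDsqr (p.1 / gamma_ alpha m))^-1 * (oneDsqr (p.2 / gamma_ alpha m))^-1.

(** With u = |log(|z| / gamma_m)|, 9 / (2 alpha) is the maximum of 6 u - 2 alpha u^2, which bounds
    the exponent left after division by the majorant; the 4 comes from (1 + x^2)^2 <= 4 exp(4 u) for
    x = |z| / gamma_m. *)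
Let K1 : R := 4 * expR (9 / (2 * alpha)).

Lemma density_le m (p : P) :
  modulus (cplx p ^+ m) ^+ 2 * expR (- (2 * phi (cplx p))) <=
  K1 * gauss m * gamma_ alpha m ^- 2 * majorant m p.
Proof.
set g := gamma_ alpha m; set r := modulus (cplx p).
have g0 : 0 < g := gamma_gt0 m.
have r0 : 0 <= r := modulus_ge0 _.
have gn0 : g != 0 by rewrite gt_eqF.
rewrite -(ler_pM2r (_ : 0 < g ^+ 2 * (1 + (r / g) ^+ 2) ^+ 2)); last first.
  by rewrite mulr_gt0 // exprn_gt0 // ltr_pwDl // sqr_ge0.
have M1 : 1 <= majorant m p * (1 + (r / g) ^+ 2) ^+ 2.
  rewrite /majorant -invfM mulrC ler_pdivlMr ?mul1r; last first.
    by rewrite mulr_gt0 // (lt_le_trans ltr01) // oneDsqr_ge1.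
  rewrite expr2 /oneDsqr; have rE : r ^+ 2 = p.1 ^+ 2 + p.2 ^+ 2 by rewrite modulus_sqr.
  have x2 : 0 <= (p.1 / g) ^+ 2 by exact: sqr_ge0.
  have y2 : 0 <= (p.2 / g) ^+ 2 by exact: sqr_ge0.
  have -> : (r / g) ^+ 2 = (p.1 / g) ^+ 2 + (p.2 / g) ^+ 2.
    by rewrite !exprMn rE mulrDl.
  by apply: ler_pM; lra.
have -> : K1 * gauss m * g ^- 2 * majorant m p * (g ^+ 2 * (1 + (r / g) ^+ 2) ^+ 2) =
  K1 * gauss m * (majorant m p * (1 + (r / g) ^+ 2) ^+ 2).
  by field.
apply: le_trans (_ : K1 * gauss m <= _); last first.
  by rewrite ler_peMr // mulr_ge0 ?mulr_ge0 ?expR_ge0.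
have [r1|r1] := leP 1 r.
  rewrite densityE // -/r; have rp : 0 < r by apply: lt_le_trans r1.
  set t := ln r; set tau := t - mid m.
  have gE : g = expR (mid m) by [].
  have rgE : r / g = expR tau by rewrite expRD expRN -/g lnK.
  have B : (1 + (r / g) ^+ 2) ^+ 2 <= 4 * expR (4 * `|tau|).
    have E1 : 1 <= expR (2 * `|tau|) by rewrite -expR0 ler_expR mulr_ge0.
    have E2 : (r / g) ^+ 2 <= expR (2 * `|tau|).
      by rewrite rgE -expRM_natl ler_expR ler_wpM2l // ler_norm.
    have -> : 4 * expR (4 * `|tau|) = (2 * expR (2 * `|tau|)) ^+ 2.
      by rewrite exprMn -expRM_natl mulrA -!natrM -natrX.
    apply: lerXn2r; rewrite ?nnegrE ?mulr_ge0 ?addr_ge0 ?sqr_ge0 ?expR_ge0 //.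
    by lra.
  apply: le_trans (ler_wpM2l _ (ler_wpM2l _ B)) _.
  - by rewrite mulr_ge0 ?expR_ge0.
  - by rewrite exprn_ge0 // ltW.
  have -> : gauss m * expR (- 2 * alpha * tau ^+ 2 - 2 * t) * (g ^+ 2 * (4 * expR (4 * `|tau|)))
    = 4 * expR (- 2 * alpha * tau ^+ 2 - 2 * tau + 4 * `|tau|) * gauss m.
    rewrite gE -expRM_natl !(mulrCA _ 4) -!mulrA; congr (4 * _).
    rewrite [RHS]mulrC; congr (_ * _); rewrite -!expRD; congr expR.
    by rewrite /tau; ring.
  rewrite ler_wpM2r ?expR_ge0 // ler_wpM2l // ler_expR.
  have nt : - tau <= `|tau| by rewrite -normrN ler_norm.
  have t2 : tau ^+ 2 = `|tau| ^+ 2 by rewrite real_normK ?num_real.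
  rewrite ler_pdivlMr // t2; move: `|tau| nt => u nt.
  have := sqr_ge0 (2 * alpha * u - 3); have := alpha_gt0; nra.
rewrite log_weight_inner ?mulr0 ?oppr0 ?expR0 ?mulr1; last exact: ltW.
have g1 : 1 <= g := gamma_ge1 m.
have A1 : modulus (cplx p ^+ m) ^+ 2 <= 1.
  by rewrite modulusX -exprM exprn_ile1 // ltW.
have A2 : (1 + (r / g) ^+ 2) ^+ 2 <= 4.
  have : r / g <= 1 by rewrite ler_pdivrMr // mul1r; lra.
  move=> rg; have rg0 : 0 <= r / g by rewrite divr_ge0 // ltW.
  have rg2 : (r / g) ^+ 2 <= 1 by rewrite exprn_ile1.
  have -> : (4 : R) = (1 + 1) ^+ 2 by ring.
  by apply: lerXn2r; rewrite ?nnegrE ?addr_ge0 ?sqr_ge0 // lerD2l.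
apply: le_trans (_ : 1 * (g ^+ 2 * 4) <= _).
  apply: ler_pM A1 _; [exact: sqr_ge0|by apply: mulr_ge0; exact: sqr_ge0|].
  by apply: ler_wpM2l => //; exact: sqr_ge0.
rewrite mul1r mulrC /K1 -mulrA ler_wpM2l // /g /gamma_ -expRM_natl -expRD ler_expR.
rewrite /gauss -mulrDl mulrA ler_pM2r ?invr_gt0 //.
by have := sqr_ge0 (m.+1%:R - 1 : R); set q := m.+1%:R; nra.
Qed.

Lemma moment_le m : (moment phi m <= (K1 * pi ^+ 2 * gauss m)%:E)%E.
Proof.
have mq g : measurable_fun [set: T] (fun x : T => ((oneDsqr (x / g))^-1)%:E).
  apply/measurable_EFinP; apply: (measurableT_comp (f := fun x => (oneDsqr x)^-1)).
    by apply: continuous_measurable_fun; exact: continuous_oneDsqrV.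
  exact: measurable_funM.
set g := gamma_ alpha m.
have g0 : 0 < g := gamma_gt0 m.
pose F (p : P) : \bar R := (((oneDsqr (p.1 / g))^-1)%:E * ((oneDsqr (p.2 / g))^-1)%:E)%E.
have mF : measurable_fun [set: P] F.
  apply: emeasurable_funM.
    exact: (measurableT_comp (mq g) measurable_fst).
  exact: (measurableT_comp (mq g) measurable_snd).
have F0 p : (0 <= F p)%E by rewrite mule_ge0 // lee_fin invr_ge0.
have IF : (\int[planar_measure R]_p F p = ((g * pi) ^+ 2)%:E)%E.
  rewrite /planar_measure (@fubini_tonelli1 _ _ _ _ _ mu mu F mF F0).
  transitivity (\int[mu]_x ((g * pi)%:E * ((oneDsqr (x / g))^-1)%:E))%E.
    apply: eq_integral => x _; rewrite /fubini_F /F /=.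
    rewrite (ge0_integralZl mu measurableT (mq g)) => [|y _|].
    - by rewrite integral_oneDsqrV_scaled // muleC.
    - by rewrite lee_fin invr_ge0.
    - by rewrite lee_fin invr_ge0.
  rewrite (ge0_integralZl mu measurableT (mq g)) => [|y _|].
  - by rewrite integral_oneDsqrV_scaled // -EFinM expr2.
  - by rewrite lee_fin invr_ge0.
  - by rewrite lee_fin mulr_ge0 // ?pi_ge0 // ltW.
have K0 : 0 <= K1 * gauss m * g ^- 2.
  by rewrite !mulr_ge0 ?expR_ge0 // invr_ge0 exprn_ge0 // ltW.
apply: le_trans (_ : \int[planar_measure R]_p ((K1 * gauss m * g ^- 2)%:E * F p) <= _)%E.
  apply: ge0_le_integral => //.
  - by move=> p _; rewrite lee_fin mulr_ge0 ?expR_ge0 // exprn_ge0 // modulus_ge0.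
  - exact: (measurable_density2 measurable_log_weight (h := fun z => z ^+ m) (mcomplexX m mcomplex_id)).
  - exact: measurable_funeM.
  - by move=> p _; rewrite /F -!EFinM lee_fin; exact: density_le.
rewrite ge0_integralZl // ?lee_fin // IF -EFinM lee_fin le_eqVlt; apply/orP; left.
by apply/eqP; field; rewrite gt_eqF.
Qed.

Lemma moment_fin m : (moment phi m < +oo)%E.
Proof. by apply: le_lt_trans (moment_le m) _; rewrite ltry. Qed.

Let K2 : R := expR (- 2 * alpha - 2) / 4.

Lemma moment_ge m : ((K2 * gauss m)%:E <= moment phi m)%E.
Proof.
set g := gamma_ alpha m; have g0 : 0 < g := gamma_gt0 m.
have g1 : 1 <= g := gamma_ge1 m.
(* On this square g <= |z| <= 2 g, so log|z| exceeds the centre by at most 1: the Gaussian factor is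
   at least exp(- 2 alpha) and |z|^-2 at least exp(-2) g^-2. The area g^2 / 4 completes [K2]. *)
pose B : set P := `[g, g + g / 2] `*` `[0, g / 2].
have mB : measurable B by apply: measurableX; exact: measurable_itv.
have muB : (planar_measure R B = (g ^+ 2 / 4)%:E)%E.
  rewrite /planar_measure [LHS](product_measure1E mu mu) //= !lebesgue_measure_itv /= !lte_fin.
  by rewrite ltrDl divr_gt0 //= -!EFinB -EFinM; congr (_%:E); field.
have c0 : 0 <= gauss m * expR (- 2 * alpha - 2) * g ^- 2.
  by rewrite !mulr_ge0 ?expR_ge0 // invr_ge0 exprn_ge0 // ltW.
apply: le_trans (_ : \int[planar_measure R]_p
   ((gauss m * expR (- 2 * alpha - 2) * g ^- 2)%:E * (\1_B p)%:E) <= _)%E.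
  have mI : measurable_fun [set: P] (fun p : P => (\1_B p)%:E : \bar R).
    by apply/measurable_EFinP; exact: measurable_indic.
  rewrite (ge0_integralZl _ measurableT mI) => [|p _|]; rewrite ?lee_fin //.
  rewrite integral_indic // setIT muB -EFinM lee_fin le_eqVlt; apply/orP; left.
  by apply/eqP; rewrite /K2; field; rewrite gt_eqF.
apply: ge0_le_integral => //.
- by move=> p _; rewrite mule_ge0 // lee_fin.
- by apply: measurable_funeM; apply/measurable_EFinP; exact: measurable_indic.
- exact: (measurable_density2 measurable_log_weight (h := fun z => z ^+ m) (mcomplexX m mcomplex_id)).
move=> p _; rewrite indicE; case pB : (p \in B); last first.
  by rewrite mule0 lee_fin mulr_ge0 ?expR_ge0 // exprn_ge0 // modulus_ge0.
rewrite mule1; move/set_mem: pB => [/=]; rewrite !in_itv /= => /andP[p1 p1'] /andP[p2 p2'].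
rewrite lee_fin; set r := modulus (cplx p).
have r2 : r ^+ 2 = p.1 ^+ 2 + p.2 ^+ 2 by rewrite modulus_sqr.
have r0 : 0 <= r := modulus_ge0 _.
have gr : g <= r.
  rewrite -ler_sqr ?nnegrE ?(ltW g0) // r2 ler_wpDr ?sqr_ge0 //.
  by rewrite ler_sqr ?nnegrE ?(ltW g0) // (le_trans (ltW g0)).
have r1 : 1 <= r by exact: le_trans gr.
have rp : 0 < r by exact: lt_le_trans r1.
have rg2 : r <= 2 * g.
  have g20 : 0 <= 2 * g by rewrite mulr_ge0 // ltW.
  rewrite -ler_sqr ?nnegrE // r2.
  have x2 : p.1 ^+ 2 <= (g + g / 2) ^+ 2.
    by rewrite ler_sqr ?nnegrE ?addr_ge0 ?divr_ge0 ?(ltW g0) // (le_trans (ltW g0)).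
  have y2 : p.2 ^+ 2 <= (g / 2) ^+ 2.
    by rewrite ler_sqr ?nnegrE ?divr_ge0 ?(ltW g0).
  by apply: le_trans (lerD x2 y2) _; have := sqr_ge0 g; lra.
rewrite densityE // -/r -mulrA ler_wpM2l ?expR_ge0 //.
rewrite -expRM_natl -expRN -expRD ler_expR.
have lnr : ln r <= mid m + 1.
  rewrite -ler_expR lnK // expRD; apply: le_trans rg2 _; rewrite mulrC.
  by rewrite ler_wpM2l ?expR_ge0 // (le_trans _ (expR_ge1Dx 1)).
have lnr' : mid m <= ln r by rewrite -ler_expR lnK.
rewrite -/(mid m).
have : (ln r - mid m) ^+ 2 <= 1 by rewrite exprn_ile1; lra.
move: (_ ^+ 2) => u u1; have := alpha_gt0; nra.
Qed.

Lemma cmoment_bounds : exists2 C : R, 0 < C &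
  forall m, C^-1 * gauss m <= cmoment phi m <= C * gauss m.
Proof.
have p0 : 0 < pi :> R := pi_gt0 R.
have k1 : 0 < K1 by rewrite mulr_gt0 ?expR_gt0.
have k2 : 0 < K2 by rewrite divr_gt0 ?expR_gt0.
pose C := Num.max (K1 * pi ^+ 2) K2^-1.
have C0 : 0 < C by rewrite lt_max invr_gt0 k2 orbT.
exists C => // m; rewrite -!lee_fin -(momentE moment_fin).
apply/andP; split.
  apply: le_trans (moment_ge m); rewrite lee_fin ler_wpM2r ?expR_ge0 //.
  by rewrite -[leRHS]invrK lef_pV2 ?posrE ?invr_gt0 // le_max lexx orbT.
apply: le_trans (moment_le m) _; rewrite lee_fin ler_wpM2r ?expR_ge0 //.
by rewrite le_max lexx.
Qed.

End Moments.

(** * Reproducing kernels *)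

Section PowerSeries.
Context {R : realType}.
Implicit Types (f g h : R[i] -> R[i]) (a b : nat -> R[i]) (z w : R[i]).

Let real_geometric_limit (u : nat -> R) (M : R) : (forall n, `|u n| <= M * 2^-1 ^+ n) ->
  exists L : R, (fun N => \sum_(n < N) u n) @ \oo --> L.
Proof.
move=> uM; suff /cvg_ex [L HL] : cvgn (series u).
  exists L; move: HL; rewrite /series /=.
  by under eq_fun do rewrite big_mkord.
apply: normed_cvg; apply: (@series_le_cvg _ _ (fun n => M * 2^-1 ^+ n)) => //.
- by move=> n; rewrite /= normr_ge0.
- by move=> n; apply: le_trans (uM n).
- by apply: is_cvg_geometric_series; rewrite ger0_norm ?invr_ge0 // invf_lt1 // ltr1n.
Qed.

Lemma geometric_limit a (M : R) : (forall n, modulus (a n) <= M * 2^-1 ^+ n) ->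
  exists L, forall e : R, 0 < e -> exists N0, forall N, (N0 <= N)%N ->
    modulus (L - \sum_(n < N) a n) <= e.
Proof.
move=> aM.
have [x Hx] := real_geometric_limit (u := fun n => complex.Re (a n))
  (fun n => le_trans (Re_le_modulus _) (aM n)).
have [y Hy] := real_geometric_limit (u := fun n => complex.Im (a n))
  (fun n => le_trans (Im_le_modulus _) (aM n)).
exists (x +i* y) => e e0; have e2 : 0 < e / 2 by rewrite divr_gt0.
move: Hx => /cvgrPdist_le /(_ _ e2) [N1 _ HN1].
move: Hy => /cvgrPdist_le /(_ _ e2) [N2 _ HN2].
exists (maxn N1 N2) => N; rewrite geq_max => /andP[/HN1 /= h1 /HN2 /= h2].
apply: le_trans (modulus_le_ReIm _) _.
by rewrite cReD cImD cReN cImN cRe_sum cIm_sum /= (splitr e) lerD.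
Qed.

Lemma expansion_exists a :
  (forall r : R, 0 < r -> exists M : R, forall n, modulus (a n) * r ^+ n <= M) ->
  exists f, expansion f a.
Proof.
move=> Ha; suff /choice [f Hf] : forall z, exists L, forall e : R, 0 < e -> exists N0,
    forall N, (N0 <= N)%N -> modulus (L - psum a N z) <= e by exists f.
move=> z; have z1 : 0 < modulus z + 1 by rewrite ltr_wpDl // modulus_ge0.
have [M HM] := Ha (2 * (modulus z + 1)) (mulr_gt0 (ltr0Sn R 1) z1).
apply: (@geometric_limit (fun n => a n * z ^+ n) M) => n.
rewrite modulusM modulusX exprVn ler_pdivlMr ?exprn_gt0 //.
apply: le_trans (HM n); rewrite -mulrA ler_wpM2l ?modulus_ge0 // mulrC -exprMn.
apply: lerXn2r; rewrite ?nnegrE ?mulr_ge0 ?modulus_ge0 ?(ltW z1) //.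
by rewrite ler_wpM2l // lerDl.
Qed.

Let exp_second_order z w n (r : R) : 1 <= r -> modulus z + modulus w <= r ->
  modulus ((z + w) ^+ n - z ^+ n - n%:R * z ^+ n.-1 * w) <=
  n%:R ^+ 2 * r ^+ n * modulus w ^+ 2.
Proof.
move=> r1 zwr; have r0 : 0 <= r by apply: le_trans r1.
have zr : modulus z <= r by apply: le_trans zwr; rewrite lerDl modulus_ge0.
elim: n => [|n IH].
  by rewrite !expr0 subrr !mul0r subrr modulus0 expr0n /= !mul0r.
have -> : (z + w) ^+ n.+1 - z ^+ n.+1 - n.+1%:R * z ^+ n.+1.-1 * w =
  (z + w) * ((z + w) ^+ n - z ^+ n - n%:R * z ^+ n.-1 * w) + n%:R * z ^+ n.-1 * w ^+ 2.
  case: n {IH} => [|n] /=; first by rewrite !expr0 !expr1; ring.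
  by rewrite !exprS -!natr1; ring.
apply: le_trans (modulusD_le _ _) _; rewrite !modulusM !modulusX.
have n0 : 0 <= n%:R :> R by [].
have mn : modulus (n%:R : R[i]) = n%:R.
  by rewrite -[n%:R](rmorph_nat (@real_complex R)) modulus_real ger0_norm.
rewrite mn.
have A : modulus (z + w) * modulus ((z + w) ^+ n - z ^+ n - n%:R * z ^+ n.-1 * w) <=
    r * (n%:R ^+ 2 * r ^+ n * modulus w ^+ 2).
  apply: ler_pM; rewrite ?modulus_ge0 //.
  exact: le_trans (modulusD_le _ _) zwr.
have B : n%:R * modulus z ^+ n.-1 * modulus w ^+ 2 <= n%:R * r ^+ n.+1 * modulus w ^+ 2.
  rewrite ler_wpM2r ?sqr_ge0 // ler_wpM2l //.
  apply: le_trans (_ : r ^+ n.-1 <= _); first by rewrite lerXn2r ?nnegrE ?modulus_ge0.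
  by rewrite ler_weXn2l // (leq_trans (leq_pred _)).
apply: le_trans (lerD A B) _.
have -> : r * (n%:R ^+ 2 * r ^+ n * modulus w ^+ 2) = n%:R ^+ 2 * (r ^+ n.+1 * modulus w ^+ 2).
  by rewrite [r ^+ n.+1]exprS; ring.
rewrite -!(mulrA _ (r ^+ n.+1)).
have C : 0 <= r ^+ n.+1 * modulus w ^+ 2 by rewrite mulr_ge0 ?exprn_ge0 ?modulus_ge0.
by rewrite -mulrDl ler_wpM2r // -natr1; move: n0; set q := n%:R; nra.
Qed.

Lemma expansion_entire f a : expansion f a -> entire f.
Proof.
move=> fa; apply/entire_cderivable => z.
have [Ha Hf] := fa.
pose r := modulus z + 1.
have r1 : 1 <= r by rewrite /r lerDr modulus_ge0.
have r0 : 0 < r by apply: lt_le_trans r1.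
(* In 8 = 4 * 2 the power 4^n absorbs the factor n^2 of [exp_second_order], and 2^n leaves a
   geometric series. *)
have [M HM] := Ha (8 * r) (mulr_gt0 (ltr0Sn R 7) r0).
have term n : modulus (a n) * (n%:R ^+ 2 * r ^+ n) <= M * 2^-1 ^+ n.
  rewrite exprVn ler_pdivlMr ?exprn_gt0 //; apply: le_trans (HM n).
  rewrite -mulrA ler_wpM2l ?modulus_ge0 // mulrAC exprMn ler_wpM2r ?exprn_ge0 ?(ltW r0) //.
  have -> : (8 : R) = (2 * 2) * 2 by ring.
  rewrite !exprMn ler_wpM2r ?exprn_ge0 // -expr2.
  apply: lerXn2r; rewrite ?nnegrE ?exprn_ge0 //.
  by rewrite -natrX ler_nat ltnW // ltn_expl.
have [l Hl] : exists L, forall e : R, 0 < e -> exists N0, forall N, (N0 <= N)%N ->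
    modulus (L - \sum_(n < N) a n * (n%:R * z ^+ n.-1)) <= e.
  apply: (@geometric_limit (fun n => a n * (n%:R * z ^+ n.-1)) M) => n.
  apply: le_trans (term n); rewrite !modulusM modulusX ler_wpM2l ?modulus_ge0 //.
  rewrite -[n%:R in leLHS](rmorph_nat (@real_complex R)) modulus_real ger0_norm //.
  apply: ler_pM; rewrite ?exprn_ge0 ?modulus_ge0 //.
    by rewrite -natrX ler_nat; case: (n) => // k; rewrite -[X in (X <= _)%N]muln1 leq_mul2l.
  apply: le_trans (_ : r ^+ n.-1 <= _).
    by rewrite lerXn2r ?nnegrE ?modulus_ge0 ?(ltW r0) // lerDl.
  by rewrite ler_weXn2l // leq_pred.
have M0 : 0 <= M.
  by apply: le_trans (HM 0%N); rewrite mulr_ge0 ?modulus_ge0 // exprn_ge0 // mulr_ge0 // ltW.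
exists l => eps eps0; pose d := Num.min 1 (eps / (2 * M + 1)).
have M1 : 0 < 2 * M + 1 by rewrite ltr_wpDl // mulr_ge0.
have d0 : 0 < d by rewrite lt_min ltr01 divr_gt0.
exists d => // w; rewrite lt_min => /andP[w1 wd].
apply/ler_addgt0Pr => e e0.
have e3 : 0 < e / 3 by rewrite divr_gt0.
have e3w : 0 < e / 3 / (modulus w + 1) by rewrite divr_gt0 // ltr_wpDl ?modulus_ge0.
have [N1 HN1] := Hf (z + w) _ e3; have [N2 HN2] := Hf z _ e3.
have [N3 HN3] := Hl _ e3w.
pose N := maxn N1 (maxn N2 N3).
have /HN1 h1 : (N1 <= N)%N by rewrite leq_maxl.
have /HN2 h2 : (N2 <= N)%N by rewrite (leq_trans _ (leq_maxr _ _)) // leq_maxl.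
have /HN3 h3 : (N3 <= N)%N by rewrite (leq_trans _ (leq_maxr _ _)) // leq_maxr.
set S := \sum_(n < N) _ in h3.
have -> : f (z + w) - f z - l * w = (psum a N (z + w) - psum a N z - S * w)
  + ((f (z + w) - psum a N (z + w)) - (f z - psum a N z) - (l - S) * w) by ring.
apply: le_trans (modulusD_le _ _) _; apply: lerD.
  have -> : psum a N (z + w) - psum a N z - S * w =
      \sum_(n < N) a n * ((z + w) ^+ n - z ^+ n - n%:R * z ^+ n.-1 * w).
    rewrite /psum /S mulr_suml -!sumrB; apply: eq_bigr => n _; ring.
  apply: le_trans (modulus_sum _ _ _) _.
  have zwr : modulus z + modulus w <= r by rewrite /r lerD2l ltW.
  apply: le_trans (_ : \sum_(n < N) M * modulus w ^+ 2 * 2^-1 ^+ n <= _).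
    apply: ler_sum => n _; rewrite modulusM.
    apply: le_trans (ler_wpM2l (modulus_ge0 _) (exp_second_order n r1 zwr)) _.
    rewrite mulrA [leRHS]mulrAC; apply: ler_wpM2r; last exact: term.
    by rewrite exprn_ge0 // modulus_ge0.
  rewrite -mulr_sumr.
  have -> : \sum_(n < N) 2^-1 ^+ n = 2 - 2 * 2^-1 ^+ N :> R.
    elim: (N) => [|k IH]; first by rewrite big_ord0 expr0 mulr1 subrr.
    by rewrite big_ord_recr /= IH exprS; field.
  apply: le_trans (_ : M * modulus w ^+ 2 * 2 <= _).
    rewrite ler_wpM2l ?mulr_ge0 ?exprn_ge0 ?modulus_ge0 // gerBl mulr_ge0 //.
  have W : (2 * M + 1) * modulus w <= eps by rewrite mulrC -ler_pdivlMr // ltW.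
  have w0 := modulus_ge0 w; rewrite expr2; move: (modulus w) w0 W => u u0 W; nra.
apply: le_trans (modulusB_le _ _) _; have -> : e = e / 3 + e / 3 + e / 3 by field.
apply: lerD; first by apply: le_trans (modulusB_le _ _) _; exact: lerD.
rewrite modulusM; apply: le_trans (ler_wpM2r (modulus_ge0 _) h3) _.
by rewrite mulrAC ler_pdivrMr ?ltr_wpDl ?modulus_ge0 // ler_wpM2l ?(ltW e3) // lerDl.
Qed.

End PowerSeries.

(** * Reproducing kernels of a radial weight *)

Section ReproducingKernel.
Context {R : realType}.
Local Notation T := (measurableTypeR R).
Local Notation P := (T * T)%type.
Local Notation mu2 := (planar_measure R).
Variable phi : R[i] -> R.
Hypothesis phi_rot : forall u z, modulus u = 1 -> phi (u * z) = phi z.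
Hypothesis phi_meas : measurable_fun [set: P] (fun p : P => expR (- (2 * phi (cplx p)))).
Hypothesis moment_fin : forall m, (moment phi m < +oo)%E.
Local Notation c := (cmoment phi).
Hypothesis c_gt0 : forall m, 0 < c m.
Hypothesis c_growth : forall r : R, 0 < r -> exists M : R, forall m, r ^+ m / c m <= M.
Implicit Types (f g h : R[i] -> R[i]) (a b : nat -> R[i]) (z w : R[i]).

Let nrm a K : R := \sum_(m < K) modulus (a m) ^+ 2 * c m.

Lemma modulusD_sqr z w : modulus (z + w) ^+ 2 <= 2 * modulus z ^+ 2 + 2 * modulus w ^+ 2.
Proof.
rewrite !modulus_sqr cReD cImD.
have := sqr_ge0 (complex.Re z - complex.Re w).
have := sqr_ge0 (complex.Im z - complex.Im w); nra.
Qed.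

Lemma expansionD f g a b : expansion f a -> expansion g b ->
  expansion (fun z => f z + g z) (fun m => a m + b m).
Proof.
move=> [Ha Hf] [Hb Hg]; split=> [r r0|z e e0].
  have [M HM] := Ha r r0; have [M' HM'] := Hb r r0.
  exists (M + M') => n; apply: le_trans (lerD (HM n) (HM' n)).
  by rewrite -mulrDl ler_wpM2r ?exprn_ge0 ?(ltW r0) // modulusD_le.
have e2 : 0 < e / 2 by rewrite divr_gt0.
have [N1 H1] := Hf z _ e2; have [N2 H2] := Hg z _ e2.
exists (maxn N1 N2) => N; rewrite geq_max => /andP[/H1 h1 /H2 h2].
have -> : f z + g z - psum (fun m => a m + b m) N z =
    (f z - psum a N z) + (g z - psum b N z).
  rewrite /psum; under eq_bigr do rewrite mulrDl.
  by rewrite big_split /=; ring.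
by apply: le_trans (modulusD_le _ _) _; rewrite (splitr e) lerD.
Qed.

Lemma expansionZ f a (k : R[i]) : expansion f a ->
  expansion (fun z => k * f z) (fun m => k * a m).
Proof.
move=> [Ha Hf]; split=> [r r0|z e e0].
  have [M HM] := Ha r r0; exists (modulus k * M) => n.
  by rewrite modulusM -mulrA ler_wpM2l ?modulus_ge0.
have k1 : 0 < modulus k + 1 by rewrite ltr_wpDl // modulus_ge0.
have [N0 HN0] := Hf z _ (divr_gt0 e0 k1); exists N0 => N /HN0 h.
have -> : k * f z - psum (fun m => k * a m) N z = k * (f z - psum a N z).
  rewrite /psum mulrBr mulr_sumr; congr (_ - _).
  by apply: eq_bigr => m _; rewrite mulrA.
rewrite modulusM; apply: le_trans (ler_wpM2l (modulus_ge0 k) h) _.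
by rewrite mulrCA ler_piMr ?(ltW e0) // ler_pdivrMr // mul1r lerDl.
Qed.

Lemma sum_delta (V : nmodType) (F : nat -> V) n K :
  \sum_(m < K) (if m == n :> nat then F m else 0) = if (n < K)%N then F n else 0.
Proof.
rewrite -big_mkcond /=; case: ifP => nK; last first.
  by rewrite big1 // => m /eqP mn; rewrite -mn ltn_ord in nK.
by rewrite (big_pred1 (Ordinal nK)).
Qed.

Lemma expansion_monomial n :
  expansion (fun z => z ^+ n) (fun m => if m == n then 1 else 0).
Proof.
split=> [r r0|z e e0].
  exists (r ^+ n) => m; case: eqP => [->|_]; first by rewrite modulus1 mul1r.
  by rewrite modulus0 mul0r exprn_ge0 // ltW.
exists n.+1 => N nN; rewrite /psum.
under eq_bigr => m _ do rewrite (fun_if (fun x => x * _)) mul1r mul0r.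
by rewrite (sum_delta (fun m => z ^+ m)) nN subrr modulus0 ltW.
Qed.

Lemma fock_space_expansion f a (B : R) : expansion f a -> (forall K, nrm a K <= B) ->
  fock_space phi f.
Proof.
move=> fa HB; split; first exact: expansion_entire fa.
apply: le_lt_trans (fock_sqnorm_le phi_rot phi_meas moment_fin fa HB) _.
by rewrite ltry.
Qed.

Lemma nrm_le_fine f a K : expansion f a -> fock_space phi f ->
  nrm a K <= fine (fock_sqnorm phi f).
Proof.
move=> fa [_ ff]; rewrite -lee_fin fineK ?ge0_fin_numE ?fock_sqnorm_ge0 //.
exact: fock_sqnorm_ge.
Qed.

(** The two Fatou inequalities together give the exact norm as the limit of the coefficient sums. *)
Lemma nrm_cvg f a : expansion f a -> fock_space phi f ->
  nrm a @ \oo --> fine (fock_sqnorm phi f).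
Proof.
move=> fa Ff; have [_ ff] := Ff.
have nd : {homo nrm a : m n / (m <= n)%N >-> m <= n}.
  apply/nondecreasing_seqP => K; rewrite /nrm big_ord_recr /= lerDl.
  by rewrite mulr_ge0 ?(ltW (c_gt0 _)) // exprn_ge0 // modulus_ge0.
have cn : cvgn (nrm a).
  apply: nondecreasing_is_cvgn => //; exists (fine (fock_sqnorm phi f)) => _ [K _ <-].
  exact: nrm_le_fine.
suff -> : fine (fock_sqnorm phi f) = limn (nrm a) by [].
apply/eqP; rewrite eq_le; apply/andP; split; last first.
  by apply: limr_le => //; near=> K; exact: nrm_le_fine.
rewrite -lee_fin fineK ?ge0_fin_numE ?fock_sqnorm_ge0 //.
apply: (fock_sqnorm_le phi_rot phi_meas moment_fin fa) => K.
exact: nondecreasing_cvgn_le.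
Unshelve. all: by end_near. Qed.

Lemma nrm_bounded f a : expansion f a -> fock_space phi f ->
  exists B, forall K, nrm a K <= B.
Proof. by move=> fa ff; exists (fine (fock_sqnorm phi f)) => K; exact: nrm_le_fine. Qed.

Lemma fock_spaceD f g : fock_space phi f -> fock_space phi g ->
  fock_space phi (fun z => f z + g z).
Proof.
move=> Ff Fg; have [a fa] := entire_expansion Ff.1; have [b gb] := entire_expansion Fg.1.
have [A HA] := nrm_bounded fa Ff; have [B HB] := nrm_bounded gb Fg.
apply: (fock_space_expansion (B := 2 * A + 2 * B) (expansionD fa gb)) => K.
apply: le_trans (lerD (ler_wpM2l _ (HA K)) (ler_wpM2l _ (HB K))) => //.
rewrite /nrm !mulr_sumr -big_split /=; apply: ler_sum => m _.
rewrite (mulrA 2 (modulus (a m) ^+ 2)) (mulrA 2 (modulus (b m) ^+ 2)) -mulrDl; apply: ler_wpM2r; first exact: ltW (c_gt0 m).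
exact: modulusD_sqr.
Qed.

Lemma fock_spaceZ f (k : R[i]) : fock_space phi f -> fock_space phi (fun z => k * f z).
Proof.
move=> Ff; have [a fa] := entire_expansion Ff.1; have [A HA] := nrm_bounded fa Ff.
apply: (fock_space_expansion (B := modulus k ^+ 2 * A) (expansionZ k fa)) => K.
apply: le_trans (ler_wpM2l (sqr_ge0 _) (HA K)).
rewrite /nrm mulr_sumr; apply: ler_sum => m _.
by rewrite modulusM exprMn -mulrA.
Qed.

Let integrable_sqr h : fock_space phi h ->
  mu2.-integrable setT (fun p : P => (modulus (h (cplx p)) ^+ 2 * expR (- (2 * phi (cplx p))))%:E).
Proof.
move=> Fh; have [a ha] := entire_expansion Fh.1; apply/integrableP; split.
  exact: measurable_density2 (mcomplex_expansion ha).
move: Fh => [_]; apply: le_lt_trans; rewrite le_eqVlt; apply/orP; left; apply/eqP.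
apply: eq_integral => p _; rewrite gee0_abs // lee_fin mulr_ge0 ?expR_ge0 //.
by rewrite exprn_ge0 // modulus_ge0.
Qed.

Let inner_partial a b K : R[i] := \sum_(m < K) a m * (b m)^*%R * (c m)%:C.

(** Polarization holds both pointwise and coefficientwise, so convergence of the inner products
    follows from that of the norms of f + g and f - g. *)
Lemma fock_inner_Re f g a b : expansion f a -> expansion g b ->
  fock_space phi f -> fock_space phi g ->
  (fun K => complex.Re (inner_partial a b K)) @ \oo --> complex.Re (fock_inner phi f g).
Proof.
move=> fa gb Ff Fg; have gNb := expansionZ (-1) gb.
have FD := fock_spaceD Ff Fg; have FB := fock_spaceD Ff (fock_spaceZ (-1) Fg).
have -> : complex.Re (fock_inner phi f g) =
   (fine (fock_sqnorm phi (fun z => f z + g z))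
    - fine (fock_sqnorm phi (fun z => f z + (-1) * g z))) / 4.
  rewrite /fock_inner /= -[fine (fock_sqnorm _ _)]/(Rintegral _ _ _).
  rewrite -[X in _ - X]/(Rintegral _ _ _).
  have iD : mu2.-integrable [set: P] (EFin \o (fun p : P =>
    modulus (f (cplx p) + g (cplx p)) ^+ 2 * expR (- (2 * phi (cplx p))))) := integrable_sqr FD.
  have iB : mu2.-integrable [set: P] (EFin \o (fun p : P =>
    modulus (f (cplx p) + (-1) * g (cplx p)) ^+ 2 * expR (- (2 * phi (cplx p))))) := integrable_sqr FB.
  rewrite -(RintegralB measurableT iD iB).
  have iDB := integrableB measurableT iD iB.
  rewrite -(RintegralZr _ measurableT iDB).
  apply: eq_Rintegral => p _; rewrite !modulus_sqr !cReD !cImD !cReM !cImM cReJ cImJ /=.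
  by field.
have -> : (fun K => complex.Re (inner_partial a b K)) =
   (fun K => (nrm (fun m => a m + b m) K - nrm (fun m => a m + (-1) * b m) K) / 4).
  apply/funext => K; rewrite /inner_partial /nrm cRe_sum -sumrB mulr_suml.
  apply: eq_bigr => m _; rewrite !modulus_sqr !cReD !cImD !cReM !cImM cReJ cImJ /=.
  by field.
apply: cvgMl; apply: cvgB; first exact: nrm_cvg (expansionD fa gb) FD.
exact: nrm_cvg (expansionD fa gNb) FB.
Qed.

Lemma fock_inner_cvg f g a b : expansion f a -> expansion g b ->
  fock_space phi f -> fock_space phi g ->
  forall e : R, 0 < e -> exists N0, forall K, (N0 <= K)%N ->
    modulus (fock_inner phi f g - inner_partial a b K) <= e.
Proof.
move=> fa gb Ff Fg e e0; have e2 : 0 < e / 2 by rewrite divr_gt0.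
have := fock_inner_Re fa gb Ff Fg.
(* Replacing g by i g turns the real part of the inner product into the imaginary part. *)
have := fock_inner_Re fa (expansionZ ('i)%C gb) Ff (fock_spaceZ ('i)%C Fg).
have -> : complex.Re (fock_inner phi f (fun z => ('i)%C * g z)) = complex.Im (fock_inner phi f g).
  rewrite /fock_inner /=; apply: eq_Rintegral => p _; congr (_ * _).
  by rewrite !(cReM, cImM, cReJ, cImJ) /=; ring.
have -> : (fun K => complex.Re (inner_partial a (fun m => ('i)%C * b m) K)) =
    (fun K => complex.Im (inner_partial a b K)).
  apply/funext => K; rewrite /inner_partial cRe_sum cIm_sum; apply: eq_bigr => m _.
  by rewrite !(cReM, cImM, cReJ, cImJ) /=; ring.
move=> /cvgrPdist_le /(_ _ e2) [N1 _ H1] /cvgrPdist_le /(_ _ e2) [N2 _ H2].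
exists (maxn N1 N2) => K; rewrite geq_max => /andP[/H1 /= h1 /H2 /= h2].
apply: le_trans (modulus_le_ReIm _) _.
by rewrite cReD cImD cReN cImN (splitr e) lerD.
Qed.

Definition kernel_coef z m : R[i] := (z^*)%R ^+ m / (c m)%:C.

Lemma modulus_kernel_coef z m : modulus (kernel_coef z m) = modulus z ^+ m / c m.
Proof.
by rewrite /kernel_coef modulus_div modulusX modulusJ modulus_real gtr0_norm.
Qed.

Lemma kernel_coef_nrm z K : nrm (kernel_coef z) K = \sum_(m < K) (modulus z ^+ m) ^+ 2 / c m.
Proof.
apply: eq_bigr => m _; rewrite modulus_kernel_coef.
by field; rewrite gt_eqF.
Qed.

(** Testing on the monomials z^n determines every coefficient, so whichever kernel [xget] selects
    has the expected expansion. *)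
Lemma reproduces_expansion z k b : expansion k b -> reproduces_at phi z k ->
  b = kernel_coef z.
Proof.
move=> kb [Fk Hk]; apply/funext => n.
have dn := expansion_monomial n.
have Fd : fock_space phi (fun z => z ^+ n).
  apply: (fock_space_expansion (B := c n) dn) => K; rewrite /nrm.
  under eq_bigr => m _ do rewrite (fun_if (fun x => modulus x ^+ 2 * _)) modulus1
    modulus0 expr1n mul1r expr0n mul0r.
  by rewrite sum_delta; case: ifP => // _; exact: ltW.
have bn : (b n)^*%R * (c n)%:C = z ^+ n.
  apply/eqP; rewrite -subr_eq0; apply/eqP; apply: modulus_le0_eq0 => e e0.
  have [N0 HN0] := fock_inner_cvg dn kb Fd Fk e0.
  have := HN0 (maxn N0 n.+1) (leq_maxl _ _).
  rewrite Hk // modulusB /inner_partial.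
  under eq_bigr => m _ do rewrite (fun_if (fun x => x * _ * _)) mul1r !mul0r.
  by rewrite (sum_delta (fun m => (b m)^*%R * (c m)%:C)) leq_maxr.
have cn : (c n)%:C != 0 :> R[i] by rewrite -modulus_eq0 modulus_real normr_eq0 gt_eqF.
rewrite /kernel_coef -cJX -bn cJM cJK cJ_real mulfK //.
Qed.

Lemma kernel_exists z : exists2 k, expansion k (kernel_coef z) & fock_space phi k.
Proof.
have rapid r : 0 < r -> exists M : R, forall n, modulus (kernel_coef z n) * r ^+ n <= M.
  move=> r0; have z1 : 0 < (modulus z + 1) * r by rewrite mulr_gt0 // ltr_wpDl // modulus_ge0.
  have [M HM] := c_growth z1; exists M => n; apply: le_trans (HM n).
  rewrite modulus_kernel_coef mulrAC -exprMn ler_wpM2r ?invr_ge0 ?(ltW (c_gt0 n)) //.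
  apply: lerXn2r; rewrite ?nnegrE ?mulr_ge0 ?addr_ge0 ?modulus_ge0 ?(ltW r0) //.
  by rewrite ler_wpM2r ?(ltW r0) // lerDl.
have [k kz] := expansion_exists rapid; exists k => //.
(* The squared norm involves |z|^(2 m) / c_m; the factor 2 makes it summable. *)
pose r := 2 * (modulus z + 1) ^+ 2.
have r0 : 0 < r by rewrite mulr_gt0 // exprn_gt0 // ltr_wpDl // modulus_ge0.
have [M HM] := c_growth r0.
apply: (fock_space_expansion (B := 2 * M) kz) => K; rewrite kernel_coef_nrm.
have M0 : 0 <= M.
  by apply: le_trans (HM 0%N); rewrite expr0 divr_ge0 // ltW.
apply: le_trans (_ : \sum_(m < K) M * 2^-1 ^+ m <= _).
  apply: ler_sum => m _; rewrite exprVn ler_pdivlMr ?exprn_gt0 //.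
  apply: le_trans (HM m); rewrite mulrAC ler_wpM2r ?invr_ge0 ?(ltW (c_gt0 m)) //.
  rewrite -exprM mulnC exprM -exprMn mulrC.
  have zz : modulus z ^+ 2 <= (modulus z + 1) ^+ 2.
    by rewrite ler_sqr ?nnegrE ?addr_ge0 ?modulus_ge0 // lerDl.
  apply: lerXn2r; rewrite ?nnegrE ?(ltW r0) //; last by rewrite ler_wpM2l.
  by apply: mulr_ge0 => //; exact: sqr_ge0.
rewrite -mulr_sumr mulrC ler_wpM2r //.
have -> : \sum_(n < K) 2^-1 ^+ n = 2 - 2 * 2^-1 ^+ K :> R.
  elim: (K) => [|j IH]; first by rewrite big_ord0 expr0 mulr1 subrr.
  by rewrite big_ord_recr /= IH exprS; field.
by rewrite gerBl mulr_ge0 // exprn_ge0 // invr_ge0.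
Qed.

Lemma kernel_reproduces z k : expansion k (kernel_coef z) -> fock_space phi k ->
  reproduces_at phi z k.
Proof.
move=> kz Fk; split => // f Ff; have [a fa] := entire_expansion Ff.1.
apply/eqP; rewrite -subr_eq0; apply/eqP; apply: modulus_le0_eq0 => e e0.
have e2 : 0 < e / 2 by rewrite divr_gt0.
have [N1 H1] := fock_inner_cvg fa kz Ff Fk e2.
have [N2 H2] := fa.2 z _ e2.
have := H1 (maxn N1 N2) (leq_maxl _ _); have := H2 (maxn N1 N2) (leq_maxr _ _).
set K := maxn N1 N2.
have -> : inner_partial a (kernel_coef z) K = psum a K z.
  apply: eq_bigr => m _; rewrite /kernel_coef -cJX.
  have cm : (c m)%:C != 0 :> R[i] by rewrite -modulus_eq0 modulus_real normr_eq0 gt_eqF.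
  rewrite -mulrA; congr (_ * _).
  have -> : (c m)%:C^-1 = ((c m)^-1)%:C :> R[i] by rewrite fmorphV.
  by rewrite cJM cJK cJ_real -mulrA fmorphV mulVf ?mulr1.
move=> h2 h1; rewrite modulusB in h2.
have -> : fock_inner phi f k - f z = (fock_inner phi f k - psum a K z) + (psum a K z - f z) by ring.
by apply: le_trans (modulusD_le _ _) _; rewrite (splitr e) lerD.
Qed.

Lemma repr_kernel_reproduces z : reproduces_at phi z (repr_kernel phi z).
Proof.
have [k kz Fk] := kernel_exists z.
have : exists k, [set k | reproduces_at phi z k] k.
  by exists k; exact: kernel_reproduces.
exact: xgetPex.
Qed.

Lemma repr_kernel_expansion z : expansion (repr_kernel phi z) (kernel_coef z).
Proof.
have H := repr_kernel_reproduces z; have [b kb] := entire_expansion H.1.1.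
by rewrite -(reproduces_expansion kb H).
Qed.

Definition kernel_norm z : R := fock_norm phi (repr_kernel phi z).

Lemma kernel_norm_cvg z :
  (fun K => \sum_(m < K) (modulus z ^+ m) ^+ 2 / c m) @ \oo --> kernel_norm z ^+ 2.
Proof.
rewrite /kernel_norm /fock_norm sqr_sqrtr ?fine_ge0 ?fock_sqnorm_ge0 //.
have := nrm_cvg (repr_kernel_expansion z) (repr_kernel_reproduces z).1.
have <- : nrm (kernel_coef z) = fun K => \sum_(m < K) (modulus z ^+ m) ^+ 2 / c m.
  by apply/funext => K; exact: kernel_coef_nrm.
by [].
Qed.

Lemma kernel_norm_ge z m : modulus z ^+ m / Num.sqrt (c m) <= kernel_norm z.
Proof.
have k0 : 0 <= kernel_norm z by exact: sqrtr_ge0.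
rewrite -ler_sqr ?nnegrE ?divr_ge0 ?exprn_ge0 ?modulus_ge0 ?sqrtr_ge0 //.
rewrite expr_div_n sqr_sqrtr ?(ltW (c_gt0 m)) //.
have nd : {homo (fun K => \sum_(m < K) (modulus z ^+ m) ^+ 2 / c m) : m n / (m <= n)%N >-> m <= n}.
  apply/nondecreasing_seqP => K; rewrite big_ord_recr /= lerDl.
  by rewrite divr_ge0 ?(ltW (c_gt0 _)) // exprn_ge0 // exprn_ge0 // modulus_ge0.
have := nondecreasing_cvgn_le nd (cvgP _ (kernel_norm_cvg (z := z))) m.+1.
rewrite (cvg_lim _ (kernel_norm_cvg (z := z))) //; apply: le_trans.
rewrite big_ord_recr /= lerDr sumr_ge0 // => i _.
by rewrite divr_ge0 ?(ltW (c_gt0 _)) // exprn_ge0 // exprn_ge0 // modulus_ge0.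
Qed.

Lemma kernel_norm_gt0 z : 0 < kernel_norm z.
Proof.
apply: lt_le_trans (kernel_norm_ge z 0).
by rewrite expr0 divr_gt0 // sqrtr_gt0.
Qed.

Lemma kernel_norm_le z (B : R) : (forall K, \sum_(m < K) (modulus z ^+ m) ^+ 2 / c m <= B) ->
  kernel_norm z ^+ 2 <= B.
Proof.
move=> HB; rewrite -(cvg_lim _ (kernel_norm_cvg (z := z))) //.
apply: limr_le; first exact: cvgP (kernel_norm_cvg (z := z)).
by near=> K; exact: HB.
Unshelve. all: by end_near. Qed.

End ReproducingKernel.

(** * Riesz bases of sequences localized near the diagonal *)

Section FiniteEstimates.
Context {R : realType}.
Implicit Types (x t : nat -> R) (q : R).

Lemma weighted_cauchy_schwarz N x t : (forall n, 0 <= t n) ->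
  (\sum_(n < N) x n * t n) ^+ 2 <= (\sum_(n < N) t n) * (\sum_(n < N) x n ^+ 2 * t n).
Proof.
move=> t0; elim: N => [|N IH]; first by rewrite !big_ord0 mul0r expr0n.
rewrite !big_ord_recr /=.
have T0 : 0 <= \sum_(n < N) t n by rewrite sumr_ge0.
have Q0 : 0 <= \sum_(n < N) x n ^+ 2 * t n.
  by rewrite sumr_ge0 // => n _; rewrite mulr_ge0 // sqr_ge0.
set S := \sum_(n < N) x n * t n in IH *.
set T := \sum_(n < N) t n in IH T0 *.
set Q := \sum_(n < N) x n ^+ 2 * t n in IH Q0 *.
have K : 2 * S * x N <= T * x N ^+ 2 + Q.
  have [T00|Tn] := eqVneq T 0.
    have /eqP : S ^+ 2 <= 0 by move: IH; rewrite T00 mul0r.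
    rewrite T00 mul0r add0r => S2.
    have S0 : S = 0 by apply/eqP; rewrite -sqrf_eq0 eq_le sqr_ge0 andbT; apply/eqP/S2.
    by rewrite S0 mulr0 mul0r.
  have Tp : 0 < T by rewrite lt_def Tn.
  rewrite -(ler_pM2l Tp); have := sqr_ge0 (T * x N - S); nra.
have := ler_wpM2r (t0 N) K; have := t0 N; nra.
Qed.

(** Schur's test for a dominated vector y; this form serves combinations of rows, frame coefficients
    and the finite inverses alike. *)
Lemma schur_test N M (a y : nat -> R[i]) (t : nat -> nat -> R) (A B : R) :
  (forall n m, 0 <= t n m) -> 0 <= A -> 0 <= B ->
  (forall m, (m < M)%N -> modulus (y m) <= \sum_(n < N) modulus (a n) * t n m) ->
  (forall n, (n < N)%N -> \sum_(m < M) t n m <= A) ->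
  (forall m, (m < M)%N -> \sum_(n < N) t n m <= B) ->
  \sum_(m < M) modulus (y m) ^+ 2 <= A * B * \sum_(n < N) modulus (a n) ^+ 2.
Proof.
move=> t0 A0 B0 Hy HA HB.
have step (m : 'I_M) : modulus (y m) ^+ 2 <= B * \sum_(n < N) modulus (a n) ^+ 2 * t n m.
  have S0 : 0 <= \sum_(n < N) modulus (a n) * t n m.
    by rewrite sumr_ge0 // => n _; rewrite mulr_ge0 // modulus_ge0.
  apply: le_trans (_ : (\sum_(n < N) modulus (a n) * t n m) ^+ 2 <= _).
    by rewrite ler_sqr ?nnegrE ?modulus_ge0 // Hy.
  apply: le_trans (weighted_cauchy_schwarz N (fun n => modulus (a n)) (fun n => t0 n m)) _.
  apply: ler_wpM2r; last exact: HB.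
  by rewrite sumr_ge0 // => n _; rewrite mulr_ge0 // sqr_ge0.
apply: le_trans (ler_sum _ (fun m _ => step m)) _.
rewrite -mulr_sumr exchange_big /= [A * B]mulrC -mulrA; apply: ler_wpM2l => //.
rewrite mulr_sumr; apply: ler_sum => n _.
rewrite -mulr_sumr mulrC; apply: ler_wpM2r; first exact: sqr_ge0.
exact: HA.
Qed.

Definition ndist (i j : nat) : nat := (i - j) + (j - i).

Lemma ndistC i j : ndist i j = ndist j i. Proof. by rewrite /ndist addnC. Qed.

Lemma ndist_ge i j : (j <= i)%N -> ndist i j = (i - j)%N.
Proof. by move=> ji; rewrite /ndist (eqP (_ : (j - i)%N == 0%N)) ?addn0 ?subn_eq0. Qed.

Lemma ndist_le i j : (i <= j)%N -> ndist i j = (j - i)%N.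
Proof. by move=> ij; rewrite ndistC ndist_ge. Qed.

Lemma geometric_sum_le q N : 0 <= q < 1 -> \sum_(n < N) q ^+ n <= (1 - q)^-1.
Proof.
move=> /andP[q0 q1]; have p0 : 0 < 1 - q by rewrite subr_gt0.
have := subrX1 q N; rewrite -opprB -[q - 1]opprB mulNr => /oppr_inj H.
rewrite -[leRHS]mulr1 -[leLHS](mulKf (lt0r_neq0 p0)) -H ler_wpM2l ?invr_ge0 ?(ltW p0) //.
by rewrite gerBl exprn_ge0.
Qed.

Lemma geometric_sum_ge q M L N : 0 <= q < 1 -> (L <= M)%N ->
  \sum_(M <= n < N) q ^+ (n - (M - L)) <= q ^+ L / (1 - q).
Proof.
move=> q01 LM; have /andP[q0 q1] := q01.
have [NM|MN] := leqP N M.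
  by rewrite big_geq // divr_ge0 ?exprn_ge0 // subr_ge0 ltW.
rewrite -{1}(add0n M) big_addn big_mkord.
under eq_bigr => n _.
  rewrite (_ : (n + M - (M - L) = L + n)%N) ?exprD; last first.
    by rewrite subnBA // addnAC addnK addnC.
  over.
by rewrite -mulr_sumr ler_wpM2l ?exprn_ge0 // geometric_sum_le.
Qed.

Lemma ndist_sum q j N : 0 <= q < 1 ->
  \sum_(n < N) q ^+ ndist n j <= 2 / (1 - q).
Proof.
move=> q01; have /andP[q0 q1] := q01.
have p0 : 0 < 1 - q by rewrite subr_gt0.
apply: le_trans (_ : \sum_(n < N + j) q ^+ ndist n j <= _).
  rewrite big_split_ord /= lerDl sumr_ge0 // => i _; exact: exprn_ge0.
rewrite addnC big_split_ord /=.
have -> : 2 / (1 - q) = (1 - q)^-1 + (1 - q)^-1 by rewrite mulrDl mul1r.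
apply: lerD; last first.
  apply: le_trans (geometric_sum_le N q01); apply: ler_sum => i _.
  by rewrite ndist_ge ?leq_addr // addKn.
rewrite (reindex_inj rev_ord_inj) /=.
apply: le_trans (geometric_sum_le j q01); apply: ler_sum => i _.
rewrite ndist_le ?leq_subr // subKn // exprS ler_piMl ?exprn_ge0 //.
exact: ltW.
Qed.

Lemma kernel_vector (A : nat -> nat -> R[i]) M N : (M < N)%N ->
  exists a : nat -> R[i], 0 < \sum_(n < N) modulus (a n) ^+ 2 /\
    forall m, (m < M)%N -> \sum_(n < N) a n * A n m = 0.
Proof.
move=> MN; pose B := \matrix_(n < N, m < M) A n m.
have : kermx B != 0.
  rewrite kermx_eq0 /row_free neq_ltn (leq_ltn_trans (rank_leq_col B)) //.
move=> /rowV0Pn [v /sub_kermxP vB v0].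
pose a n := if insub n is Some i then v 0 i else 0.
have aE (i : 'I_N) : a i = v 0 i by rewrite /a valK.
exists a; split.
  have [i vi] : exists i, v 0 i != 0.
    apply/existsP; apply: contraNT v0; rewrite negb_exists => /forallP H.
    apply/eqP/rowP => i; rewrite mxE; apply/eqP; have := H i; by rewrite negbK.
  rewrite (bigD1 i) //= ltr_pwDl //; first by rewrite aE exprn_gt0 // modulus_gt0.
  by rewrite sumr_ge0 // => j _; rewrite sqr_ge0.
move=> m mM; have := congr1 (fun X : 'rV_M => X 0 (Ordinal mM)) vB.
rewrite !mxE => H; rewrite -[RHS]H; apply: eq_bigr => n _.
by rewrite aE !mxE.
Qed.

End FiniteEstimates.

(** * Riesz bases of l^2 formed by the rows of a matrix *)

Section RieszSequences.
Context {R : realType}.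
Implicit Types (a x y : nat -> R[i]) (B : R).

Lemma cauchy_schwarz N (x y : nat -> R) :
  (\sum_(n < N) x n * y n) ^+ 2 <= (\sum_(n < N) x n ^+ 2) * (\sum_(n < N) y n ^+ 2).
Proof.
elim: N => [|N IH]; first by rewrite !big_ord0 mul0r expr0n.
rewrite !big_ord_recr /=.
have P0 : 0 <= \sum_(n < N) x n ^+ 2 by rewrite sumr_ge0 // => n _; exact: sqr_ge0.
have Q0 : 0 <= \sum_(n < N) y n ^+ 2 by rewrite sumr_ge0 // => n _; exact: sqr_ge0.
set S := \sum_(n < N) x n * y n in IH *.
set P := \sum_(n < N) x n ^+ 2 in IH P0 *.
set Q := \sum_(n < N) y n ^+ 2 in IH Q0 *.
have K : 2 * S * (x N * y N) <= P * y N ^+ 2 + Q * x N ^+ 2.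
  apply: le_trans (ler_norm _) _.
  have rhs0 : 0 <= P * y N ^+ 2 + Q * x N ^+ 2 by rewrite addr_ge0 // mulr_ge0 // sqr_ge0.
  rewrite -ler_sqr ?nnegrE // real_normK ?num_real // !exprMn.
  have := sqr_ge0 (P * y N ^+ 2 - Q * x N ^+ 2).
  have := ler_wpM2r (mulr_ge0 (sqr_ge0 (x N)) (sqr_ge0 (y N))) IH.
  move: (x N ^+ 2) (y N ^+ 2) (S ^+ 2) => u v s; nra.
nra.
Qed.

Lemma complex_cauchy_schwarz N (x y : nat -> R[i]) :
  modulus (\sum_(n < N) x n * y n) ^+ 2 <=
  (\sum_(n < N) modulus (x n) ^+ 2) * (\sum_(n < N) modulus (y n) ^+ 2).
Proof.
apply: le_trans (cauchy_schwarz N (fun n => modulus (x n)) (fun n => modulus (y n))).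
rewrite ler_sqr ?nnegrE ?modulus_ge0 ?sumr_ge0 // => [|n _]; last first.
  by rewrite mulr_ge0 ?modulus_ge0.
by apply: le_trans (modulus_sum _ _ _) _; apply: ler_sum => n _; rewrite modulusM.
Qed.

Definition comb (V : nat -> nat -> R[i]) a K m : R[i] := \sum_(n < K) a n * V n m.

Definition l2ub x B := forall M, \sum_(m < M) modulus (x m) ^+ 2 <= B.

(** Upper bound, lower bound and density for the rows of V in l^2. Membership and norms are
    expressed by uniform bounds on partial sums, and e bounds a squared distance. *)
Definition l2riesz (V : nat -> nat -> R[i]) (C : R) : Prop :=
  [/\ forall K a, l2ub (comb V a K) (C * \sum_(n < K) modulus (a n) ^+ 2),
      forall K a B, l2ub (comb V a K) B -> \sum_(n < K) modulus (a n) ^+ 2 <= C * B &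
      forall x B, l2ub x B -> forall e, 0 < e ->
        exists K a, l2ub (fun m => x m - comb V a K m) e].

Lemma l2ub_ge0 x B : l2ub x B -> 0 <= B.
Proof. by move=> /(_ 0%N); rewrite big_ord0. Qed.

Lemma l2ub_le x B B' : B <= B' -> l2ub x B -> l2ub x B'.
Proof. by move=> BB' H M; apply: le_trans (H M) BB'. Qed.

Section FromRiesz.
Variables (V : nat -> nat -> R[i]) (C : R).
Hypothesis C0 : 0 < C.
Hypothesis rV : l2riesz V C.

(** The combination with the conjugates of column j as coefficients has entry S at j, so the upper
    bound reads S^2 <= C S. *)
Lemma riesz_column K j : \sum_(n < K) modulus (V n j) ^+ 2 <= C.
Proof.
have [up _ _] := rV; set S := \sum_(n < K) _.
have S0 : 0 <= S by rewrite sumr_ge0 // => n _; exact: sqr_ge0.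
have := up K (fun n => (V n j)^*%R) j.+1.
under [X in _ <= _ * X]eq_bigr => n _ do rewrite modulusJ.
rewrite -/S big_ord_recr /= => H.
have Sj : comb V (fun n => (V n j)^*%R) K j = S%:C.
  by rewrite /comb /S rmorph_sum /=; apply: eq_bigr => n _; rewrite mulrC mulJ.
have : S ^+ 2 <= C * S.
  apply: le_trans H; rewrite Sj modulus_real ger0_norm // lerDr sumr_ge0 // => i _.
  exact: sqr_ge0.
have [->|Sn] := eqVneq S 0; first by move=> _; exact: ltW.
by rewrite expr2 ler_pM2r // lt_def Sn.
Qed.

(** Duality. Let y be a combination of rows at squared distance at most X / 4 from x, so that |y|^2
    <= 2 X + X / 2 and its coefficients have squared norm at most (5/2) C X. The pairing of x with y
    is then controlled by the frame coefficients, and (X / 2)^2 <= (5/2) C X B gives the constant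
    10. *)
Lemma riesz_frame M x B :
  (forall K, \sum_(k < K) modulus (\sum_(j < M) x j * (V k j)^*%R) ^+ 2 <= B) ->
  \sum_(j < M) modulus (x j) ^+ 2 <= 10 * C * B.
Proof.
move=> HB; have [_ low dense] := rV.
set X := \sum_(j < M) _.
have B0 : 0 <= B by have := HB 0%N; rewrite big_ord0.
have X0 : 0 <= X by rewrite sumr_ge0 // => n _; exact: sqr_ge0.
have [->|Xn] := eqVneq X 0; first by rewrite !mulr_ge0 // ltW.
have Xp : 0 < X by rewrite lt_def Xn.
pose x' j := if (j < M)%N then x j else 0.
have ux' : l2ub x' X.
  move=> M'; apply: le_trans (_ : \sum_(m < M + M') modulus (x' m) ^+ 2 <= _).
    rewrite addnC big_split_ord /= lerDl sumr_ge0 // => n _; exact: sqr_ge0.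
  rewrite big_split_ord /= [X in _ + X]big1 ?addr0 => [|n _]; last first.
    have -> : x' (M + n)%N = 0 by rewrite /x' ltnNge leq_addr.
    by rewrite modulus0 expr0n.
  by rewrite le_eqVlt; apply/orP; left; apply/eqP; apply: eq_bigr => n _; rewrite /x' ltn_ord.
have X4 : 0 < X / 4 by rewrite divr_gt0.
have [K [a Ha]] := dense x' X ux' _ X4.
pose y := comb V a K.
have uy : l2ub y (5 / 2 * X).
  move=> M'; apply: le_trans (_ : \sum_(m < M') (2 * modulus (x' m) ^+ 2 + 2 * modulus (x' m - y m) ^+ 2) <= _).
    apply: ler_sum => m _; rewrite -{1}(subKr (x' m) (y m)) -[modulus (x' m - y m)]modulusN.
    have := modulus_sqr (x' m - (x' m - y m)).
    rewrite !modulus_sqr !cReD !cReN !cImD !cImN !cReD !cReN !cImD !cImN.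
    move: (complex.Re (x' m)) (complex.Im (x' m)) (complex.Re (y m)) (complex.Im (y m)).
    move=> s t u v _; have := sqr_ge0 (s + (s - u)); have := sqr_ge0 (t + (t - v)); nra.
  rewrite big_split /= -!mulr_sumr; have := ux' M'; have := Ha M'; rewrite -/y; lra.
have aC : \sum_(n < K) modulus (a n) ^+ 2 <= C * (5 / 2 * X) by exact: low uy.
pose s1 := modulus (\sum_(j < M) x j * (x j - y j)^*%R).
pose s2 := modulus (\sum_(j < M) x j * (y j)^*%R).
have Xs : X <= s1 + s2.
  have -> : X = modulus (\sum_(j < M) x j * (x j)^*%R).
    have -> : \sum_(j < M) x j * (x j)^*%R = X%:C.
      by rewrite rmorph_sum /=; apply: eq_bigr => j _; rewrite mulJ.
    by rewrite modulus_real ger0_norm.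
  have -> : \sum_(j < M) x j * (x j)^*%R =
     \sum_(j < M) x j * (x j - y j)^*%R + \sum_(j < M) x j * (y j)^*%R.
    by rewrite -big_split /=; apply: eq_bigr => j _; rewrite -mulrDr -cJD subrK.
  exact: modulusD_le.
have h1 : s1 <= X / 2.
  rewrite -ler_sqr ?nnegrE ?modulus_ge0 ?divr_ge0 //.
  apply: le_trans (complex_cauchy_schwarz M x (fun j => (x j - y j)^*%R)) _.
  have -> : (X / 2) ^+ 2 = X * (X / 4) by field.
  rewrite -/X; apply: ler_wpM2l => //; apply: le_trans (Ha M).
  by apply: ler_sum => j _; rewrite modulusJ /x' ltn_ord.
have h2 : s2 ^+ 2 <= C * (5 / 2 * X) * B.
  have -> : s2 = modulus (\sum_(k < K) (a k)^*%R * \sum_(j < M) x j * (V k j)^*%R).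
    congr modulus; under eq_bigr => j _ do rewrite /y /comb cJ_sum mulr_sumr.
    rewrite exchange_big /=; apply: eq_bigr => k _; rewrite mulr_sumr.
    by apply: eq_bigr => j _; rewrite cJM; ring.
  apply: le_trans (complex_cauchy_schwarz K (fun k => (a k)^*%R)
    (fun k => \sum_(j < M) x j * (V k j)^*%R)) _.
  under eq_bigr do rewrite modulusJ.
  by apply: ler_pM (HB K) => //; apply: sumr_ge0 => n _; exact: sqr_ge0.
have h3 : X / 2 <= s2 by lra.
have : (X / 2) ^+ 2 <= C * (5 / 2 * X) * B.
  by apply: le_trans h2; rewrite ler_sqr ?nnegrE ?modulus_ge0 ?divr_ge0.
have -> : C * (5 / 2 * X) * B = X * (5 / 2 * (C * B)) by ring.
have -> : (X / 2) ^+ 2 = X * (X / 4) by field.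
rewrite ler_pM2l // -mulrA; lra.
Qed.

Variables (p : nat -> nat) (q A c0 : R).
Hypothesis q01 : 0 < q < 1.
Hypothesis c00 : 0 < c0.
Hypothesis A0 : 0 <= A.
Hypothesis p_mono : {homo p : m n / (m <= n)%N}.
Hypothesis V_le : forall n j, modulus (V n j) <= A * q ^+ ndist j (p n).
Hypothesis V_ge : forall n, c0 <= modulus (V n (p n)).

Let q0 : 0 <= q. Proof. by case/andP: q01 => /ltW. Qed.
Let q01' : 0 <= q < 1. Proof. by rewrite q0 /=; case/andP: q01. Qed.
Let q1 : 0 < 1 - q. Proof. by rewrite subr_gt0; case/andP: q01. Qed.

Let D := C * (2 / (1 - q)) / c0 ^+ 2.

Let D0 : 0 <= D.
Proof. by rewrite !mulr_ge0 ?invr_ge0 ?sqr_ge0 // ltW. Qed.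

(** Row n carries mass at least c0^2 in column p n, whereas a column carries at most C; hence few
    rows are centred near j. *)
Lemma riesz_density K j : \sum_(n < K) q ^+ ndist j (p n) <= D.
Proof.
rewrite /D ler_pdivlMr ?exprn_gt0 //.
pose I := (p K).+1.
apply: le_trans (_ : \sum_(n < K) \sum_(i < I) q ^+ ndist i j * modulus (V n i) ^+ 2 <= _).
  rewrite mulr_suml; apply: ler_sum => n _.
  have pI : (p n < I)%N by rewrite ltnS p_mono // ltnW.
  rewrite (bigD1 (Ordinal pI)) //= ndistC; apply: ler_wpDr.
    by rewrite sumr_ge0 // => i _; rewrite mulr_ge0 ?exprn_ge0 ?modulus_ge0.
  by rewrite ler_wpM2l ?exprn_ge0 // ler_sqr ?nnegrE ?modulus_ge0 // ltW.
rewrite exchange_big /=; apply: le_trans (_ : \sum_(i < I) q ^+ ndist i j * C <= _).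
  apply: ler_sum => i _; rewrite -mulr_sumr ler_wpM2l ?exprn_ge0 //.
  exact: riesz_column.
by rewrite -mulr_suml mulrC ler_wpM2l ?(ltW C0) // ndist_sum.
Qed.

Let small_power e : 0 < e -> exists L : nat, q ^+ L / (1 - q) <= e.
Proof.
move=> e0; have : (fun n => (1 - q)^-1 * q ^+ n) @ \oo --> (1 - q)^-1 * 0.
  by apply: cvgMr; apply: cvg_expr; rewrite ger0_norm //; case/andP: q01.
rewrite mulr0 => /cvgrPdist_le /(_ _ e0) [L _ /(_ L (leqnn L)) /=].
rewrite sub0r normrN ger0_norm ?mulr_ge0 ?exprn_ge0 ?invr_ge0 ?(ltW q1) // => H.
by exists L; rewrite mulrC.
Qed.

(* If n rows were localized on far fewer than n columns, some combination of them
   would vanish on those columns and be too small elsewhere. *)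
Lemma riesz_count_le : exists L, forall n, (n <= p n + L)%N.
Proof.
have [_ low _] := rV.
(* With this tail bound the lower Riesz inequality would give S <= S / 2 for the combination
   vanishing on the first p n + L columns. The summands 1 keep the inverted quantity positive. *)
have e0 : 0 < (2 * (C * (A + 1) ^+ 2 * (D + 1)))^-1.
  by rewrite invr_gt0 !mulr_gt0 ?exprn_gt0 // ltr_wpDl.
have [L HL] := small_power e0.
exists L => n; rewrite leqNgt; apply/negP => pn.
have MN : (p n + L < n.+1)%N by rewrite ltnS ltnW.
have [a [a0 Ha]] := @kernel_vector R V _ _ MN.
set M := (p n + L)%N in MN Ha pn.
pose t k m : R := if (M <= m)%N && (k < n.+1)%N then (A + 1) * q ^+ ndist m (p k) else 0.
have A1 : 0 <= A + 1 by rewrite addr_ge0.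
have t0 k m : 0 <= t k m.
  by rewrite /t; case: ifP => // _; rewrite mulr_ge0 ?exprn_ge0.
have ub : l2ub (comb V a n.+1) ((A + 1) * (q ^+ L / (1 - q)) * ((A + 1) * D) * \sum_(k < n.+1) modulus (a k) ^+ 2).
  move=> M'; apply: (schur_test (t := t)) => //.
  - by rewrite !mulr_ge0 ?exprn_ge0 ?invr_ge0 ?(ltW q1).
  - by rewrite mulr_ge0.
  - move=> m mM'; have [Mm|mM] := leqP M m; last first.
      rewrite /comb Ha // modulus0 sumr_ge0 // => k _.
      by rewrite mulr_ge0 ?modulus_ge0.
    apply: le_trans (modulus_sum _ _ _) _; apply: ler_sum => k _.
    rewrite modulusM ler_wpM2l ?modulus_ge0 // /t Mm ltn_ord /=.
    by apply: le_trans (V_le _ _) _; rewrite ler_wpM2r ?exprn_ge0 // lerDl.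
  - move=> k kn; have pk : (p k <= p n)%N by rewrite p_mono.
    rewrite -(big_mkord xpredT (t k)) /=.
    have [M'M|MM'] := leqP M' M.
      rewrite big_nat_cond big1 ?mulr_ge0 ?exprn_ge0 ?invr_ge0 ?(ltW q1) // => m.
      by rewrite andbT => /andP[_ mM']; rewrite /t leqNgt (leq_trans mM' M'M).
    rewrite (big_cat_nat (leq0n M) (ltnW MM')) /= [X in X + _]big_nat_cond.
    rewrite [X in X + _]big1 ?add0r => [|m]; last first.
      by rewrite andbT => /andP[_ mM]; rewrite /t leqNgt mM.
    apply: le_trans (_ : (A + 1) * \sum_(M <= m < M') q ^+ (m - (M - L)) <= _); last first.
      by rewrite ler_wpM2l // geometric_sum_ge // leq_addl.
    rewrite mulr_sumr; apply: ler_sum_nat => m /andP[Mm _].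
    rewrite /t Mm kn /= ler_wpM2l // ndist_ge; last first.
      by apply: leq_trans pk _; apply: leq_trans Mm; rewrite leq_addr.
    apply: ler_wiXn2l => //; first by case/andP: q01 => _ /ltW.
    by rewrite addnK leq_sub2l.
  - move=> m _; apply: le_trans (_ : \sum_(k < n.+1) (A + 1) * q ^+ ndist m (p k) <= _).
      apply: ler_sum => k _; rewrite /t ltn_ord andbT; case: ifP => // _.
      by rewrite mulr_ge0 ?exprn_ge0.
    by rewrite -mulr_sumr ler_wpM2l // riesz_density.
have := low _ _ _ ub; set S := \sum_(k < n.+1) _ in a0 ub *.
rewrite leNgt => /negP; apply.
rewrite mulrA -[X in _ < X]mul1r ltr_pM2r //.
apply: le_lt_trans (_ : 2^-1 < _); last by rewrite invf_lt1 // ltr1n.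
have := ler_wpM2l (_ : 0 <= C * (A + 1) ^+ 2 * (D + 1)) HL.
rewrite !mulr_ge0 ?sqr_ge0 ?(ltW C0) ?addr_ge0 // => /(_ isT) H.
have E : C * (A + 1) ^+ 2 * (D + 1) * (2 * (C * (A + 1) ^+ 2 * (D + 1)))^-1 = 2^-1.
  field; rewrite ?gt_eqF //; by rewrite ltr_wpDl.
rewrite E in H; apply: le_trans H.
have -> : C * ((A + 1) * (q ^+ L / (1 - q)) * ((A + 1) * D)) = C * (A + 1) ^+ 2 * D * (q ^+ L / (1 - q)) by ring.
rewrite ler_wpM2r ?divr_ge0 ?exprn_ge0 ?(ltW q1) // ler_wpM2l ?lerDl //.
by rewrite mulr_ge0 ?sqr_ge0 // ltW.
Qed.

(** The dual count. If the rows from n on were centred beyond n + L, a vector on the n + 1 columns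
    0, ..., n orthogonal to the first n rows would be almost orthogonal to all rows, against
    [riesz_frame]. *)
Lemma riesz_count_ge : exists L, forall n, (p n <= n + L)%N.
Proof.
have e0 : 0 < (2 * (10 * C * (A + 1) ^+ 2 * (D + 1)))^-1.
  by rewrite invr_gt0 !mulr_gt0 ?exprn_gt0 // ltr_wpDl.
have [L HL] := small_power e0.
exists L => n; rewrite leqNgt; apply/negP => pn.
have [x [x0 Hx]] := @kernel_vector R (fun j k => (V k j)^*%R) _ _ (ltnSn n).
have A1 : 0 <= A + 1 by rewrite addr_ge0.
pose t j k : R := if (n <= k)%N && (j < n.+1)%N then (A + 1) * q ^+ ndist j (p k) else 0.
have t0 j k : 0 <= t j k.
  by rewrite /t; case: ifP => // _; rewrite mulr_ge0 ?exprn_ge0.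
have fr K : \sum_(k < K) modulus (\sum_(j < n.+1) x j * (V k j)^*%R) ^+ 2 <=
    (A + 1) * D * ((A + 1) * (q ^+ L / (1 - q))) * \sum_(j < n.+1) modulus (x j) ^+ 2.
  apply: (schur_test (y := fun k => \sum_(j < n.+1) x j * (V k j)^*%R) (t := t)) => //.
  - by rewrite mulr_ge0.
  - by rewrite !mulr_ge0 ?exprn_ge0 ?invr_ge0 ?(ltW q1).
  - move=> k _; have [nk|kn] := leqP n k; last first.
      rewrite Hx // modulus0 sumr_ge0 // => j _; by rewrite mulr_ge0 ?modulus_ge0.
    apply: le_trans (modulus_sum _ _ _) _; apply: ler_sum => j _.
    rewrite modulusM modulusJ ler_wpM2l ?modulus_ge0 // /t nk ltn_ord /=.
    by apply: le_trans (V_le _ _) _; rewrite ler_wpM2r ?exprn_ge0 // lerDl.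
  - move=> j jn; apply: le_trans (_ : \sum_(k < K) (A + 1) * q ^+ ndist j (p k) <= _).
      apply: ler_sum => k _; rewrite /t jn andbT; case: ifP => // _.
      by rewrite mulr_ge0 ?exprn_ge0.
    by rewrite -mulr_sumr ler_wpM2l // riesz_density.
  - move=> k _; have [nk|kn] := leqP n k; last first.
      rewrite big1 ?mulr_ge0 ?exprn_ge0 ?invr_ge0 ?(ltW q1) // => j _.
      by rewrite /t leqNgt kn.
    have pk : (n + L < p k)%N by apply: leq_trans pn _; exact: p_mono.
    apply: le_trans (_ : \sum_(j < n.+1) (A + 1) * (q ^+ L * q ^+ (n - j)) <= _).
      apply: ler_sum => j _; rewrite /t nk ltn_ord /= ler_wpM2l //.
      have jn : (j <= n)%N by rewrite -ltnS.
      rewrite ndist_le ?(leq_trans jn) ?(leq_trans (leq_addr L n)) ?(ltnW pk) // -exprD.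
      apply: ler_wiXn2l => //; first by case/andP: q01 => _ /ltW.
      by rewrite addnBA // addnC leq_sub2r // ltnW.
    rewrite -!mulr_sumr ler_wpM2l // ler_wpM2l ?exprn_ge0 //.
    rewrite (reindex_inj rev_ord_inj) /=.
    apply: le_trans (geometric_sum_le n.+1 q01'); apply: ler_sum => j _.
    by rewrite subSS subKn // -ltnS.
have := riesz_frame fr; set S := \sum_(k < n.+1) _ in x0 fr *.
rewrite leNgt => /negP; apply.
rewrite mulrA -[X in _ < X]mul1r ltr_pM2r //.
apply: le_lt_trans (_ : 2^-1 < _); last by rewrite invf_lt1 // ltr1n.
have := ler_wpM2l (_ : 0 <= 10 * C * (A + 1) ^+ 2 * (D + 1)) HL.
rewrite !mulr_ge0 ?sqr_ge0 ?(ltW C0) ?addr_ge0 // => /(_ isT) H.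
have E : 10 * C * (A + 1) ^+ 2 * (D + 1) * (2 * (10 * C * (A + 1) ^+ 2 * (D + 1)))^-1 = 2^-1.
  field; rewrite ?gt_eqF //; by rewrite ltr_wpDl.
rewrite E in H; apply: le_trans H.
have -> : 10 * C * ((A + 1) * D * ((A + 1) * (q ^+ L / (1 - q)))) = 10 * C * (A + 1) ^+ 2 * D * (q ^+ L / (1 - q)) by ring.
rewrite ler_wpM2r ?divr_ge0 ?exprn_ge0 ?(ltW q1) // ler_wpM2l ?lerDl //.
by rewrite !mulr_ge0 ?sqr_ge0 // ltW.
Qed.

End FromRiesz.
End RieszSequences.

(** * Riesz bases from uniformly localized finite inverses *)

Section InverseMatrices.
Context {R : realType}.
Variables (V : nat -> nat -> R[i]) (B : nat -> nat -> nat -> R[i]) (t A D : R).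
Hypothesis t01 : 0 < t < 1.
Hypothesis A0 : 0 < A.
Hypothesis D0 : 0 < D.
Hypothesis V_le : forall n m, modulus (V n m) <= A * (t ^+ 2) ^+ ndist m n.
Hypothesis B_le : forall K m n, (m < K)%N -> (n < K)%N ->
  modulus (B K m n) <= D * (t ^+ 2) ^+ ndist m n.
Hypothesis BV : forall K m j, (m < K)%N -> (j < K)%N ->
  \sum_(n < K) B K m n * V n j = (m == j)%:R.
Hypothesis VB : forall K n k, (n < K)%N -> (k < K)%N ->
  \sum_(m < K) V n m * B K m k = (n == k)%:R.

Let t0 : 0 < t. Proof. by case/andP: t01. Qed.
Let t1 : t < 1. Proof. by case/andP: t01. Qed.
Let t01' : 0 <= t < 1. Proof. by rewrite (ltW t0). Qed.
Let Q : R := 2 / (1 - t).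
Let Q0 : 0 < Q. Proof. by rewrite divr_gt0 // subr_gt0. Qed.
Let t2_le k : (t ^+ 2) ^+ k <= t ^+ k.
Proof.
by rewrite exprAC expr2 ler_piMr ?exprn_ge0 ?(ltW t0) // exprn_ile1 // ltW.
Qed.
Let t2_ge0 k : 0 <= (t ^+ 2) ^+ k.
Proof. by rewrite !exprn_ge0 // ltW. Qed.
Let sumQ j N : \sum_(n < N) (t ^+ 2) ^+ ndist n j <= Q.
Proof.
by apply: le_trans (ndist_sum j N t01'); apply: ler_sum => n _; exact: t2_le.
Qed.

Let sumQ' j N : \sum_(n < N) (t ^+ 2) ^+ ndist j n <= Q.
Proof. by under eq_bigr do rewrite ndistC; exact: sumQ. Qed.

Let upper K a : l2ub (comb V a K) ((A * Q) * (A * Q) * \sum_(n < K) modulus (a n) ^+ 2).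
Proof.
move=> M; apply: (schur_test (t := fun n m => A * (t ^+ 2) ^+ ndist m n)).
- by move=> n m; rewrite mulr_ge0 // ltW.
- by rewrite ltW // mulr_gt0.
- by rewrite ltW // mulr_gt0.
- move=> m _; apply: le_trans (modulus_sum _ _ _) _; apply: ler_sum => n _.
  by rewrite modulusM ler_wpM2l ?modulus_ge0.
- by move=> n _; rewrite -mulr_sumr ler_pM2l.
- by move=> m _; rewrite -mulr_sumr ler_pM2l.
Qed.

(** The right inverse recovers a from the first K coordinates of the combination, so Schur's test
    for B bounds a. *)
Let lower K a E : l2ub (comb V a K) E ->
  \sum_(n < K) modulus (a n) ^+ 2 <= (D * Q) * (D * Q) * E.
Proof.
move=> HE; have DQ : 0 <= D * Q by rewrite ltW // mulr_gt0.
apply: le_trans (ler_wpM2l (mulr_ge0 DQ DQ) (HE K)).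
pose T m n : R := if (m < K)%N && (n < K)%N then D * (t ^+ 2) ^+ ndist m n else 0.
have TE m n : T m n <= D * (t ^+ 2) ^+ ndist m n.
  by rewrite /T; case: ifP => // _; rewrite mulr_ge0 // ltW.
apply: (schur_test (a := comb V a K) (y := a) (t := T)) => //.
- by move=> m n; rewrite /T; case: ifP => // _; rewrite mulr_ge0 // ltW.
- move=> n nK; have -> : a n = \sum_(m < K) comb V a K m * B K m n.
    under eq_bigr do rewrite /comb mulr_suml.
    rewrite exchange_big /= (bigD1 (Ordinal nK)) //= [X in _ + X]big1 ?addr0 => [|k kn].
      by under eq_bigr do rewrite -mulrA; rewrite -mulr_sumr VB // eqxx mulr1.
    under eq_bigr do rewrite -mulrA; rewrite -mulr_sumr VB //.
    by rewrite -val_eqE /= in kn; rewrite (negPf kn) mulr0.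
  apply: le_trans (modulus_sum _ _ _) _; apply: ler_sum => m _.
  by rewrite modulusM ler_wpM2l ?modulus_ge0 // /T ltn_ord nK B_le.
- move=> n _; apply: (@le_trans _ _ (\sum_(m < K) D * (t ^+ 2) ^+ ndist n m)).
    by apply: ler_sum => *; exact: TE.
  by rewrite -mulr_sumr ler_pM2l.
- move=> m _; apply: (@le_trans _ _ (\sum_(n < K) D * (t ^+ 2) ^+ ndist n m)).
    by apply: ler_sum => *; exact: TE.
  by rewrite -mulr_sumr ler_pM2l.
Qed.

Let tail x E : l2ub x E -> forall e : R, 0 < e -> exists M, forall N,
  \sum_(M <= m < N) modulus (x m) ^+ 2 <= e.
Proof.
move=> HE e e0; pose u N : R := \sum_(m < N) modulus (x m) ^+ 2.
have um : nondecreasing_seq u.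
  apply/nondecreasing_seqP => N; rewrite /u big_ord_recr /= lerDl; exact: sqr_ge0.
have uc : cvgn u by apply: nondecreasing_is_cvgn => //; exists E => _ [N _ <-]; exact: HE.
have /cvgrPdist_lt /(_ _ e0) [M _ HM] := uc.
exists M => N; have [NM|/ltnW MN] := leqP N M; first by rewrite big_geq // ltW.
have -> : \sum_(M <= m < N) modulus (x m) ^+ 2 = u N - u M.
  rewrite /u -!(big_mkord xpredT (fun m => modulus (x m) ^+ 2)) (big_cat_nat (leq0n M) MN) /=.
  by rewrite [X in X - _]addrC addrK.
have := HM M (leqnn M); have := nondecreasing_cvgn_le um uc N.
rewrite ltr_norml => h1 /andP[_ h2]; lra.
Qed.

(** Truncate x to M coordinates and invert the section of size K = M + N. The combination agrees
    with the truncation below K, and from K on its entries are at most W t^(j - M), small because of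
    the margin N. The decay rate is t^2 so that one factor t pays for the sum over n and the other
    survives. *)
Let dense x E : l2ub x E -> forall e : R, 0 < e ->
  exists K a, l2ub (fun m => x m - comb V a K m) e.
Proof.
move=> HE e e0.
have e4 : 0 < e / 4 by rewrite divr_gt0.
have ndQ j N : \sum_(n < N) t ^+ ndist j n <= Q.
  by under eq_bigr do rewrite ndistC; exact: ndist_sum.
clearbody Q.
have [M HM] := tail HE e4.
pose S := \sum_(m < M) modulus (x m).
have S0 : 0 <= S by apply: sumr_ge0 => m _; exact: modulus_ge0.
pose W := S * D * A * Q.
have W0 : 0 <= W.
  by rewrite /W; apply: mulr_ge0 (ltW Q0); apply: mulr_ge0 (ltW A0); apply: mulr_ge0 (ltW D0).
have WE : W = S * D * A * Q by [].
clearbody W.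
have [N HN] : exists N : nat, W ^+ 2 * (t ^+ N / (1 - t)) <= e / 4.
  have : (fun n => W ^+ 2 / (1 - t) * t ^+ n) @ \oo --> W ^+ 2 / (1 - t) * 0.
    by apply: cvgMr; apply: cvg_expr; rewrite ger0_norm // ltW.
  rewrite mulr0 => /cvgrPdist_le /(_ _ e4) [N _ /(_ N (leqnn N)) /=].
  rewrite sub0r normrN ger0_norm => [H|]; last first.
    by rewrite !mulr_ge0 ?sqr_ge0 ?exprn_ge0 ?invr_ge0 ?subr_ge0 // ltW.
  by exists N; rewrite (_ : W ^+ 2 * (t ^+ N / (1 - t)) = W ^+ 2 / (1 - t) * t ^+ N) //; ring.
pose K := (M + N)%N.
pose a n := \sum_(m < M) x m * B K m n.
have combE j : comb V a K j = \sum_(m < M) x m * \sum_(n < K) B K m n * V n j.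
  rewrite /comb /a; under eq_bigr do rewrite mulr_suml.
  rewrite exchange_big /=; apply: eq_bigr => m _; rewrite mulr_sumr.
  by apply: eq_bigr => n _; rewrite mulrA.
have mK (m : 'I_M) : (m < K)%N by rewrite ltn_addr.
have comb_low j : (j < K)%N -> comb V a K j = if (j < M)%N then x j else 0.
  move=> jK; rewrite combE; under eq_bigr do rewrite BV //.
  case: ifP => jM.
    rewrite (bigD1 (Ordinal jM)) //= eqxx mulr1 big1 ?addr0 // => m.
    by rewrite -val_eqE /= => /negPf ->; rewrite mulr0.
  rewrite big1 // => m _; case: eqP => [mj|_]; last by rewrite mulr0.
  by rewrite -mj ltn_ord in jM.
have comb_high j : (K <= j)%N -> modulus (comb V a K j) <= W * t ^+ (j - M).
  move=> Kj; rewrite combE; apply: le_trans (modulus_sum _ _ _) _.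
  rewrite WE /S !mulr_suml; apply: ler_sum => m _; rewrite modulusM.
  rewrite -!mulrA ler_wpM2l ?modulus_ge0 //; apply: le_trans (modulus_sum _ _ _) _.
  apply: le_trans (_ : \sum_(n < K) (D * A * t ^+ (j - M)) * t ^+ ndist j n <= _); last first.
    rewrite -mulr_sumr.
    have -> : D * (A * (Q * t ^+ (j - M))) = D * A * t ^+ (j - M) * Q by ring.
    by rewrite ler_wpM2l ?ndQ ?mulr_ge0 ?exprn_ge0 ?(ltW t0) ?(ltW D0) ?(ltW A0).
  apply: ler_sum => n _; rewrite modulusM.
  apply: le_trans (ler_pM (modulus_ge0 _) (modulus_ge0 _) (B_le (mK m) (ltn_ord n)) (V_le n j)) _.
  have -> : D * A * t ^+ (j - M) * t ^+ ndist j n = (D * A) * (t ^+ (j - M) * t ^+ ndist j n) by ring.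
  rewrite mulrACA ler_wpM2l ?mulr_ge0 ?(ltW D0) ?(ltW A0) // -exprD -!exprM -exprD.
  apply: ler_wiXn2l; rewrite ?(ltW t0) ?(ltW t1) //.
  have mM : (m <= M)%N by exact: ltnW.
  have nj : (n <= j)%N by apply: leq_trans Kj; exact: ltnW.
  rewrite (ndist_ge nj) -mulnDr.
  have : (n - m <= ndist m n)%N by rewrite /ndist leq_addl.
  move: (ndist m n) => d hd.
  have h : (j - M <= d + (j - n))%N.
    apply: leq_trans (_ : (j - m <= _)%N); first exact: leq_sub2l.
    rewrite leq_subLR addnA; apply: leq_trans (_ : (n + (j - n) <= _)%N).
      by rewrite subnKC.
    by rewrite leq_add2r -leq_subLR.
  rewrite mul2n -addnn leq_add //; apply: leq_addl.
exists K, a => N'.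
apply: le_trans (_ : \sum_(m < K + N') modulus (x m - comb V a K m) ^+ 2 <= _).
  rewrite [(K + N')%N]addnC big_split_ord /= lerDl; apply: sumr_ge0 => *; exact: sqr_ge0.
rewrite -(big_mkord xpredT (fun m => modulus (x m - comb V a K m) ^+ 2)).
have MK : (M <= K)%N by rewrite leq_addr.
rewrite (big_cat_nat (leq0n M)) ?(leq_trans MK) ?leq_addr //=.
rewrite [X in X + _]big_nat_cond [X in X + _]big1 ?add0r => [|m]; last first.
  rewrite andbT => /andP[_ mM]; rewrite (comb_low _ (leq_trans mM MK)) mM subrr.
  by rewrite modulus0 expr0n.
rewrite (big_cat_nat MK) ?leq_addr //=.
have h1 : \sum_(M <= m < K) modulus (x m - comb V a K m) ^+ 2 <= 2 * \sum_(M <= m < K) modulus (x m) ^+ 2.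
  rewrite mulr_sumr; apply: ler_sum_nat => m /andP[Mm mK'].
  rewrite (comb_low _ mK') ltnNge Mm subr0; have := sqr_ge0 (modulus (x m)); lra.
have h2 : \sum_(K <= m < K + N') modulus (x m - comb V a K m) ^+ 2 <=
   2 * (\sum_(K <= m < K + N') modulus (x m) ^+ 2) + 2 * (W ^+ 2 * (t ^+ N / (1 - t))).
  apply: le_trans (_ : \sum_(K <= m < K + N') (2 * modulus (x m) ^+ 2 + 2 * (W ^+ 2 * t ^+ (m - M))) <= _).
    apply: ler_sum_nat => m /andP[Km _].
    apply: le_trans (_ : 2 * modulus (x m) ^+ 2 + 2 * modulus (comb V a K m) ^+ 2 <= _).
      have := modulusB_le (x m) (comb V a K m).
      have := modulus_ge0 (x m - comb V a K m).
      move: (modulus _) (modulus _) (modulus _) => p q r hp hpq.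
      have := sqr_ge0 (q - p); have := ler_pM hp hp hpq hpq; nra.
    rewrite lerD2l ler_pM2l //; apply: le_trans (_ : (W * t ^+ (m - M)) ^+ 2 <= _).
      by rewrite ler_sqr ?nnegrE ?modulus_ge0 ?mulr_ge0 ?exprn_ge0 ?(ltW t0) // comb_high.
    by rewrite exprMn ler_wpM2l ?sqr_ge0 // exprAC t2_le.
  rewrite big_split /= -!mulr_sumr lerD2l ler_pM2l // ler_wpM2l ?sqr_ge0 //.
  have -> : M = (K - N)%N by rewrite addnK.
  by apply: geometric_sum_ge => //; rewrite leq_addl.
have h3 := HM (K + N')%N.
rewrite (big_cat_nat MK) ?leq_addr //= in h3.
lra.
Qed.

Lemma l2riesz_of_inverse : exists2 C : R, 0 < C & l2riesz V C.
Proof.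
pose C1 := (A * Q) * (A * Q); pose C2 := (D * Q) * (D * Q).
have C10 : 0 < C1 by apply: mulr_gt0; apply: mulr_gt0.
have C20 : 0 < C2 by apply: mulr_gt0; apply: mulr_gt0.
exists (C1 + C2); first exact: addr_gt0.
split=> [K a|K a E HE|]; last exact: dense.
  apply: l2ub_le (upper K a); rewrite ler_wpM2r ?lerDl ?(ltW C20) //.
  by apply: sumr_ge0 => *; exact: sqr_ge0.
apply: le_trans (lower HE) _; rewrite ler_wpM2r ?(l2ub_ge0 HE) // lerDr ltW //.
Qed.

End InverseMatrices.

(** * Polynomials and divided differences *)

Section Landau.
Context {R : realType}.
Implicit Types (p q : {poly R[i]}) (r : R) (l : R[i]) (lambda : nat -> R[i]).

(** By Parseval, the mean of |p|^2 over the circle |z| = r as soon as M >= size p. *)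
Definition circle_norm r M p : R := \sum_(j < M) modulus p`_j ^+ 2 * (r ^+ j) ^+ 2.

(* On the circle |z| = r the factors z - l and r - conj(l) z / r have the same
   modulus; replacing one by the other makes the top coefficient visible. *)
Definition flip r l : {poly R[i]} := (r%:C)%:P - (((l^*)%R / r%:C)%:P) * 'X.

Let flip_coef r l (x y : R[i]) : 0 < r ->
  modulus (x - l * y) ^+ 2 - modulus (r%:C * y - (l^*)%R / r%:C * x) ^+ 2 =
  (1 - modulus l ^+ 2 / r ^+ 2) * (modulus x ^+ 2 - r ^+ 2 * modulus y ^+ 2).
Proof.
move=> r0; have -> : (r%:C)^-1 = (r^-1)%:C :> R[i] by rewrite fmorphV.
rewrite !modulus_sqr !(cReD, cImD, cReN, cImN, cReM, cImM, cReJ, cImJ) /=.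
move: (complex.Re x) (complex.Im x) (complex.Re y) (complex.Im y) (complex.Re l) (complex.Im l).
by move=> a b c d e f; field; rewrite gt_eqF.
Qed.

(** By [flip_coef] the difference of the two sums telescopes to a multiple of the squared modulus of
    the coefficient of degree M in p, which is 0. *)
Lemma circle_norm_flip r l p M : 0 < r -> (size p <= M)%N ->
  circle_norm r M.+1 (('X - l%:P) * p) = circle_norm r M.+1 (flip r l * p).
Proof.
move=> r0 sp; apply/eqP; rewrite -subr_eq0 /circle_norm -sumrB.
have coefL j : (('X - l%:P) * p)`_j.+1 = p`_j - l * p`_j.+1.
  by rewrite mulrBl coefB coefXM coefCM.
have coefR j : (flip r l * p)`_j.+1 = r%:C * p`_j.+1 - (l^*)%R / r%:C * p`_j.
  by rewrite mulrBl coefB coefCM -(mulrA _ 'X) coefCM coefXM.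
have E N : \sum_(j < N.+1) (modulus (('X - l%:P) * p)`_j ^+ 2 * (r ^+ j) ^+ 2 -
    modulus (flip r l * p)`_j ^+ 2 * (r ^+ j) ^+ 2) =
    - ((1 - modulus l ^+ 2 / r ^+ 2) * (modulus p`_N ^+ 2 * (r ^+ N.+1) ^+ 2)).
  elim: N => [|N IH].
    rewrite big_ord_recl big_ord0 addr0 mulrBl coefB coefXM coefCM sub0r modulusN.
    rewrite mulrBl coefB coefCM -(mulrA _ 'X) coefCM coefXM mulr0 subr0 !modulusM modulus_real gtr0_norm //.
    by rewrite expr0 expr1; field; rewrite gt_eqF.
  rewrite big_ord_recr /= IH coefL coefR -mulrBl flip_coef // [r ^+ N.+2]exprS.
  by ring.
by rewrite E nth_default // modulus0 expr0n mul0r mulr0 oppr0.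
Qed.

(** The factor q collects the zeros already treated. If |lambda_n| >= r the flipped factor is used,
    whose leading coefficient has modulus |lambda_n| / r; otherwise X - lambda_n is kept. In both
    cases |q_d| r^d gains max(r, |lambda_n|). The last coefficient alone then bounds the sum from
    below. *)
Lemma landau r lambda n : 0 < r -> forall q d, (size q <= d.+1)%N ->
  (\prod_(k < n) Num.max r (modulus (lambda k))) ^+ 2 * (modulus q`_d ^+ 2 * (r ^+ d) ^+ 2)
  <= circle_norm r (n + d).+1 ((\prod_(k < n) ('X - (lambda k)%:P)) * q).
Proof.
move=> r0; elim: n => [|n IH] q d sq.
  rewrite !big_ord0 expr1n !mul1r /circle_norm big_ord_recr /= lerDr.
  by apply: sumr_ge0 => j _; rewrite mulr_ge0 ?sqr_ge0.
set l := lambda n; rewrite big_ord_recr /= [in leRHS]big_ord_recr /= -/l.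
set P : {poly R[i]} := \prod_(k < n) ('X - _).
have sP : size P = n.+1.
  by rewrite /P size_prod_XsubC -[index_enum _]enumT size_enum_ord.
have sPq : (size (P * q)%R <= n + d.+1)%N.
  apply: leq_trans (size_polyMleq _ _) _.
  by rewrite sP addSn /= leq_add2l.
have step q' : (size q' <= d.+2)%N -> modulus q'`_d.+1 ^+ 2 * (r ^+ d.+1) ^+ 2 =
    Num.max r (modulus l) ^+ 2 * (modulus q`_d ^+ 2 * (r ^+ d) ^+ 2) ->
    (\prod_(k < n) Num.max r (modulus (lambda k)) * Num.max r (modulus l)) ^+ 2 *
      (modulus q`_d ^+ 2 * (r ^+ d) ^+ 2) <= circle_norm r (n.+1 + d).+1 (P * q').
  by move=> sq' E; rewrite exprMn -mulrA -E addSnnS; exact: IH.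
have /orP[rl|lr] := le_total r (modulus l).
  rewrite (mulrAC P) (mulrC _ ('X - _)) addSnnS circle_norm_flip // -addSnnS (mulrCA _ P).
  apply: step; last rewrite (max_r rl).
    apply: leq_trans (size_polyMleq _ _) _.
    have : (size (flip r l) <= 2)%N.
      rewrite /flip; apply: leq_trans (size_polyD _ _) _; rewrite geq_max size_polyN.
      rewrite (leq_trans (size_polyC_leq1 _)) //= (leq_trans (size_polyMleq _ _)) //.
      by rewrite size_polyX addn2 /= ltnS size_polyC_leq1.
    by move=> k1; rewrite -subn1 leq_subLR (leq_trans (leq_add k1 sq)).
  rewrite mulrBl coefB coefCM -(mulrA _ 'X) coefCM coefXM /= [q`_d.+1]nth_default //.
  rewrite mulr0 sub0r modulusN modulusM modulus_div modulusJ modulus_real gtr0_norm //.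
  by rewrite [r ^+ d.+1]exprS; field; rewrite gt_eqF.
rewrite -[P * _ * q]mulrA; apply: step; last rewrite (max_l lr).
  apply: leq_trans (size_polyMleq _ _) _.
  by rewrite size_XsubC.
rewrite mulrBl coefB coefXM coefCM /= [q`_d.+1]nth_default // mulr0.
by rewrite subr0 [r ^+ d.+1]exprS; ring.
Qed.

End Landau.

(** * Divided differences of monomials *)

Section DividedDifferences.
Context {R : realType}.
Variable lambda : nat -> R[i].
Hypothesis lambda_inj : injective lambda.

Definition node_weight m k : R[i] := (\prod_(i < m.+1 | i != k :> nat) (lambda k - lambda i))^-1.

(* The divided difference of z^j at lambda_0, ..., lambda_m, that is, the complete
   homogeneous symmetric polynomial of degree j - m in the nodes. *)
Definition divdiff m j : R[i] := \sum_(k < m.+1) lambda k ^+ j * node_weight m k.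

(** For j <= m the monomial is its own interpolant at m + 1 nodes; this is the equality of the
    coefficients of degree m. *)
Lemma divdiff_low m j : (j <= m)%N -> divdiff m j = (j == m)%:R.
Proof.
move=> jm; have := @lagrange_gen _ m.+1 lambda (ltn0Sn m) lambda_inj 'X^j.
rewrite size_polyXn ltnS => /(_ jm) /(congr1 (fun p : {poly R[i]} => p`_m)).
rewrite coefXn eq_sym => ->; rewrite coef_sum; apply: eq_bigr => i _.
rewrite coefCM hornerXn lagrangeE //= coefCM horner_prod; congr (_ * _).
rewrite (_ : (\prod_(j0 < m.+1 | j0 != i) ('X - (lambda j0)%:P))`_m = 1) ?mulr1.
  by congr (_^-1); apply: eq_bigr => k _; rewrite hornerXsubC.
set P := \prod_(_ < _ | _) _.
have mP : P \is monic by apply: monic_prod => k _; exact: monicXsubC.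
have sP : size P = m.+1.
  have : size (\prod_(k < m.+1) ('X - (lambda k)%:P)) = m.+2.
    by rewrite size_prod_XsubC -[index_enum _]enumT size_enum_ord.
  rewrite (bigD1 i) //= -/P size_monicM ?monicXsubC ?monic_neq0 // size_XsubC.
  by case.
by move/monicP: mP; rewrite lead_coefE sP.
Qed.

Lemma divdiff_rec m j :
  divdiff m.+1 j.+1 = lambda m.+1 * divdiff m.+1 j + divdiff m j.
Proof.
rewrite addrC; apply/eqP; rewrite -subr_eq; apply/eqP.
rewrite {1 2}/divdiff mulr_sumr -sumrB big_ord_recr /= exprS -mulrA subrr addr0.
apply: eq_bigr => k _; rewrite exprS -mulrA -mulrBl mulrCA; congr (_ * _).
rewrite /node_weight big_mkcond big_ord_recr /= -big_mkcond.
have -> : m.+1 != k by rewrite gtn_eqF.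
rewrite invfM mulrC mulfVK // subr_eq0 inj_eq //.
by rewrite ltn_eqF.
Qed.

(** The generating series of the complete symmetric polynomials in |lambda_k| is prod (1 -
    |lambda_k| s)^-1, and the bound is its value at s = 1 / T. It satisfies the recurrence of
    [divdiff_rec] with equality, which drives the double induction. *)
Lemma divdiff_le m (T : R) : (forall k, (k <= m)%N -> modulus (lambda k) < T) ->
  forall j, modulus (divdiff m j) <= T ^+ j / T ^+ m * (\prod_(k < m.+1) (1 - modulus (lambda k) / T))^-1.
Proof.
elim: m => [|m IH] lT.
  have T0 : 0 < T := le_lt_trans (modulus_ge0 _) (lT 0%N (leqnn 0)).
  move=> j; rewrite /divdiff !big_ord1 /node_weight big_mkcond !big_ord1 /=.
  rewrite invr1 mulr1 expr0 divr1 modulusX.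
  have l0 := lT 0%N (leqnn 0).
  have p0 : 0 < 1 - modulus (lambda 0%N) / T by rewrite subr_gt0 ltr_pdivrMr // mul1r.
  rewrite ler_pdivlMr // (le_trans (_ : _ <= modulus (lambda 0%N) ^+ j)) //.
    rewrite ler_piMr ?exprn_ge0 ?modulus_ge0 // lerBlDr lerDl divr_ge0 ?modulus_ge0 ?(ltW T0) //.
  by rewrite lerXn2r ?nnegrE ?modulus_ge0 ?(ltW T0) // ltW.
have T0 : 0 < T := le_lt_trans (modulus_ge0 _) (lT 0%N (leq0n _)).
have pos k : (k <= m.+1)%N -> 0 < 1 - modulus (lambda k) / T.
  by move=> km; rewrite subr_gt0 ltr_pdivrMr // mul1r lT.
set P := \prod_(k < m.+2) _.
have P0 : 0 < P by apply: prodr_gt0 => k _; rewrite pos // -ltnS.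
elim=> [|j IHj].
  by rewrite (divdiff_low (leq0n m.+1)) modulus0 expr0 mul1r mulr_ge0 ?invr_ge0 ?exprn_ge0 ?(ltW T0) ?(ltW P0).
rewrite divdiff_rec; apply: le_trans (modulusD_le _ _) _; rewrite modulusM.
apply: le_trans (lerD (ler_wpM2l (modulus_ge0 _) IHj) (IH _ j)) _.
  by move=> k km; rewrite lT // leqW.
rewrite /P big_ord_recr /=.
set Q := \prod_(k < m.+1) _.
have Q0 : 0 < Q by apply: prodr_gt0 => k _; rewrite pos // leqW // -ltnS.
have l0 := pos _ (leqnn m.+1).
have l0' : T - modulus (lambda m.+1) != 0 by rewrite gt_eqF // subr_gt0 lT.
rewrite le_eqVlt; apply/orP; left; apply/eqP; rewrite !exprS; field.
by rewrite l0' !gt_eqF ?exprn_gt0.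
Qed.

End DividedDifferences.

(** * The matrix of the normalized kernels *)

Section Localization.
Context {R : realType}.
Variable alpha : R.
Hypothesis alpha0 : 0 < alpha.
Let a2 : 0 < 2 * alpha. Proof. by rewrite mulr_gt0. Qed.

(** Comparable with r^(2 j) / c_j, the j-th term of the squared kernel norm at modulus r. *)
Definition weight (r : R) (j : nat) : R := (r ^+ j) ^+ 2 / gauss alpha j.

(* [r] lies on the circle of radius gamma_n exactly when [level r = n + 1]. *)
Definition level (r : R) : R := 2 * alpha * ln r.

Lemma level_expR r : 0 < r -> r = expR (level r / (2 * alpha)).
Proof. by move=> r0; rewrite /level [_ * ln r]mulrC mulfK ?gt_eqF // lnK. Qed.

Lemma weight_gt0 r j : 0 < r -> 0 < weight r j.
Proof. by move=> r0; rewrite divr_gt0 ?exprn_gt0 // expR_gt0. Qed.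

Lemma weightE r j : 0 < r ->
  weight r j = expR ((2 * j%:R * level r - j.+1%:R ^+ 2) / (2 * alpha)).
Proof.
move=> r0; rewrite /weight {1}(level_expR r0) -!expRM_natl -expRN -expRD; congr expR.
by field; rewrite ?gt_eqF.
Qed.

Lemma ndistE i j : (ndist i j)%:R = `|i%:R - j%:R| :> R.
Proof.
have [ji|/ltnW ij] := leqP j i.
  by rewrite ndist_ge // natrB // ger0_norm // subr_ge0 ler_nat.
by rewrite ndist_le // natrB // distrC ger0_norm // subr_ge0 ler_nat.
Qed.

(** The maximum over k of exp((2 k S - k^2) / (2 alpha) + 2 k): the price of replacing a Gaussian
    bump whose centre is off by S with the decay exp(- 2 k). *)
Definition loss (S : R) : R := expR ((S + 2 * alpha) ^+ 2 / (2 * alpha)).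

(** When p = 0 all other columns lie to the right, so an upper bound on the displacement is
    enough. *)
Lemma weight_le S r p j : 0 < r -> 0 <= S -> level r - p.+1%:R <= S ->
  p = 0%N \/ - S <= level r - p.+1%:R ->
  weight r j <= loss S * (expR (-1) ^+ ndist j p) ^+ 2 * weight r p.
Proof.
move=> r0 S0 sS Sp; rewrite !weightE // -!expRM_natl -!expRD ler_expR.
rewrite ndistE -subr_ge0.
set u : R := level r in sS Sp *; set k : R := `|_|.
have k0 : 0 <= k by exact: normr_ge0.
have kk : k ^+ 2 = (j%:R - p%:R) ^+ 2 by rewrite real_normK // num_real.
have ks : (j%:R - p%:R) * (u - p.+1%:R) <= k * S.
  case: Sp => [p0|Sp]; last by apply: le_trans (ler_norm _) _; rewrite normrM ler_wpM2l // ler_norml Sp.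
  by rewrite (_ : j%:R - p%:R = k) ?ler_wpM2l // /k p0 subr0 ger0_norm.
have -> : (S + 2 * alpha) ^+ 2 / (2 * alpha) + 2 * (k * -1) +
    (2 * p%:R * u - p.+1%:R ^+ 2) / (2 * alpha) - (2 * j%:R * u - j.+1%:R ^+ 2) / (2 * alpha) =
    ((S + 2 * alpha) ^+ 2 - 4 * alpha * k - 2 * ((j%:R - p%:R) * (u - p.+1%:R))
      + (j%:R - p%:R) ^+ 2) / (2 * alpha).
  by rewrite -!natr1; field; rewrite gt_eqF.
apply: divr_ge0; last exact: ltW.
rewrite -kk; have := sqr_ge0 (S + 2 * alpha - k); lra.
Qed.

(** All points of level below 2 receive index 0, however close to the origin; this is the case
    allowed without a lower bound. *)
Lemma near_index r : 0 < r ->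
  let p := Num.truncn (Num.max (level r - 1) 0) in
  level r - p.+1%:R <= 1 /\ (p = 0%N \/ -1 <= level r - p.+1%:R).
Proof.
move=> r0 p; have /truncn_itv /andP[p1 p2] : 0 <= Num.max (level r - 1) 0.
  by rewrite le_max lexx orbT.
rewrite -/p in p1 p2; rewrite gt_max in p2; case/andP: p2 => p2 _.
rewrite -natr1; split; first by move: p2; rewrite -natr1; lra.
have [->|pn] := eqVneq p 0%N; [by left|right].
move: p1; rewrite le_max lern0 (negPf pn) orbF; lra.
Qed.

(** * Localization of the kernel matrix *)

Section Kernels.
Variables (c kn : nat -> R) (lambda : nat -> R[i]) (C0 : R).
Hypothesis C0_gt0 : 0 < C0.
Hypothesis c_gauss : forall m, C0^-1 * gauss alpha m <= c m <= C0 * gauss alpha m.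
Local Notation rho n := (modulus (lambda n)).
Hypothesis rho_gt0 : forall n, 0 < rho n.
Hypothesis kn_gt0 : forall n, 0 < kn n.
Hypothesis kn_ge : forall n m, rho n ^+ m / Num.sqrt (c m) <= kn n.
Hypothesis kn_le : forall n B, (forall K, \sum_(m < K) (rho n ^+ m) ^+ 2 / c m <= B) ->
  kn n ^+ 2 <= B.

Definition kmatrix n m : R[i] :=
  ((lambda n)^*)%R ^+ m / (Num.sqrt (c m) * kn n)%:C.

Let g0 m : 0 < gauss alpha m. Proof. exact: expR_gt0. Qed.

Lemma c_gt0 m : 0 < c m.
Proof.
have /andP[+ _] := c_gauss m; apply: lt_le_trans.
by rewrite mulr_gt0 ?invr_gt0.
Qed.

Lemma modulus_kmatrix n m :
  modulus (kmatrix n m) ^+ 2 = (rho n ^+ m) ^+ 2 / c m / kn n ^+ 2.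
Proof.
have cm := c_gt0 m; have k0 := kn_gt0 n.
rewrite /kmatrix modulus_div modulusX modulusJ modulus_real.
rewrite gtr0_norm ?mulr_gt0 ?sqrtr_gt0 // expr_div_n exprMn sqr_sqrtr ?(ltW cm) //.
by field; rewrite !gt_eqF ?exprn_gt0.
Qed.

Lemma weight_c_le r m : 0 < r -> (r ^+ m) ^+ 2 / c m <= C0 * weight r m.
Proof.
move=> r0; have cm := c_gt0 m; rewrite ler_pdivrMr // /weight.
have /andP[H _] := c_gauss m.
have w0 : 0 <= C0 * ((r ^+ m) ^+ 2 / gauss alpha m).
  by rewrite mulr_ge0 ?divr_ge0 ?sqr_ge0 // ltW.
apply: le_trans (ler_wpM2l w0 H).
by rewrite le_eqVlt; apply/orP; left; apply/eqP; field; rewrite !gt_eqF.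
Qed.

Lemma weight_c_ge r m : 0 < r -> C0^-1 * weight r m <= (r ^+ m) ^+ 2 / c m.
Proof.
move=> r0; have cm := c_gt0 m; rewrite ler_pdivlMr // /weight.
have /andP[_ H] := c_gauss m.
have w0 : 0 <= C0^-1 * ((r ^+ m) ^+ 2 / gauss alpha m).
  by rewrite mulr_ge0 ?divr_ge0 ?sqr_ge0 ?invr_ge0 // ltW.
apply: le_trans (ler_wpM2l w0 H) _.
by rewrite le_eqVlt; apply/orP; left; apply/eqP; field; rewrite !gt_eqF.
Qed.

Lemma kn_weight_ge n m : C0^-1 * weight (rho n) m <= kn n ^+ 2.
Proof.
apply: le_trans (weight_c_ge m (rho_gt0 n)) _; have cm := c_gt0 m.
have := kn_ge n m; rewrite -ler_sqr ?nnegrE ?(ltW (kn_gt0 n)) //; last first.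
  by rewrite divr_ge0 ?exprn_ge0 ?sqrtr_ge0 // ltW.
by rewrite expr_div_n sqr_sqrtr // ltW.
Qed.

Lemma kn_weight_le S n p : 0 <= S -> level (rho n) - p.+1%:R <= S ->
  p = 0%N \/ - S <= level (rho n) - p.+1%:R ->
  kn n ^+ 2 <= C0 * loss S * (2 / (1 - expR (-1))) * weight (rho n) p.
Proof.
move=> S0 sS Sp; apply: kn_le => K.
apply: le_trans (_ : \sum_(m < K) C0 * (loss S * expR (-1) ^+ ndist m p * weight (rho n) p) <= _).
  apply: ler_sum => m _; apply: le_trans (weight_c_le m (rho_gt0 n)) _.
  rewrite ler_pM2l //; apply: le_trans (weight_le m (rho_gt0 n) S0 sS Sp) _.
  rewrite ler_pM2r ?weight_gt0 // ler_pM2l ?expR_gt0 // expr2.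
  rewrite ler_piMr ?exprn_ge0 ?expR_ge0 // exprn_ile1 ?expR_ge0 // expR_le1 lerN10.
rewrite -mulr_sumr -!mulrA ler_pM2l // -mulr_suml -mulr_sumr -mulrA ler_pM2l ?expR_gt0 //.
rewrite mulrA ler_pM2r ?weight_gt0 //; apply: ndist_sum.
by rewrite expR_ge0 expR_lt1 oppr_lt0 ltr01.
Qed.

Lemma kmatrix_le S n p : 0 <= S -> level (rho n) - p.+1%:R <= S ->
  p = 0%N \/ - S <= level (rho n) - p.+1%:R ->
  forall j, modulus (kmatrix n j) <= C0 * (loss S + 1) * expR (-1) ^+ ndist j p.
Proof.
move=> S0 sS Sp j; have L0 : 0 < loss S := expR_gt0 _.
rewrite -ler_sqr ?nnegrE ?modulus_ge0 //; last first.
  by rewrite !mulr_ge0 ?exprn_ge0 ?expR_ge0 ?addr_ge0 // ltW.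
rewrite modulus_kmatrix ler_pdivrMr ?exprn_gt0 //.
apply: le_trans (weight_c_le j (rho_gt0 n)) _.
apply: le_trans (_ : (C0 * (loss S + 1) * expR (-1) ^+ ndist j p) ^+ 2 * (C0^-1 * weight (rho n) p) <= _); last first.
  by rewrite ler_wpM2l ?sqr_ge0 // kn_weight_ge.
rewrite !exprMn [C0 ^+ 2]expr2.
have -> : C0 * C0 * (loss S + 1) ^+ 2 * (expR (-1) ^+ ndist j p) ^+ 2 * (C0^-1 * weight (rho n) p)
  = C0 * ((loss S + 1) ^+ 2 * ((expR (-1) ^+ ndist j p) ^+ 2 * weight (rho n) p)).
  by field; rewrite gt_eqF.
rewrite ler_pM2l //; apply: le_trans (weight_le j (rho_gt0 n) S0 sS Sp) _.
rewrite -mulrA ler_wpM2r //; last by nra.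
by rewrite mulr_ge0 ?sqr_ge0 // ltW // weight_gt0.
Qed.

Lemma kmatrix_ge S n p : 0 <= S -> level (rho n) - p.+1%:R <= S ->
  p = 0%N \/ - S <= level (rho n) - p.+1%:R ->
  (C0 * (loss S * (2 / (1 - expR (-1))) + 1))^-1 <= modulus (kmatrix n p).
Proof.
move=> S0 sS Sp; have L0 : 0 < loss S := expR_gt0 _.
have q0 : 0 < 2 / (1 - expR (-1)) :> R.
  by rewrite divr_gt0 // subr_gt0 expR_lt1 oppr_lt0 ltr01.
set D := loss S * _; have D0 : 0 < D by rewrite mulr_gt0.
rewrite -ler_sqr ?nnegrE ?modulus_ge0 ?invr_ge0 ?mulr_ge0 ?addr_ge0 ?(ltW C0_gt0) ?(ltW D0) //.
rewrite modulus_kmatrix ler_pdivlMr ?exprn_gt0 //.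
apply: le_trans (weight_c_ge p (rho_gt0 n)).
apply: le_trans (ler_wpM2l _ (kn_weight_le S0 sS Sp)) _; first exact: sqr_ge0.
rewrite mulrA ler_pM2r ?weight_gt0 // -[C0 * _ * _]mulrA -/D.
rewrite exprVn ler_pdivrMl ?exprn_gt0 ?mulr_gt0 ?addr_gt0 //.
rewrite exprMn [C0 ^+ 2]expr2.
have -> : C0 * C0 * (D + 1) ^+ 2 / C0 = C0 * (D + 1) ^+ 2 by field; rewrite gt_eqF.
rewrite ler_pM2l //; nra.
Qed.

Lemma index_bounded (C : R) : 0 < C -> l2riesz kmatrix C ->
  {homo (fun n => rho n) : m n / (m <= n)%N >-> m <= n} ->
  exists2 S : R, 0 <= S & forall n, `|level (rho n) - n.+1%:R| <= S.
Proof.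
move=> Cp rC mono.
pose p n := Num.truncn (Num.max (level (rho n) - 1) 0).
have lmono m n : (m <= n)%N -> level (rho m) <= level (rho n).
  by move=> /mono mn; rewrite /level ler_pM2l // ler_ln ?posrE.
have pm : {homo p : m n / (m <= n)%N}.
  move=> m n /lmono mn; apply: le_truncn.
  by rewrite ge_max !le_max lexx orbT andbT lerB // mn.
have q01 : 0 < expR (-1 : R) < 1 by rewrite expR_gt0 expR_lt1 oppr_lt0 ltr01.
have L0 : 0 < loss 1 := expR_gt0 _.
have A0 : 0 <= C0 * (loss 1 + 1) by rewrite mulr_ge0 ?addr_ge0 // ltW.
have c0 : 0 < (C0 * (loss 1 * (2 / (1 - expR (-1))) + 1))^-1.
  rewrite invr_gt0 mulr_gt0 // addr_gt0 // mulr_gt0 // divr_gt0 // subr_gt0 expR_lt1 oppr_lt0.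
have up n j : modulus (kmatrix n j) <= C0 * (loss 1 + 1) * expR (-1) ^+ ndist j (p n).
  by have [h1 h2] := near_index (rho_gt0 n); apply: kmatrix_le.
have low n : (C0 * (loss 1 * (2 / (1 - expR (-1))) + 1))^-1 <= modulus (kmatrix n (p n)).
  by have [h1 h2] := near_index (rho_gt0 n); apply: kmatrix_ge.
have [L1 H1] := riesz_count_le Cp rC q01 c0 A0 pm up low.
have [L2 H2] := riesz_count_ge Cp rC q01 c0 A0 pm up low.
(* The last term covers rows with p n = 0, whose level is bounded below by that of the first
   point. *)
exists (L1%:R + L2%:R + 3 + `|level (rho 0%N)|); first by rewrite !addr_ge0.
move=> n; have [h1 h2] := near_index (rho_gt0 n); rewrite -/(p n) in h1 h2.
have : n%:R <= (p n)%:R + L1%:R :> R by rewrite -natrD ler_nat.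
have : (p n)%:R <= n%:R + L2%:R :> R by rewrite -natrD ler_nat.
have l1 : 0 <= L1%:R :> R by [].
have l2 : 0 <= L2%:R :> R by [].
have := lmono 0%N n (leq0n n); have := ler_norm (- level (rho 0%N)).
have := normr_ge0 (level (rho 0%N)).
rewrite normrN ler_norml; move: h1 h2; rewrite -!natr1 => h1 [p0|h2] h3 h4 h5 h6 h7; last by lra.
by move: h1 h6 h7; rewrite p0; lra.
Qed.

End Kernels.
End Localization.

(** * Elementary inequalities for products and sums *)

Section ElementaryEstimates.
Context {R : realType}.

(** The crude growth 2^i is affordable against the decay exp(-i) of the kernel matrix, since 2 <
    e. *)
Lemma modulus_expB1 (z : R[i]) (e : R) i : modulus (z - 1) <= e -> e <= 1 ->
  modulus (1 - z ^+ i) <= e * (2 ^+ i - 1).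
Proof.
move=> ze e1; have e0 : 0 <= e := le_trans (modulus_ge0 _) ze.
have z2 : modulus z <= 2.
  rewrite -[z](subrK 1); apply: le_trans (modulusD_le _ _) _; rewrite modulus1.
  by rewrite -[leRHS]/(1 + 1) lerD // (le_trans ze).
elim: i => [|i IH]; first by rewrite !expr0 !subrr mulr0 modulus0.
have -> : 1 - z ^+ i.+1 = (1 - z ^+ i) * z + (1 - z) by rewrite exprSr; ring.
apply: le_trans (modulusD_le _ _) _; rewrite modulusM [modulus (1 - z)]modulusB.
apply: le_trans (lerD (ler_pM (modulus_ge0 _) (modulus_ge0 _) IH z2) ze) _.
by rewrite exprSr le_eqVlt; apply/orP; left; apply/eqP; ring.
Qed.

Lemma prod_oneD_le (I : Type) (r : seq I) (P : pred I) (x : I -> R) : (forall i, 0 <= x i) ->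
  \prod_(i <- r | P i) (1 + x i) <= expR (\sum_(i <- r | P i) x i).
Proof.
move=> x0; rewrite expR_sum; apply: ler_prod => i _.
by rewrite addr_ge0 //= expR_ge1Dx.
Qed.

Lemma prod_neq_split (T : comPzRingType) (F : nat -> T) N k : (k < N)%N ->
  \prod_(i < N | i != k :> nat) F i = (\prod_(i < k) F i) * \prod_(k.+1 <= i < N) F i.
Proof.
move=> kN; rewrite -(big_mkord (fun i => i != k)) (big_cat_nat (leq0n k) (ltnW kN)) /=.
rewrite [X in _ * X]big_ltn_cond // eqxx /=; congr (_ * _).
  rewrite -(big_mkord xpredT F) big_nat_cond [in RHS]big_nat_cond.
  by apply: eq_bigl => i /=; case: ltnP => //= ik; rewrite ltn_eqF.
rewrite big_nat_cond [in RHS]big_nat_cond.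
by apply: eq_bigl => i /=; case: ltnP => //= ik; rewrite gtn_eqF // andbT.
Qed.

Lemma coef_prod_XsubC_le (I : Type) (s : seq I) (P : pred I) (F : I -> R[i]) (r : R) m : 0 <= r ->
  modulus (\prod_(i <- s | P i) ('X - (F i)%:P))`_m * r ^+ m <=
  \prod_(i <- s | P i) (r + modulus (F i)).
Proof.
move=> r0; set p := \prod_(i <- s | P i) ('X - _).
(* The induction is run on the weighted sum of all coefficients, which is submultiplicative in the
   factors. *)
apply: le_trans (_ : \sum_(j < m.+1) modulus p`_j * r ^+ j <= _).
  rewrite big_ord_recr /= lerDr; apply: sumr_ge0 => j _.
  by rewrite mulr_ge0 ?modulus_ge0 ?exprn_ge0.
move: m.+1; rewrite /p; elim/big_rec2: _ => [|i a q _ IH] M.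
  case: M => [|M]; first by rewrite big_ord0.
  rewrite big_ord_recl coef1 modulus1 mul1r expr0 big1 ?addr0 // => j _.
  by rewrite coef1 modulus0 mul0r.
have a0 : 0 <= a by apply: le_trans (IH 0%N); rewrite big_ord0.
apply: le_trans (_ : \sum_(j < M) (modulus ('X * q)`_j * r ^+ j + modulus (F i) * (modulus q`_j * r ^+ j)) <= _).
  apply: ler_sum => j _; rewrite mulrBl coefB coefCM mulrA -mulrDl ler_wpM2r ?exprn_ge0 //.
  by apply: le_trans (modulusB_le _ _) _; rewrite modulusM.
have h2 : \sum_(j < M) modulus (F i) * (modulus q`_j * r ^+ j) <= modulus (F i) * a.
  by rewrite -mulr_sumr ler_wpM2l ?modulus_ge0 // IH.
suff h1 : \sum_(j < M) modulus ('X * q)`_j * r ^+ j <= r * a.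
  by rewrite big_split /= [leRHS]mulrDl; exact: lerD.
clear h2; case: M => [|M]; first by rewrite big_ord0 mulr_ge0.
rewrite big_ord_recl coefXM modulus0 mul0r add0r.
under eq_bigr do rewrite coefXM /= exprS mulrCA.
by rewrite -mulr_sumr ler_wpM2l // IH.
Qed.

(** The new term is a fixed fraction of the new partial sum, so the partial sums T grow
    geometrically; then x_n <= T_n <= t^(m - n) T_m <= D t^(m - n) x_m. *)
Lemma dominated_sum_decay (x : nat -> R) (D : R) : (forall n, 0 < x n) -> 0 < D ->
  (forall m, \sum_(k < m.+1) x k <= D * x m) ->
  exists2 eta : R, 0 < eta & exists K : R, forall n m, (n <= m)%N ->
    x n <= expR (K - eta * (m - n)%:R) * x m.
Proof.
move=> x0 D0 HD; pose T m := \sum_(k < m.+1) x k.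
have D1 : 0 < D + 1 by rewrite addr_gt0.
(* With D + 1 in place of D the ratio t is positive, as its logarithm requires. *)
pose t := 1 - (D + 1)^-1.
have t0 : 0 < t by rewrite subr_gt0 invf_lt1 // ltrDr.
have t1 : t < 1 by rewrite ltrBlDr ltrDl invr_gt0.
exists (- ln t); first by rewrite oppr_gt0 ln_lt0 // t0.
exists (ln D) => n m nm.
have step k : T k <= t * T k.+1.
  have := HD k.+1; rewrite -/(T k.+1) => h.
  have E : T k.+1 = T k + x k.+1 by rewrite /T big_ord_recr.
  have h' : (D + 1)^-1 * T k.+1 <= x k.+1.
    rewrite ler_pdivrMl // mulrDl mul1r; apply: le_trans h _; rewrite lerDl; exact: ltW.
  by rewrite /t mulrBl mul1r; lra.
have tt i : T n <= t ^+ i * T (n + i)%N.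
  elim: i => [|i IH]; first by rewrite mul1r addn0.
  apply: le_trans IH _; rewrite addnS exprSr -mulrA ler_pM2l ?exprn_gt0 //.
apply: le_trans (_ : T n <= _).
  by rewrite /T big_ord_recr /= lerDr; apply: sumr_ge0 => k _; exact: ltW.
apply: le_trans (tt (m - n)%N) _; rewrite subnKC // expRD lnK ?posrE // mulNr opprK.
rewrite [ln t * _]mulrC expRM_natl lnK ?posrE // -mulrA [D * _]mulrCA ler_pM2l ?exprn_gt0 //.
exact: HD.
Qed.

End ElementaryEstimates.

(** * Sequences at bounded level distance from the lattice *)

Section NearLattice.
Context {R : realType}.
Variables (alpha C0 S : R) (c kn : nat -> R) (lambda : nat -> R[i]).
Hypothesis alpha0 : 0 < alpha.
Hypothesis C0_gt0 : 0 < C0.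
Hypothesis c_gauss : forall m, C0^-1 * gauss alpha m <= c m <= C0 * gauss alpha m.
Local Notation rho n := (modulus (lambda n)).
Hypothesis rho_gt0 : forall n, 0 < rho n.
Hypothesis rho_mono : {homo (fun n => rho n) : m n / (m <= n)%N >-> m <= n}.
Hypothesis kn_gt0 : forall n, 0 < kn n.
Hypothesis kn_ge : forall n m, rho n ^+ m / Num.sqrt (c m) <= kn n.
Hypothesis kn_le : forall n B, (forall K, \sum_(m < K) (rho n ^+ m) ^+ 2 / c m <= B) ->
  kn n ^+ 2 <= B.
Hypothesis lambda_inj : injective lambda.
Hypothesis S0 : 0 <= S.
Hypothesis levelS : forall n, `|level alpha (rho n) - n.+1%:R| <= S.
Local Notation V := (kmatrix c kn lambda).
Local Notation E m := (gauss alpha m).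
Local Notation w n j := (weight alpha (rho n) j).

Let c_pos m : 0 < c m. Proof. exact: c_gt0 C0_gt0 c_gauss m. Qed.
Let E0 m : 0 < E m. Proof. exact: expR_gt0. Qed.
Let lev1 n : level alpha (rho n) - n.+1%:R <= S.
Proof. exact: le_trans (ler_norm _) (levelS n). Qed.
Let lev2 n : n = 0%N \/ - S <= level alpha (rho n) - n.+1%:R.
Proof. by right; have := levelS n; rewrite ler_norml => /andP[]. Qed.

Let A : R := C0 * (loss alpha S + 1).
Let A0 : 0 < A. Proof. by rewrite mulr_gt0 // addr_gt0 // expR_gt0. Qed.

Let V_le n j : modulus (V n j) <= A * expR (-1) ^+ ndist j n.
Proof. exact: (kmatrix_le alpha0 C0_gt0 c_gauss rho_gt0 kn_gt0 kn_ge S0 (lev1 n) (lev2 n)). Qed.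

Let L : R := loss alpha S.
Let L0 : 0 < L. Proof. exact: expR_gt0. Qed.
Let w_le n j : w n j <= L * (expR (-1) ^+ ndist j n) ^+ 2 * w n n.
Proof. exact: (weight_le alpha0 j (rho_gt0 n) S0 (lev1 n) (lev2 n)). Qed.
Let kn2_ge n : C0^-1 * w n n <= kn n ^+ 2.
Proof. exact: (kn_weight_ge (alpha := alpha) C0_gt0 c_gauss rho_gt0 kn_gt0 kn_ge). Qed.

(** g is the ratio of consecutive lattice radii, and G = exp(2 S / (2 alpha)) pays for two level
    displacements of at most S. *)
Let g : R := expR (- (2 * alpha)^-1).
Let G : R := expR (S / alpha).
Let g01 : 0 <= g < 1.
Proof. by rewrite expR_ge0 expR_lt1 oppr_lt0 invr_gt0 mulr_gt0. Qed.

Lemma rho_ratio k m : (k <= m)%N -> rho k / rho m <= G * g ^+ (m - k).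
Proof.
move=> km; rewrite (level_expR alpha0 (rho_gt0 k)) (level_expR alpha0 (rho_gt0 m)).
rewrite -expRN -expRD /G /g -expRM_natl -expRD ler_expR natrB //.
have := levelS k; have := levelS m; rewrite !ler_norml -[m.+1%:R]natr1 -[k.+1%:R]natr1.
move: (level _ _) (level _ _) => u v /andP[h1 h2] /andP[h3 h4].
rewrite -subr_ge0.
have -> : S / alpha + (m%:R - k%:R) * - (2 * alpha)^-1 - (u / (2 * alpha) - v / (2 * alpha))
  = (2 * S - (m%:R - k%:R) - u + v) / (2 * alpha).
  by field; rewrite gt_eqF.
by apply: divr_ge0; [lra | rewrite mulr_ge0 // ltW].
Qed.

(** Bounds every sum of ratios of a smaller to a larger radius; through 1 + x <= exp x it turns
    products of distances into products of radii at the cost exp(H). *)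
Let H : R := G / (1 - g).
Let H0 : 0 <= H.
Proof. by rewrite divr_ge0 ?expR_ge0 // subr_ge0 ltW //; case/andP: g01. Qed.

Lemma ratio_sum_low m n : (n <= m.+1)%N -> \sum_(k < n) rho k / rho m <= H.
Proof.
move=> nm; apply: le_trans (_ : \sum_(k < m.+1) G * g ^+ (m - k) <= _).
  rewrite (big_ord_widen _ (fun k => rho k / rho m) nm) big_mkcond /=.
  apply: ler_sum => k _; case: ifP => _; first by rewrite rho_ratio // -ltnS.
  by rewrite mulr_ge0 ?exprn_ge0 ?expR_ge0.
rewrite -mulr_sumr ler_wpM2l ?expR_ge0 // (reindex_inj rev_ord_inj) /=.
apply: le_trans (geometric_sum_le m.+1 g01); apply: ler_sum => k _.
by rewrite subSS subKn // -ltnS.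
Qed.

Lemma ratio_sum_high m N : \sum_(m.+1 <= k < N) rho m / rho k <= H.
Proof.
have /andP[g0 g1] := g01.
apply: le_trans (_ : G * \sum_(m.+1 <= k < N) g ^+ (k - (m.+1 - 1)) <= _).
  rewrite mulr_sumr; apply: ler_sum_nat => k /andP[mk _].
  by rewrite subn1 /= rho_ratio // ltnW.
rewrite ler_wpM2l ?expR_ge0 // (le_trans (geometric_sum_ge _ g01 _)) //.
by rewrite expr1 ler_piMl ?invr_ge0 ?subr_ge0 ?(ltW g1).
Qed.

Definition radii n : R := \prod_(k < n) rho k.
Definition Xseq n : R := E n / radii n.+1 ^+ 2.
Definition Yseq n : R := E n / radii n ^+ 2.

Lemma radii_gt0 n : 0 < radii n.
Proof. by apply: prodr_gt0 => k _. Qed.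

Lemma radii_split m n : (m <= n)%N -> radii n = radii m * \prod_(m <= k < n) rho k.
Proof.
by move=> mn; rewrite /radii -!(big_mkord xpredT (fun k => rho k)) (big_cat_nat (leq0n m) mn).
Qed.

Lemma Xseq_gt0 n : 0 < Xseq n.
Proof. by rewrite divr_gt0 // exprn_gt0 // radii_gt0. Qed.

Lemma Yseq_gt0 n : 0 < Yseq n.
Proof. by rewrite divr_gt0 // exprn_gt0 // radii_gt0. Qed.

Lemma prod_dist_le_low k n : (n <= k.+1)%N ->
  \prod_(i < n) modulus (lambda k - lambda i) <= rho k ^+ n * expR H.
Proof.
move=> nk; apply: le_trans (_ : \prod_(i < n) (rho k * (1 + rho i / rho k)) <= _).
  apply: ler_prod => i _; rewrite modulus_ge0 /=; apply: le_trans (modulusB_le _ _) _.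
  by rewrite mulrDr mulr1 mulrC divfK ?gt_eqF.
rewrite big_split /= prodr_const card_ord ler_wpM2l ?exprn_ge0 ?modulus_ge0 //.
apply: le_trans (prod_oneD_le _ _ _) _; first by move=> i; rewrite divr_ge0 ?modulus_ge0.
by rewrite ler_expR ratio_sum_low.
Qed.

Lemma prod_dist_le_high k n :
  \prod_(k.+1 <= i < n) modulus (lambda k - lambda i) <=
  (\prod_(k.+1 <= i < n) rho i) * expR H.
Proof.
apply: le_trans (_ : \prod_(k.+1 <= i < n) (rho i * (1 + rho k / rho i)) <= _).
  apply: ler_prod => i _; rewrite modulus_ge0 /=; apply: le_trans (modulusB_le _ _) _.
  by rewrite mulrDr mulr1 [_ * (_ / _)]mulrC divfK ?gt_eqF // addrC.
rewrite big_split /= ler_wpM2l ?prodr_ge0 // => [i _|]; first exact: modulus_ge0.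
apply: le_trans (prod_oneD_le _ _ _) _; first by move=> i; rewrite divr_ge0 ?modulus_ge0.
by rewrite ler_expR ratio_sum_high.
Qed.

Lemma kmatrixJ n m : (V n m)^*%R = lambda n ^+ m / (Num.sqrt (c m) * kn n)%:C.
Proof.
have cV (r : R) : (r%:C)^-1 = (r^-1)%:C :> R[i] by rewrite fmorphV.
by rewrite /kmatrix cJM cJX cJK cV cJ_real.
Qed.

(** The logarithmic displacement of |lambda_k| from gamma_k; in the theorem it is delta_k. *)
Definition dev k : R := (level alpha (rho k) - k.+1%:R) / (2 * alpha).

Lemma radiusE k : rho k = expR (k.+1%:R / (2 * alpha) + dev k).
Proof.
rewrite {1}(level_expR alpha0 (rho_gt0 k)); congr expR.
by rewrite /dev; field; rewrite gt_eqF.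
Qed.

Lemma radiiE n : radii n = expR (n%:R * n.+1%:R / (4 * alpha) + \sum_(k < n) dev k).
Proof.
elim: n => [|n IH]; first by rewrite /radii !big_ord0 mul0r mul0r addr0 expR0.
rewrite /radii big_ord_recr /= -/(radii n) IH radiusE -expRD big_ord_recr /=; congr expR.
by rewrite -[n.+2%:R]natr1 -[n.+1%:R]natr1; field; rewrite gt_eqF.
Qed.

Lemma YseqE n : Yseq n = expR (n.+1%:R / (2 * alpha) - 2 * \sum_(k < n) dev k).
Proof.
rewrite /Yseq radiiE -expRM_natl -expRN -expRD; congr expR.
by rewrite -[n.+1%:R]natr1; field; rewrite gt_eqF.
Qed.

Lemma XseqE n : Xseq n = expR (- (n.+1%:R / (2 * alpha)) - 2 * \sum_(k < n.+1) dev k).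
Proof.
rewrite /Xseq radiiE -expRM_natl -expRN -expRD; congr expR.
by rewrite -[n.+2%:R]natr1 -[n.+1%:R]natr1; field; rewrite gt_eqF.
Qed.

Lemma dev_sum m n : (m <= n)%N ->
  \sum_(m <= k < n) dev k = \sum_(k < n) dev k - \sum_(k < m) dev k.
Proof.
move=> mn; rewrite -!(big_mkord xpredT dev) (big_cat_nat (leq0n m) mn) /=.
by rewrite [X in X - _]addrC addrK.
Qed.


(** * Necessity: separation and growth of X and Y *)

Section FromRieszBound.
Variable C : R.
Hypothesis C_gt0 : 0 < C.
Hypothesis rC : l2riesz V C.

Let lower K a B : l2ub (comb V a K) B -> \sum_(n < K) modulus (a n) ^+ 2 <= C * B.
Proof. by have [_ low _] := rC; exact: low. Qed.

Let lower2 (n k : nat) (x : R[i]) B : n != k -> l2ub (fun m => V n m - x * V k m) B -> 1 <= C * B.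
Proof.
move=> nk HB; pose a i : R[i] := if i == n then 1 else if i == k then - x else 0.
pose K := (maxn n k).+1.
have nK : (n < K)%N by rewrite ltnS leq_maxl.
have kK : (k < K)%N by rewrite ltnS leq_maxr.
have sumE (F : nat -> R[i]) : \sum_(i < K) a i * F i = F n - x * F k.
  rewrite (bigD1 (Ordinal nK)) //= (bigD1 (Ordinal kK)) /=; last first.
    by rewrite -val_eqE /= eq_sym.
  rewrite big1 => [|i /andP[]]; last first.
    by rewrite -!val_eqE /= /a => /negPf -> /negPf ->; rewrite mul0r.
  by rewrite /a eqxx eq_sym (negPf nk) eqxx mul1r addr0 mulNr.
have ub : l2ub (comb V a K) B.
  move=> M; rewrite (eq_bigr (fun m : 'I_M => modulus (V n m - x * V k m) ^+ 2)) ?HB // => m _.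
  by rewrite /comb (sumE (V^~ m)).
apply: le_trans (lower ub).
rewrite (bigD1 (Ordinal nK)) //= {1}/a eqxx modulus1 expr1n lerDl.
by apply: sumr_ge0 => i _; exact: sqr_ge0.
Qed.

(** If lambda_k / lambda_n is close to 1, a multiple x of row k matches row n in column n, and the
    difference has entries V_nm (1 - z^|m - n|) with z close to 1. It is too small for the lower
    Riesz bound applied to two coefficients, one of them 1. *)
Lemma riesz_separated : exists2 e : R, 0 < e &
  forall n k, n != k -> e * rho n <= modulus (lambda n - lambda k).
Proof.
clearbody A; pose h : R := 2 * expR (-1).
have h0 : 0 <= h by rewrite mulr_ge0 ?expR_ge0.
have h1 : h < 1.
  rewrite /h expRN ltr_pdivrMr ?expR_gt0 // mul1r.
  by have := @expR_gt1Dx R 1 (oner_neq0 _); lra.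
pose D := A ^+ 2 * (2 / (1 - h)).
have D0 : 0 < D by rewrite mulr_gt0 ?exprn_gt0 // divr_gt0 // subr_gt0.
(* The difference of the two rows has squared norm at most D / T^2, and T^2 > C D contradicts the
   lower bound 1 <= C D / T^2. *)
pose T := 1 + C * D; have T1 : 1 < T by rewrite ltrDl mulr_gt0.
have DE : D = A ^+ 2 * (2 / (1 - h)) by [].
have TE : T = 1 + C * D by [].
clearbody T; clearbody D.
exists (2 * T)^-1; first by rewrite invr_gt0 mulr_gt0 // (lt_trans ltr01).
move=> n k nk; rewrite leNgt; apply/negP => close.
have T0 : 0 < T by apply: lt_trans T1.
have ln0 : lambda n != 0 by rewrite -modulus_gt0.
have lk0 : lambda k != 0 by rewrite -modulus_gt0.
have dist : modulus (lambda k / lambda n - 1) < (2 * T)^-1.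
  rewrite -[1](divff ln0) -mulrBl modulus_div ltr_pdivrMr // modulusB.
  by apply: lt_le_trans close _.
have half : (2 * T)^-1 <= 2^-1 by rewrite lef_pV2 ?posrE ?mulr_gt0 //; lra.
have TV : (2 * T)^-1 <= T^-1 by rewrite lef_pV2 ?posrE ?mulr_gt0 //; lra.
have TV1 : T^-1 <= 1 by rewrite invf_le1 // ltW.
have near1 : modulus (lambda k / lambda n - 1) <= T^-1 by apply: le_trans (ltW dist) _.
have big_ratio : 2^-1 <= modulus (lambda k / lambda n).
  have := modulusB_ge 1 (1 - lambda k / lambda n); rewrite subKr modulus1 modulusB; lra.
have near2 : modulus (lambda n / lambda k - 1) <= T^-1.
  have -> : lambda n / lambda k - 1 = - (lambda k / lambda n - 1) / (lambda k / lambda n).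
    by field; rewrite ln0 lk0.
  rewrite modulus_div modulusN ler_pdivrMr ?(lt_le_trans _ big_ratio) //.
  apply: le_trans (ltW dist) _; rewrite invfM mulrC ler_pM2l ?invr_gt0 //.
pose x : R[i] := (kn k / kn n)%:C * ((lambda n / lambda k)^*%R) ^+ n.
have ub : l2ub (fun m => V n m - x * V k m) (T^-1 ^+ 2 * D).
  move=> M; have TA0 : 0 <= T^-1 ^+ 2 * A ^+ 2 by apply: mulr_ge0; exact: sqr_ge0.
  apply: le_trans (_ : \sum_(m < M) (T^-1 ^+ 2 * A ^+ 2) * h ^+ ndist m n <= _); last first.
    rewrite -mulr_sumr DE [leRHS]mulrA ler_wpM2l //.
    by apply: ndist_sum; rewrite h0.
  apply: ler_sum => m _.
  apply: le_trans (_ : (A * expR (-1) ^+ ndist m n * (T^-1 * 2 ^+ ndist m n)) ^+ 2 <= _); last first.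
    have -> : A * expR (-1) ^+ ndist m n * (T^-1 * 2 ^+ ndist m n) = T^-1 * A * h ^+ ndist m n.
      by rewrite /h exprMn; ring.
    rewrite exprMn [(T^-1 * A) ^+ 2]exprMn ler_wpM2l // expr2 ler_piMr ?exprn_ge0 //.
    by rewrite exprn_ile1 // ltW.
  suff [z zT ->] : exists2 z, modulus (z - 1) <= T^-1 &
      V n m - x * V k m = V n m * (1 - z ^+ ndist m n).
    rewrite modulusM ler_sqr ?nnegrE ?mulr_ge0 ?modulus_ge0 ?exprn_ge0 ?expR_ge0 ?invr_ge0 ?(ltW T0) ?(ltW A0) //.
    apply: ler_pM (V_le n m) _; rewrite ?modulus_ge0 //.
    apply: le_trans (modulus_expB1 _ zT TV1) _.
    by rewrite ler_wpM2l ?invr_ge0 ?(ltW T0) // lerBlDr lerDl.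
  have [cn ck] : (lambda n)^*%R != 0 /\ (lambda k)^*%R != 0 by rewrite !conjC_eq0.
  have sm : (Num.sqrt (c m))%:C != 0 :> R[i].
    by rewrite -[0]/(0%:C) (inj_eq (@complexI R)) gt_eqF // sqrtr_gt0.
  have kk : (kn k)%:C != 0 :> R[i].
    by rewrite -[0]/(0%:C) (inj_eq (@complexI R)) gt_eqF.
  have kn' : (kn n)%:C != 0 :> R[i].
    by rewrite -[0]/(0%:C) (inj_eq (@complexI R)) gt_eqF.
  rewrite /x /kmatrix !rmorphM !fmorphV /=.
  set l := (lambda n)^*%R in cn *; set l' := (lambda k)^*%R in ck *.
  have [nm|/ltnW mn] := leqP n m.
    exists (l' / l).
      by move: near1; rewrite -modulusJ rmorphB rmorphM fmorphV rmorph1.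
    have e (y : R[i]) : y ^+ m = y ^+ (m - n) * y ^+ n by rewrite -exprD subnK.
    rewrite ndist_ge // !e !expr_div_n; field.
    by rewrite kk kn' sm !expf_neq0.
  exists (l / l').
    by move: near2; rewrite -modulusJ rmorphB rmorphM fmorphV rmorph1.
  have e (y : R[i]) : y ^+ n = y ^+ (n - m) * y ^+ m by rewrite -exprD subnK.
  rewrite ndist_le // expr_div_n !e expr_div_n; field.
  by rewrite kk kn' sm !expf_neq0.
have := lower2 nk ub; rewrite leNgt => /negP; apply.
rewrite mulrCA exprVn mulrC ltr_pdivrMr ?exprn_gt0 // mul1r TE.
have CD : 0 < C * D by rewrite mulr_gt0.
nra.
Qed.

(** Let f have zeros lambda_0, ..., lambda_(n-1). Its normalized samples vanish for k < n and,
    squared, are O(E_n q^|k - n|) otherwise, so the frame bound gives norm O(E_n) for the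
    coefficients. Landau's inequality on each circle |z| = rho_m bounds the part of this norm
    localized near m from below. *)
Lemma Yseq_sum : exists2 D : R, 0 < D & forall n, \sum_(m < n.+1) Yseq m <= D * Yseq n.
Proof.
pose q : R := expR (-1); pose Q := 2 / (1 - q).
have q01 : 0 <= q < 1 by rewrite expR_ge0 expR_lt1 oppr_lt0 ltr01.
have Q0 : 0 < Q by rewrite divr_gt0 // subr_gt0; case/andP: q01.
have [eH eH0 dist_low] : exists2 e : R, 0 < e & forall k n, (n <= k.+1)%N ->
    \prod_(i < n) modulus (lambda k - lambda i) <= rho k ^+ n * e.
  by exists (expR H); [exact: expR_gt0 | exact: prod_dist_le_low].
have eH2 : 0 < eH ^+ 2 by exact: exprn_gt0.
pose B := eH ^+ 2 * C0 * L * Q.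
have B0 : 0 < B by do 3 (apply: mulr_gt0 => //).
exists (L * C0 * Q * (10 * C * B)); first by clearbody B Q L; rewrite !mulr_gt0.
have BE : B = eH ^+ 2 * C0 * L * Q by [].
have qq k : (q ^+ k) ^+ 2 <= q ^+ k.
  by rewrite expr2 ler_piMr ?exprn_ge0 ?expR_ge0 // exprn_ile1 ?expR_ge0 // expR_le1 lerN10.
have ndQ j N : \sum_(k < N) q ^+ ndist k j <= Q by exact: ndist_sum.
have wq n j : w n j <= L * q ^+ ndist j n * w n n.
  apply: le_trans (w_le n j) _; rewrite ler_pM2r ?weight_gt0 // ler_pM2l //.
clearbody B L Q.
move=> n; pose f : {poly R[i]} := \prod_(k < n) ('X - (lambda k)%:P).
have sf : size f = n.+1 by rewrite size_prod_XsubC -[index_enum _]enumT size_enum_ord.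
pose x j : R[i] := f`_j * (Num.sqrt (c j))%:C.
have sE (r : R) : r != 0 -> r%:C != 0 :> R[i].
  by move=> r0; rewrite -[0]/(0%:C) (inj_eq (@complexI R)).
have fE k : \sum_(j < n.+1) x j * (V k j)^*%R = f.[lambda k] / (kn k)%:C.
  rewrite horner_coef sf mulr_suml; apply: eq_bigr => j _.
  rewrite /x kmatrixJ rmorphM /=.
  by field; rewrite !sE // gt_eqF // sqrtr_gt0.
have frame K : \sum_(k < K) modulus (\sum_(j < n.+1) x j * (V k j)^*%R) ^+ 2 <= B * E n.
  apply: le_trans (_ : \sum_(k < K) (eH ^+ 2 * C0 * L * E n) * q ^+ ndist k n <= _); last first.
    have -> : B * E n = (eH ^+ 2 * C0 * L * E n) * Q by rewrite BE; ring.
    rewrite -mulr_sumr ler_wpM2l ?ndQ //.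
    by rewrite ltW // ; do 3 (apply: mulr_gt0 => //).
  apply: ler_sum => k _; rewrite fE horner_prod.
  have c0 : 0 < eH ^+ 2 * C0 * L * E n by do 3 (apply: mulr_gt0 => //).
  have [nk|kn'] := leqP n k; last first.
    rewrite (bigD1 (Ordinal kn')) //= hornerXsubC subrr mul0r mul0r modulus0 expr0n.
    by rewrite mulr_ge0 ?exprn_ge0 ?expR_ge0 // ltW.
  rewrite modulus_div modulus_real gtr0_norm // expr_div_n ler_pdivrMr ?exprn_gt0 //.
  apply: le_trans (_ : (rho k ^+ n * eH) ^+ 2 <= _).
    rewrite ler_sqr ?nnegrE ?modulus_ge0 ?mulr_ge0 ?exprn_ge0 ?modulus_ge0 ?(ltW eH0) //.
    rewrite modulus_prod; under eq_bigr do rewrite hornerXsubC.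
    by apply: dist_low; rewrite ltnW.
  have := wq k n; rewrite {1}/weight ler_pdivrMr // => h1.
  have h2 : w k k <= C0 * kn k ^+ 2 by have := kn2_ge k; rewrite ler_pdivrMl.
  rewrite exprMn [leLHS]mulrC; have e0 : 0 <= eH ^+ 2 by exact: sqr_ge0.
  apply: le_trans (ler_wpM2l e0 h1) _.
  have -> : eH ^+ 2 * C0 * L * E n * q ^+ ndist k n * kn k ^+ 2 =
     eH ^+ 2 * (L * q ^+ ndist n k * (C0 * kn k ^+ 2) * E n) by rewrite ndistC; ring.
  rewrite ler_wpM2l // ler_pM2r // ler_wpM2l // mulr_ge0 ?exprn_ge0 ?expR_ge0 // ltW //.
have := riesz_frame C_gt0 rC frame.
set Z := \sum_(j < n.+1) _ => hZ.
have xE j : modulus (x j) ^+ 2 = modulus f`_j ^+ 2 * c j.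
  by rewrite /x modulusM modulus_real ger0_norm ?sqrtr_ge0 // exprMn sqr_sqrtr // ltW.
(* Here prod_(k < n) max(rho_m, rho_k) is at least rho_m^m times the product of the radii from m to
   n - 1; the weight converts the circle norm into the coefficient norm localized around j = m. *)
have low m : (m < n.+1)%N -> Yseq m * radii n ^+ 2 <= L * C0 * \sum_(j < n.+1) modulus (x j) ^+ 2 * q ^+ ndist j m.
  rewrite ltnS => mn; have wm := weight_gt0 alpha m (rho_gt0 m).
  have h1 : Yseq m * radii n ^+ 2 * w m m <= circle_norm (rho m) n.+1 f.
    have := @landau R (rho m) lambda n (rho_gt0 m) 1 0.
    rewrite size_poly1 => /(_ isT); rewrite coef1 modulus1 expr0 !expr1n !mulr1 addn0.
    apply: le_trans; rewrite /Yseq /weight.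
    have -> : E m / radii m ^+ 2 * radii n ^+ 2 * ((rho m ^+ m) ^+ 2 / E m) = (rho m ^+ m * (radii n / radii m)) ^+ 2.
      by field; rewrite !gt_eqF // radii_gt0.
    have p0 : 0 <= rho m ^+ m * (radii n / radii m).
      by rewrite mulr_ge0 ?exprn_ge0 ?modulus_ge0 // divr_ge0 // ltW // radii_gt0.
    rewrite ler_sqr ?nnegrE //; last first.
      by apply: prodr_ge0 => k _; rewrite le_max modulus_ge0.
    rewrite (radii_split mn) [radii m * _]mulrC mulfK ?gt_eqF ?radii_gt0 //.
    rewrite -(big_mkord xpredT (fun k => Num.max (rho m) (rho k))) (big_cat_nat (leq0n m) mn) /=.
    apply: ler_pM.
    - by rewrite exprn_ge0 ?modulus_ge0.
    - by apply: prodr_ge0 => i _; exact: modulus_ge0.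
    - have -> : rho m ^+ m = \prod_(i < m) rho m by rewrite prodr_const card_ord.
      rewrite big_mkord; apply: ler_prod => i _; by rewrite modulus_ge0 le_max lexx.
    - by apply: ler_prod => i _; rewrite modulus_ge0 le_max lexx orbT.
  rewrite -(ler_pM2r wm); apply: le_trans h1 _.
  rewrite /circle_norm mulr_sumr mulr_suml; apply: ler_sum => j _.
  have := wq m j; rewrite {1}/weight ler_pdivrMr // => h1.
  have /andP[h2 _] := c_gauss j; rewrite ler_pdivrMl // in h2.
  rewrite xE; apply: le_trans (ler_wpM2l (sqr_ge0 _) h1) _.
  have -> : L * C0 * (modulus f`_j ^+ 2 * c j * q ^+ ndist j m) * w m m =
    modulus f`_j ^+ 2 * (L * q ^+ ndist j m * w m m * (C0 * c j)) by ring.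
  rewrite ler_wpM2l ?sqr_ge0 // ler_wpM2l //.
  by apply: mulr_ge0; [rewrite mulr_ge0 ?exprn_ge0 ?expR_ge0 // ltW | exact: ltW].
have rn := radii_gt0 n.
rewrite -(ler_pM2r (exprn_gt0 2 rn)) mulr_suml.
(* After exchanging the sums each coefficient is charged at most Q over all circles, so the n + 1
   Landau bounds share a single frame bound. *)
apply: (@le_trans _ _ (\sum_(m < n.+1) L * C0 * \sum_(j < n.+1) modulus (x j) ^+ 2 * q ^+ ndist j m)).
  by apply: ler_sum => m _; exact: low.
rewrite -mulr_sumr exchange_big /=.
apply: le_trans (_ : L * C0 * (Q * Z) <= _).
  rewrite ler_pM2l ?mulr_gt0 // /Z mulr_sumr; apply: ler_sum => j _.
  rewrite -mulr_sumr mulrC ler_wpM2r ?sqr_ge0 //.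
  by under eq_bigr do rewrite ndistC; exact: ndQ.
have -> : L * C0 * Q * (10 * C * B) * Yseq n * radii n ^+ 2 = L * C0 * (Q * (10 * C * (B * E n))).
  by rewrite /Yseq; field; rewrite gt_eqF.
by rewrite ler_pM2l ?mulr_gt0 // ler_pM2l.
Qed.

(** The test combination is the divided difference of the kernels at lambda_0, ..., lambda_m. Its
    coordinates vanish before m and decay after m, so its squared norm is O(1 / E_m); its
    coefficients are bounded below through upper bounds on the distances between nodes. *)
Lemma Xseq_sum : exists2 D : R, 0 < D & forall m, \sum_(k < m.+1) (Xseq k)^-1 <= D / Xseq m.
Proof.
(* Half of the decay rate of the bumps: [divdiff_le] is used at the radius rho_m / q, which exceeds
   all nodes and costs q^-(j - m), less than the decay gains. *)
pose q : R := expR (- 2^-1).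
have q01 : 0 <= q < 1 by rewrite expR_ge0 expR_lt1 oppr_lt0 invr_gt0 ltr0n.
have q1 : 0 < 1 - q by rewrite subr_gt0; case/andP: q01.
have q0 : 0 < q := expR_gt0 _.
have qE : expR (-1) = q ^+ 2 by rewrite -expRM_natl; congr expR; field.
pose Q := 2 / (1 - q).
have Q0 : 0 < Q by rewrite divr_gt0.
have ndQ j N : \sum_(k < N) q ^+ ndist k j <= Q by exact: ndist_sum.
(* Each factor obeys 1 / (1 - q x) <= 1 + x / (1 - q) for 0 <= x <= 1, and the ratios x have a
   bounded sum. *)
have [P P0 HP] : exists2 P : R, 0 < P & forall m,
    (\prod_(k < m.+1) (1 - rho k / (q^-1 * rho m)))^-1 <= P.
  exists (expR (H / (1 - q))) => [|m]; first exact: expR_gt0.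
  rewrite -prodfV; apply: le_trans (_ : \prod_(k < m.+1) (1 + (1 - q)^-1 * (rho k / rho m)) <= _).
    apply: ler_prod => k _; have km : rho k <= rho m by rewrite rho_mono // -ltnS.
    have -> : rho k / (q^-1 * rho m) = q * (rho k / rho m) by field; rewrite !gt_eqF.
    set x := rho k / rho m; have x0 : 0 <= x by rewrite divr_ge0 ?modulus_ge0.
    have x1 : x <= 1 by rewrite ler_pdivrMr ?mul1r.
    have p : 0 < 1 - q * x by have := ler_wpM2l (ltW q0) x1; lra.
    clearbody x.
    rewrite invr_ge0 (ltW p) /= -[leLHS]mul1r ler_pdivrMr //.
    rewrite -(ler_pM2l q1).
    have -> : (1 - q) * ((1 + (1 - q)^-1 * x) * (1 - q * x)) = ((1 - q) + x) * (1 - q * x).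
      by field; rewrite gt_eqF.
    have h1 : 0 <= x * (1 - x) * q by rewrite !mulr_ge0 ?subr_ge0 ?(ltW q0).
    have h2 : 0 <= x * (1 - q) * (1 - q).
      by rewrite !mulr_ge0 ?(ltW q1).
    nra.
  apply: le_trans (prod_oneD_le _ _ _) _.
    by move=> k; rewrite mulr_ge0 ?divr_ge0 ?modulus_ge0 // invr_ge0 ltW.
  rewrite ler_expR -mulr_sumr mulrC ler_pM2r ?invr_gt0 //.
  exact: ratio_sum_low.
have [e e0 [dist_low dist_high]] : exists2 e : R, 0 < e & 
    (forall k n, (n <= k.+1)%N -> \prod_(i < n) modulus (lambda k - lambda i) <= rho k ^+ n * e) /\
    (forall k n, \prod_(k.+1 <= i < n) modulus (lambda k - lambda i) <= (\prod_(k.+1 <= i < n) rho i) * e).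
  exists (expR H); first exact: expR_gt0.
  by split=> *; [exact: prod_dist_le_low | exact: prod_dist_le_high].
have wq n j : w n j <= L * (q ^+ 2 ^+ ndist j n) ^+ 2 * w n n by rewrite -qE; exact: w_le.
exists (C * (P ^+ 2 * C0 * L * Q) * (C0 * e ^+ 4)).
  by clearbody L Q; rewrite !mulr_gt0 ?exprn_gt0.
clearbody L Q.
move=> m; have rm := radii_gt0 m.+1.
pose a k : R[i] := ((node_weight lambda m k)^* * (kn k)%:C)%R.
have ub : l2ub (comb V a m.+1) (P ^+ 2 * C0 * L / E m * Q).
  move=> M; apply: le_trans (_ : \sum_(j < M) P ^+ 2 * C0 * L / E m * q ^+ ndist j m <= _); last first.
    by rewrite -mulr_sumr ler_wpM2l // !mulr_ge0 ?invr_ge0 ?sqr_ge0 // ltW.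
  apply: ler_sum => j _.
  have -> : comb V a m.+1 j = ((divdiff lambda m j)^* / (Num.sqrt (c j))%:C)%R.
    rewrite /comb /divdiff cJ_sum mulr_suml; apply: eq_bigr => k _.
    rewrite /a /kmatrix cJM cJX rmorphM /=.
    have sE (r : R) : r != 0 -> r%:C != 0 :> R[i].
      by move=> r0; rewrite -[0]/(0%:C) (inj_eq (@complexI R)).
    by field; rewrite !sE // gt_eqF // sqrtr_gt0.
  rewrite modulus_div modulusJ modulus_real ger0_norm ?sqrtr_ge0 // expr_div_n sqr_sqrtr ?(ltW (c_pos j)) //.
  have [jm|mj] := ltnP j m.
    rewrite divdiff_low ?(ltnW jm) // ltn_eqF // modulus0 expr0n mul0r.
    by rewrite !mulr_ge0 ?exprn_ge0 ?invr_ge0 // ltW.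
  have T0 : 0 < q^-1 * rho m by rewrite mulr_gt0 // invr_gt0.
  have lT k : (k <= m)%N -> rho k < q^-1 * rho m.
    move=> km; apply: le_lt_trans (rho_mono km) _.
    by rewrite ltr_pMl // invf_gt1 //; case/andP: q01.
  have D := divdiff_le lambda_inj lT j.
  have D' : modulus (divdiff lambda m j) <= (q^-1 * rho m) ^+ j / (q^-1 * rho m) ^+ m * P.
    apply: le_trans D _; rewrite ler_wpM2l // divr_ge0 ?exprn_ge0 // ltW //.
  rewrite ler_pdivrMr //.
  apply: le_trans (_ : ((q^-1 * rho m) ^+ j / (q^-1 * rho m) ^+ m * P) ^+ 2 <= _).
    rewrite ler_sqr ?nnegrE ?modulus_ge0 // mulr_ge0 ?divr_ge0 ?exprn_ge0 // ltW //.
  have := wq m j; rewrite {1}/weight ler_pdivrMr // => h1.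
  have /andP[h2 _] := c_gauss j; rewrite ler_pdivrMl // in h2.
  have rpow : 0 < rho m ^+ m by rewrite exprn_gt0.
  have qpow k : 0 < q ^+ k by rewrite exprn_gt0.
  have -> : ((q^-1 * rho m) ^+ j / (q^-1 * rho m) ^+ m * P) ^+ 2 =
      (q ^+ m / q ^+ j * P / rho m ^+ m) ^+ 2 * (rho m ^+ j) ^+ 2.
    rewrite !exprMn !exprVn; field.
    by rewrite !gt_eqF // exprn_gt0.
  apply: le_trans (ler_wpM2l (sqr_ge0 _) h1) _.
  have -> : q ^+ j = q ^+ m * q ^+ (j - m) by rewrite -exprD subnKC.
  rewrite ndist_ge //; set t := q ^+ (j - m).
  have t0 : 0 < t := qpow _.
  have -> : q ^+ 2 ^+ (j - m) = t ^+ 2 by rewrite /t -!exprM mulnC.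
  have -> : (q ^+ m / (q ^+ m * t) * P / rho m ^+ m) ^+ 2 * (L * (t ^+ 2) ^+ 2 * w m m * E j) =
      (t * t) * (P ^+ 2 * L / E m * E j).
    rewrite /weight; field.
    by rewrite !gt_eqF // ?exprn_gt0 ?expR_gt0.
  have -> : P ^+ 2 * C0 * L / E m * t * c j = t * (P ^+ 2 * L / E m * (C0 * c j)) by ring.
  apply: le_trans (_ : t * (P ^+ 2 * L / E m * E j) <= _).
    rewrite ler_wpM2r ?ler_piMr ?(ltW t0) //.
      by rewrite !mulr_ge0 ?invr_ge0 ?sqr_ge0 // ltW.
    by rewrite exprn_ile1 ?(ltW q0) //; case/andP: q01 => _ /ltW.
  rewrite ler_wpM2l ?(ltW t0) // ler_wpM2l //.
  by rewrite !mulr_ge0 ?invr_ge0 ?sqr_ge0 // ltW.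
have := lower ub => main.
have low k : (k < m.+1)%N -> (Xseq k)^-1 <= C0 * e ^+ 4 * radii m.+1 ^+ 2 * modulus (a k) ^+ 2.
  move=> km; have wk := weight_gt0 alpha k (rho_gt0 k).
  rewrite /a modulusM modulusJ modulus_real gtr0_norm // exprMn.
  have h1 : (rho k ^+ k * e * (radii m.+1 / radii k.+1 * e))^-1 <= modulus (node_weight lambda m k).
    rewrite /node_weight modulusV modulus_prod lef_pV2 ?posrE; last 2 first.
    - by rewrite !mulr_gt0 ?exprn_gt0 ?invr_gt0 ?radii_gt0.
    - apply: prodr_gt0 => i ik; rewrite modulus_gt0 subr_eq0 inj_eq //.
      by rewrite eq_sym.
    rewrite (prod_neq_split (fun i => modulus (lambda k - lambda i)) km).
    apply: ler_pM (dist_low _ _ _) _ => //; try by apply: prodr_ge0 => *; exact: modulus_ge0.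
    apply: le_trans (dist_high _ _) _.
    by rewrite (radii_split km) [radii k.+1 * _]mulrC mulfK ?gt_eqF ?radii_gt0.
  have rk := radii_gt0 k.+1.
  have rpow : 0 < rho k ^+ k by rewrite exprn_gt0.
  have h2 : ((rho k ^+ k * e * (radii m.+1 / radii k.+1 * e))^-1) ^+ 2 <= modulus (node_weight lambda m k) ^+ 2.
    rewrite ler_sqr ?nnegrE ?modulus_ge0 // invr_ge0 !mulr_ge0 ?invr_ge0 // ltW //.
  have h3 := ler_pM (sqr_ge0 _) (ltW (mulr_gt0 (_ : 0 < C0^-1) wk)) h2 (kn2_ge k).
  have h4 : 0 <= C0 * e ^+ 4 * radii m.+1 ^+ 2 by rewrite !mulr_ge0 ?exprn_ge0 // ltW.
  apply: le_trans (ler_wpM2l h4 (h3 _)); last by rewrite invr_gt0.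
  rewrite le_eqVlt; apply/orP; left; apply/eqP; rewrite /Xseq /weight; field.
  by rewrite !gt_eqF.
apply: (@le_trans _ _ (\sum_(k < m.+1) C0 * e ^+ 4 * radii m.+1 ^+ 2 * modulus (a k) ^+ 2)).
  by apply: ler_sum => k _; exact: low.
rewrite -mulr_sumr.
have -> : C * (P ^+ 2 * C0 * L * Q) * (C0 * e ^+ 4) / Xseq m =
   C0 * e ^+ 4 * radii m.+1 ^+ 2 * (C * (P ^+ 2 * C0 * L / E m * Q)).
  by rewrite /Xseq; field; rewrite !gt_eqF.
rewrite ler_pM2l // !mulr_gt0 ?exprn_gt0 //.
Qed.

(** The growth of Y bounds the sums of [dev] from above and that of 1 / X bounds them from below.
    Both exponents contain the sum twice, hence the half of the smaller rate. *)
Lemma riesz_mean : exists2 eta : R, 0 < eta & exists K : R, forall n m : nat, (n <= m)%N ->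
  `|\sum_(n.+1 <= k < m.+1) dev k| <= (1 / (4 * alpha) - eta) * (m - n)%:R + K.
Proof.
have [DY DY0 HY] := Yseq_sum; have [DX DX0 HX] := Xseq_sum.
have [e1 e10 [K1 H1]] := dominated_sum_decay Yseq_gt0 DY0 HY.
have X0 n : 0 < (Xseq n)^-1 by rewrite invr_gt0 Xseq_gt0.
have [e2 e20 [K2 H2]] := dominated_sum_decay X0 DX0 HX.
have e0 : 0 < Num.min e1 e2 by rewrite lt_min e10.
exists (Num.min e1 e2 / 2); first by rewrite divr_gt0.
exists (`|K1| + `|K2|) => n m nm; rewrite dev_sum ?ltnS //.
set d := \sum_(k < m.+1) _; set d' := \sum_(k < n.+1) _.
have := H1 n.+1 m.+1 nm; rewrite !YseqE -expRD ler_expR -/d -/d' subSS.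
have := H2 n m nm; rewrite !XseqE -!expRN -expRD ler_expR -/d -/d'.
have n0 : 0 <= (m - n)%:R :> R by [].
have k1 := ler_norm K1; have k2 := ler_norm K2.
have k1' := normr_ge0 K1; have k2' := normr_ge0 K2.
have m1 : Num.min e1 e2 * (m - n)%:R <= e1 * (m - n)%:R.
  by rewrite ler_wpM2r // ge_min lexx.
have m2 : Num.min e1 e2 * (m - n)%:R <= e2 * (m - n)%:R.
  by rewrite ler_wpM2r // ge_min lexx orbT.
have mE : m.+1%:R = n.+1%:R + (m - n)%:R :> R by rewrite -natrD addSn subnKC.
have mE' : m.+2%:R = n.+2%:R + (m - n)%:R :> R by rewrite -natrD !addSn subnKC.
rewrite mE mE'; move: (Num.min e1 e2) m1 m2 => e.
move: (m - n)%:R n.+1%:R n.+2%:R => x y z m1 m2 h1 h2.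
have -> : (1 / (4 * alpha) - e / 2) * x = (x / (2 * alpha) - e * x) / 2 by field; rewrite gt_eqF.
rewrite (mulrDl y x) in h1; rewrite (mulrDl z x) in h2.
by rewrite ler_norml; apply/andP; split; lra.
Qed.

End FromRieszBound.

(** * Sufficiency: decay of the inverse sections *)

Section FromSeparation.
Variables (e1 eta Km : R).
Hypothesis e10 : 0 < e1.
Hypothesis separated : forall n k, n != k -> e1 * rho n <= modulus (lambda n - lambda k).
Hypothesis eta0 : 0 < eta.
Hypothesis mean : forall n m, (n <= m)%N ->
  `|\sum_(n <= k < m) dev k| <= (1 / (4 * alpha) - eta) * (m - n)%:R + Km.

Let Mc : R := 2 + 2 * `|ln e1|.
Let Mc0 : 0 <= Mc. Proof. by rewrite addr_ge0 // mulr_ge0. Qed.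

(** For x <= 1/2 the gap 1 - x between the moduli suffices, with exponent 2 x; for x > 1/2
    separation takes over, as 2 x |ln e1| >= |ln e1|. *)
Let expR_le_gap (x : R) : 0 <= x <= 1 -> expR (- (Mc * x)) <= Num.max e1 (1 - x).
Proof.
move=> /andP[x0 x1]; rewrite le_max; apply/orP.
have [xh|hx] := leP x 2^-1.
  right; apply: le_trans (_ : expR (- (2 * x)) <= _).
    by rewrite ler_expR lerN2 ler_wpM2r // /Mc lerDl mulr_ge0.
  have p : 0 < 1 + 2 * x by rewrite ltr_pwDl // mulr_ge0.
  rewrite expRN; apply: le_trans (_ : (1 + 2 * x)^-1 <= _).
    by rewrite lef_pV2 ?posrE ?expR_gt0 // expR_ge1Dx.
  by rewrite -[leLHS]mul1r ler_pdivrMr //; nra.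
left; rewrite -[leRHS](lnK e10) ler_expR /Mc.
have := ler_norm (- ln e1); have := normr_ge0 (ln e1); rewrite normrN; nra.
Qed.

Let gap n k : n != k -> rho k <= rho n ->
  rho n * expR (- (Mc * (rho k / rho n))) <= modulus (lambda n - lambda k).
Proof.
move=> nk kn'; apply: le_trans (ler_wpM2l (modulus_ge0 _) (expR_le_gap _)) _.
  by rewrite divr_ge0 ?modulus_ge0 //= ler_pdivrMr // mul1r.
case: (leP e1 (1 - rho k / rho n)) => _; last by rewrite mulrC separated.
rewrite mulrBr mulr1 mulrC divfK ?gt_eqF //; exact: modulusB_ge.
Qed.

Lemma prod_dist_ge_low n :
  rho n ^+ n * expR (- (Mc * H)) <= \prod_(i < n) modulus (lambda n - lambda i).
Proof.
apply: le_trans (_ : \prod_(i < n) (rho n * expR (- (Mc * (rho i / rho n)))) <= _).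
  rewrite big_split /= prodr_const card_ord ler_wpM2l ?exprn_ge0 ?modulus_ge0 //.
  rewrite -expR_sum ler_expR sumrN lerN2 -mulr_sumr ler_wpM2l //.
  by apply: ratio_sum_low; exact: leqnSn.
apply: ler_prod => i _; rewrite mulr_ge0 ?modulus_ge0 ?expR_ge0 //= gap //.
  by rewrite gtn_eqF.
by rewrite rho_mono // ltnW.
Qed.

Lemma prod_dist_ge_high n K :
  (\prod_(n.+1 <= i < K) rho i) * expR (- (Mc * H)) <=
  \prod_(n.+1 <= i < K) modulus (lambda n - lambda i).
Proof.
apply: le_trans (_ : \prod_(n.+1 <= i < K) (rho i * expR (- (Mc * (rho n / rho i)))) <= _).
  rewrite big_split /= ler_wpM2l //.
    by apply: prodr_ge0 => *; exact: modulus_ge0.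
  by rewrite -expR_sum ler_expR sumrN lerN2 -mulr_sumr ler_wpM2l // ratio_sum_high.
rewrite big_seq [leRHS]big_seq; apply: ler_prod => i; rewrite mem_index_iota => /andP[ni _].
rewrite mulr_ge0 ?modulus_ge0 ?expR_ge0 //= modulusB gap //.
  by rewrite gtn_eqF.
by rewrite rho_mono // ltnW.
Qed.

Let lagP K n : {poly R[i]} := \prod_(i < K | i != n :> nat) ('X - (lambda i)%:P).
Definition lag K n : {poly R[i]} := ((lagP K n).[lambda n]^-1)%:P * lagP K n.

Let lagE K (i : 'I_K) (K0 : (0 < K)%N) : lag K i = tnth (lagrange K lambda) i.
Proof. by rewrite (lagrangeE K0 lambda_inj). Qed.

Lemma lag_sample K n k : (n < K)%N -> (k < K)%N -> (lag K n).[lambda k] = (n == k)%:R.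
Proof.
move=> nK kK; have K0 : (0 < K)%N by apply: leq_trans kK.
by rewrite (lagE (Ordinal nK) K0) (lagrange_sample K0 lambda_inj _ (Ordinal kK)).
Qed.

Lemma lag_interp K m j : (m < K)%N -> (j < K)%N ->
  \sum_(n < K) (lag K n)`_m * lambda n ^+ j = (m == j)%:R.
Proof.
move=> mK jK; have K0 : (0 < K)%N by apply: leq_trans mK.
have := lagrange_gen K0 lambda_inj (p := 'X^j).
rewrite size_polyXn => /(_ jK) /(congr1 (fun p : {poly R[i]} => p`_m)).
rewrite coefXn => ->; rewrite coef_sum; apply: eq_bigr => n _.
by rewrite (lagE n K0) coefCM hornerXn mulrC.
Qed.

Lemma size_lag K n : (n < K)%N -> size (lag K n) = K.
Proof.
move=> nK; have K0 : (0 < K)%N by apply: leq_trans nK.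
by rewrite (lagE (Ordinal nK) K0) size_lagrange_.
Qed.

Let D1 : R := expR (2 * H + 2 * (Mc * H)).

(** The coefficient is bounded by expanding prod (rho_m + rho_i), the evaluation at lambda_n from
    below by separation; the radii of the full section K cancel, which makes the bound uniform in
    K. *)
Lemma coef_lag_le K m n : (m < K)%N -> (n < K)%N ->
  modulus (lag K n)`_m * rho m ^+ m * (rho n ^+ n * radii m.+1 * rho (maxn m n)) <=
  D1 * (rho m ^+ m.+1 * radii n.+1).
Proof.
move=> mK nK; rewrite /lag coefCM modulusM.
have rK := radii_gt0 K; have rm := radii_gt0 m.+1; have rn := radii_gt0 n.+1.
set z := modulus (lagP K n).[lambda n]^-1.
have zE : z = (\prod_(i < K | i != n :> nat) modulus (lambda n - lambda i))^-1.
  rewrite /z modulusV /lagP horner_prod modulus_prod; congr (_^-1).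
  by apply: eq_bigr => i _; rewrite hornerXsubC.
have zle : z * (rho n ^+ n * (radii K / radii n.+1)) <= expR (2 * (Mc * H)).
  have P0 : 0 < \prod_(i < K | i != n :> nat) modulus (lambda n - lambda i).
    apply: prodr_gt0 => i ni; rewrite modulus_gt0 subr_eq0 inj_eq //.
    by rewrite eq_sym.
  rewrite zE mulrC ler_pdivrMr //.
  rewrite (prod_neq_split (fun i => modulus (lambda n - lambda i)) nK).
  have h := ler_pM _ _ (prod_dist_ge_low n) (prod_dist_ge_high n K).
  rewrite -ler_pdivrMl ?expR_gt0 //; apply: le_trans (h _ _).
  - rewrite (radii_split nK) [radii n.+1 * _]mulrC mulfK ?gt_eqF //.
    have -> : expR (2 * (Mc * H)) = expR (Mc * H) * expR (Mc * H).
      by rewrite -expRD; congr expR; ring.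
    rewrite expRN le_eqVlt; apply/orP; left; apply/eqP; field.
    by rewrite gt_eqF ?expR_gt0.
  - by rewrite mulr_ge0 ?exprn_ge0 ?modulus_ge0 ?expR_ge0.
  - by rewrite mulr_ge0 ?expR_ge0 //; apply: prodr_ge0 => *; exact: modulus_ge0.
(* The factor i = n missing from the product is restored through rho_max(m, n) <= rho_m + rho_n. *)
have cle : modulus (lagP K n)`_m * rho m ^+ m * rho (maxn m n) <=
    rho m ^+ m.+1 * (radii K / radii m.+1) * expR (2 * H).
  apply: le_trans (_ : \prod_(i < K | i != n :> nat) (rho m + rho i) * (rho m + rho n) <= _).
    apply: ler_pM; rewrite ?modulus_ge0 ?mulr_ge0 ?exprn_ge0 ?modulus_ge0 //.
      exact: coef_prod_XsubC_le (modulus_ge0 _).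
    by case: (leqP m n) => _; rewrite ?lerDl ?lerDr modulus_ge0.
  have -> : \prod_(i < K | i != n :> nat) (rho m + rho i) * (rho m + rho n) = \prod_(i < K) (rho m + rho i).
    by rewrite [RHS](bigD1 (Ordinal nK)) //= mulrC.
  rewrite -(big_mkord xpredT (fun i => rho m + rho i)) (big_cat_nat (leq0n m.+1) mK) /=.
  rewrite (radii_split mK) [radii m.+1 * _]mulrC mulfK ?gt_eqF //.
  have -> : expR (2 * H) = expR H * expR H by rewrite -expRD; congr expR; ring.
  rewrite mulrACA; apply: ler_pM.
  - by apply: prodr_ge0 => *; rewrite addr_ge0 ?modulus_ge0.
  - by apply: prodr_ge0 => *; rewrite addr_ge0 ?modulus_ge0.
  - rewrite big_mkord; apply: le_trans (_ : \prod_(i < m.+1) (rho m * (1 + rho i / rho m)) <= _).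
      apply: ler_prod => i _; rewrite addr_ge0 ?modulus_ge0 //=.
      by rewrite mulrDr mulr1 mulrC divfK ?gt_eqF.
    rewrite big_split /= prodr_const card_ord ler_wpM2l ?exprn_ge0 ?modulus_ge0 //.
    apply: le_trans (prod_oneD_le _ _ _) _; first by move=> i; rewrite divr_ge0 ?modulus_ge0.
    by rewrite ler_expR ratio_sum_low.
  apply: le_trans (_ : \prod_(m.+1 <= i < K) (rho i * (1 + rho m / rho i)) <= _).
    apply: ler_prod => i _; rewrite addr_ge0 ?modulus_ge0 //=.
    by rewrite mulrDr mulr1 [_ * (_ / _)]mulrC divfK ?gt_eqF // addrC.
  rewrite big_split /= ler_wpM2l //.
    by apply: prodr_ge0 => *; exact: modulus_ge0.
  apply: le_trans (prod_oneD_le _ _ _) _; first by move=> i; rewrite divr_ge0 ?modulus_ge0.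
  by rewrite ler_expR ratio_sum_high.
have z0 : 0 <= z by exact: modulus_ge0.
have := ler_pM _ _ zle cle; rewrite !mulr_ge0 ?exprn_ge0 ?modulus_ge0 ?invr_ge0 ?(ltW rK) ?(ltW rn) //.
move=> /(_ isT isT) h.
have f0 : 0 <= radii n.+1 * radii m.+1 / radii K by rewrite ltW // divr_gt0 ?mulr_gt0.
have := ler_wpM2l f0 h; congr (_ <= _).
  by field; rewrite !gt_eqF.
by rewrite /D1 expRD; field; rewrite !gt_eqF.
Qed.
Let Xdecay n m : (n <= m)%N ->
  Xseq m <= expR (2 * Km - 2 * eta * (m - n)%:R) * Xseq n.
Proof.
move=> nm; rewrite !XseqE -expRD ler_expR.
have := mean (_ : n.+1 <= m.+1)%N; rewrite ltnS => /(_ nm); rewrite dev_sum ?ltnS // subSS.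
rewrite ler_norml => /andP[h _]; move: h.
set d := \sum_(k < m.+1) _; set d' := \sum_(k < n.+1) _.
have -> : m.+1%:R = n.+1%:R + (m - n)%:R :> R by rewrite -natrD addSn subnKC.
move: (m - n)%:R n.+1%:R => x y.
have -> : (1 / (4 * alpha) - eta) * x = (x / (2 * alpha)) / 2 - eta * x by field; rewrite gt_eqF.
by rewrite (mulrDl y x); lra.
Qed.

Let Ydecay n m : (n <= m)%N ->
  Yseq n <= expR (2 * Km - 2 * eta * (m - n)%:R) * Yseq m.
Proof.
move=> nm; rewrite !YseqE -expRD ler_expR.
have := mean nm; rewrite dev_sum //.
rewrite ler_norml => /andP[_ h]; move: h.
set d := \sum_(k < m) _; set d' := \sum_(k < n) _.
have -> : m.+1%:R = n.+1%:R + (m - n)%:R :> R by rewrite -natrD addSn subnKC.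
move: (m - n)%:R n.+1%:R => x y.
have -> : (1 / (4 * alpha) - eta) * x = (x / (2 * alpha)) / 2 - eta * x by field; rewrite gt_eqF.
by rewrite (mulrDl y x); lra.
Qed.

Definition inv_kmatrix K m n : R[i] :=
  (((lag K n)`_m)^* * (Num.sqrt (c m) * kn n)%:C)%R.

Let KN : R := C0 * loss alpha S * (2 / (1 - expR (-1))).
Let KN0 : 0 < KN.
Proof.
by rewrite !mulr_gt0 ?expR_gt0 // invr_gt0 subr_gt0 expR_lt1 oppr_lt0 ltr01.
Qed.

Let kn2_le n : kn n ^+ 2 <= KN * w n n.
Proof. exact: (kn_weight_le alpha0 C0_gt0 c_gauss rho_gt0 kn_le S0 (lev1 n) (lev2 n)). Qed.

Lemma inv_kmatrix_le K m n : (m < K)%N -> (n < K)%N ->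
  modulus (inv_kmatrix K m n) ^+ 2 <=
  C0 * KN * D1 ^+ 2 * expR (2 * Km - 2 * eta * (ndist m n)%:R).
Proof.
move=> mK nK; have coef := coef_lag_le mK nK.
rewrite /inv_kmatrix modulusM modulusJ modulus_real exprMn.
rewrite real_normK ?num_real // [(Num.sqrt _ * _) ^+ 2]exprMn sqr_sqrtr ?(ltW (c_pos m)) //.
set x := modulus _ in coef *; have x0 : 0 <= x by exact: modulus_ge0.
have rm := radii_gt0 m.+1; have rn := radii_gt0 n.+1.
have rmn := rho_gt0 (maxn m n).
have pm : 0 < rho m ^+ m by rewrite exprn_gt0.
have pn : 0 < rho n ^+ n by rewrite exprn_gt0.
have D0 : 0 < D1 := expR_gt0 _.
have xle : x * (rho n ^+ n * radii m.+1 * rho (maxn m n)) <= D1 * (rho m * radii n.+1).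
  rewrite -(ler_pM2r pm); apply: le_trans (_ : D1 * (rho m ^+ m.+1 * radii n.+1) <= _).
    by apply: le_trans coef; rewrite le_eqVlt; apply/orP; left; apply/eqP; ring.
  by rewrite exprS le_eqVlt; apply/orP; left; apply/eqP; ring.
clear coef; have q0 : 0 < rho n ^+ n * radii m.+1 * rho (maxn m n) by rewrite !mulr_gt0.
have x2le : x ^+ 2 * (rho n ^+ n * radii m.+1 * rho (maxn m n)) ^+ 2 <= D1 ^+ 2 * (rho m * radii n.+1) ^+ 2.
  rewrite -!exprMn ler_sqr ?nnegrE ?mulr_ge0 ?(ltW D0) ?modulus_ge0 ?(ltW rn) ?(ltW pn) ?(ltW rm) //.
have h1 : c m * kn n ^+ 2 <= C0 * KN * (E m * w n n).
  have /andP[_ cm] := c_gauss m.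
  have -> : C0 * KN * (E m * w n n) = (C0 * E m) * (KN * w n n) by ring.
  by apply: ler_pM (kn2_le n) => //; [exact: ltW | exact: sqr_ge0].
apply: le_trans (ler_wpM2l (sqr_ge0 x) h1) _.
have h2 : x ^+ 2 * (E m * w n n) <= D1 ^+ 2 * ((rho m / rho (maxn m n)) ^+ 2 * (Xseq m / Xseq n)).
  have f0 : 0 < E m / E n / (radii m.+1 * rho (maxn m n)) ^+ 2.
    by rewrite !divr_gt0 ?exprn_gt0 ?mulr_gt0.
  have := ler_wpM2l (ltW f0) x2le; rewrite /Xseq /weight; congr (_ <= _).
    by field; rewrite !gt_eqF.
  by field; rewrite !gt_eqF.
have -> : x ^+ 2 * (C0 * KN * (E m * w n n)) = C0 * KN * (x ^+ 2 * (E m * w n n)) by ring.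
rewrite -[C0 * KN * _ * _]mulrA ler_pM2l ?mulr_gt0 //; apply: le_trans h2 _.
rewrite ler_pM2l ?exprn_gt0 //.
(* For m <= n the factor (rho_m / rho_n)^2 turns the ratio of X into that of Y; for m >= n it is
   1. *)
have [mn|/ltnW nm] := leqP m n.
  have -> : (rho m / rho n) ^+ 2 * (Xseq m / Xseq n) = Yseq m / Yseq n.
    rewrite /Xseq /Yseq /radii !big_ord_recr /= -!/(radii _).
    by field; rewrite !gt_eqF ?radii_gt0.
  by rewrite ler_pdivrMr ?Yseq_gt0 // ndist_le // Ydecay.
have -> : (rho m / rho m) ^+ 2 * (Xseq m / Xseq n) = Xseq m / Xseq n.
  by rewrite divff ?gt_eqF // expr1n mul1r.
by rewrite ler_pdivrMr ?Xseq_gt0 // ndist_ge // Xdecay.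
Qed.

Let sE (r : R) : 0 < r -> r%:C != 0 :> R[i].
Proof. by move=> r0; rewrite -[0]/(0%:C) (inj_eq (@complexI R)) gt_eqF. Qed.

(** Up to diagonal scalings and conjugation this is exactness of interpolation on X^j; the product
    in the other order is evaluation of the Lagrange polynomials at the nodes. *)
Lemma mul_inv_kmatrix K m j : (m < K)%N -> (j < K)%N ->
  \sum_(n < K) inv_kmatrix K m n * V n j = (m == j)%:R.
Proof.
move=> mK jK; have sm := sE (etrans (sqrtr_gt0 _) (c_pos m)).
have sj := sE (etrans (sqrtr_gt0 _) (c_pos j)).
have -> : (m == j)%:R = (Num.sqrt (c m))%:C / (Num.sqrt (c j))%:C * ((m == j)%:R)^*%R :> R[i].
  by case: eqP => [->|_]; rewrite ?conjC1 ?conjC0 ?mulr0 // divff ?mulr1.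
rewrite -(lag_interp mK jK) cJ_sum mulr_sumr; apply: eq_bigr => n _.
have kn' := sE (kn_gt0 n).
by rewrite /inv_kmatrix /kmatrix cJM cJX !rmorphM /=; field; rewrite sj kn'.
Qed.

Lemma mul_kmatrix_inv K n k : (n < K)%N -> (k < K)%N ->
  \sum_(m < K) V n m * inv_kmatrix K m k = (n == k)%:R.
Proof.
move=> nK kK; have kk := sE (kn_gt0 k); have kn' := sE (kn_gt0 n).
have -> : (n == k)%:R = (kn k)%:C / (kn n)%:C * ((k == n)%:R)^*%R :> R[i].
  by rewrite eq_sym; case: eqP => [->|_]; rewrite ?conjC1 ?conjC0 ?mulr0 // divff ?mulr1.
rewrite -(lag_sample kK nK) horner_coef size_lag // cJ_sum mulr_sumr.
apply: eq_bigr => m _; have sm := sE (etrans (sqrtr_gt0 _) (c_pos m)).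
by rewrite /inv_kmatrix /kmatrix cJM cJX !rmorphM /=; field; rewrite sm kn'.
Qed.

Lemma separated_mean_riesz : exists2 C : R, 0 < C & l2riesz V C.
Proof.
(* The entries of V decay like exp(-k) and those of the inverse like exp(- eta k); t^2 = exp(- 2 b)
   has to dominate both. *)
pose b := Num.min (2^-1) (eta / 2).
have b0 : 0 < b by rewrite lt_min invr_gt0 ltr0n divr_gt0.
have b1 : b <= 2^-1 by rewrite ge_min lexx.
have b2 : b <= eta / 2 by rewrite ge_min lexx orbT.
pose t := expR (- b).
have t01 : 0 < t < 1 by rewrite expR_gt0 expR_lt1 oppr_lt0.
have tE k : (t ^+ 2) ^+ k = expR (- (2 * b * k%:R)).
  by rewrite -exprM /t -expRM_natl natrM; congr expR; ring.
pose D2 := C0 * KN * D1 ^+ 2 * expR (2 * Km).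
have D20 : 0 < D2 by rewrite /D2 mulr_gt0 ?expR_gt0 // mulr_gt0 ?exprn_gt0 ?expR_gt0 // mulr_gt0.
apply: (@l2riesz_of_inverse R V inv_kmatrix t A (Num.sqrt D2) t01 A0).
- by rewrite sqrtr_gt0.
- move=> n m; apply: le_trans (V_le n m) _; rewrite ler_pM2l // tE -expRM_natl ler_expR.
  have k0 : 0 <= (ndist m n)%:R :> R by []; have := ler_wpM2r k0 b1; lra.
- move=> K m n mK nK; rewrite -ler_sqr ?nnegrE ?modulus_ge0 ?mulr_ge0 ?sqrtr_ge0 ?tE ?expR_ge0 //.
  apply: le_trans (inv_kmatrix_le mK nK) _.
  rewrite [leRHS]exprMn sqr_sqrtr ?(ltW D20) // /D2 -[leRHS]mulrA ler_pM2l; last first.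
    by rewrite mulr_gt0 ?exprn_gt0 ?expR_gt0 // mulr_gt0.
  rewrite -expRM_natl -expRD ler_expR.
  have k0 : 0 <= (ndist m n)%:R :> R by []; have := ler_wpM2r k0 b2; lra.
- by move=> *; exact: mul_inv_kmatrix.
- by move=> *; exact: mul_kmatrix_inv.
Qed.

End FromSeparation.
End NearLattice.

(** * From the Fock space to square-summable sequences *)

Section RieszBasisCoefficients.
Context {R : realType}.
Local Notation P := (measurableTypeR R * measurableTypeR R)%type.
Variable phi : R[i] -> R.
Hypothesis phi_rot : forall u z, modulus u = 1 -> phi (u * z) = phi z.
Hypothesis phi_meas : measurable_fun [set: P] (fun p : P => expR (- (2 * phi (cplx p)))).
Hypothesis moment_fin : forall m, (moment phi m < +oo)%E.
Local Notation c := (cmoment phi).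
Hypothesis c_gt0 : forall m, 0 < c m.
Hypothesis c_growth : forall r : R, 0 < r -> exists M : R, forall m, r ^+ m / c m <= M.
Variable lambda : nat -> R[i].
Hypothesis lambda_inj : injective lambda.
Local Notation kn n := (kernel_norm phi (lambda n)).
Local Notation V := (kmatrix c (fun n => kn n) lambda).
Local Notation nker := (normalized_kernel phi).

Let s m : R[i] := (Num.sqrt (c m))%:C.

Let s_neq0 m : s m != 0.
Proof. by rewrite /s -[0]/(0%:C) (inj_eq (@complexI R)) gt_eqF // sqrtr_gt0. Qed.

Let ss m : s m * s m = (c m)%:C.
Proof. by rewrite /s -rmorphM /= -expr2 sqr_sqrtr // ltW. Qed.

Let modulus_s x m : modulus (s m * x) ^+ 2 = modulus x ^+ 2 * c m.
Proof.
by rewrite modulusM modulus_real ger0_norm ?sqrtr_ge0 // exprMn sqr_sqrtr ?(ltW (c_gt0 m)) // mulrC.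
Qed.

Let normC_neq0 l : (kernel_norm phi l)%:C != 0 :> R[i].
Proof.
rewrite -[0]/(0%:C) (inj_eq (@complexI R)) gt_eqF //.
exact: kernel_norm_gt0 phi_rot phi_meas moment_fin c_gt0 c_growth l.
Qed.

Let nker_coef l m : R[i] := (kernel_norm phi l)%:C^-1 * kernel_coef phi l m.

Let nker_expansion l : expansion (nker l) (nker_coef l).
Proof.
have := expansionZ (kernel_norm phi l)%:C^-1
  (repr_kernel_expansion phi_rot phi_meas moment_fin c_gt0 c_growth l).
by congr expansion; apply/funext => z; rewrite /normalized_kernel mulrC.
Qed.

Let s_nker_coef n m : s m * nker_coef (lambda n) m = V n m.
Proof.
have := s_neq0 m; have := normC_neq0 (lambda n); have cs := ss m.
rewrite /nker_coef /kernel_coef /kmatrix -cs rmorphM /= -/(s m) => h1 h2.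
by field; rewrite h1 h2.
Qed.

Let lin_comb_expansion S (a : R[i] -> R[i]) :
  expansion (lin_comb nker S a) (fun m => \sum_(l <- S) a l * nker_coef l m).
Proof.
elim: S => [|l S IH].
  have := expansionZ 0 (nker_expansion 0); congr expansion.
    by apply/funext => z; rewrite /lin_comb big_nil mul0r.
  by apply/funext => m; rewrite big_nil mul0r.
have := expansionD (expansionZ (a l) (nker_expansion l)) IH; congr expansion.
  by apply/funext => z; rewrite /lin_comb big_cons.
by apply/funext => m; rewrite big_cons.
Qed.

Let sqnorm_le f a B : expansion f a -> l2ub (fun m => s m * a m) B ->
  (fock_sqnorm phi f <= B%:E)%E.
Proof.
move=> fa HB; apply: (fock_sqnorm_le phi_rot phi_meas moment_fin fa) => K.
by apply: le_trans (HB K); apply: ler_sum => m _; rewrite modulus_s.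
Qed.

Let sqnorm_l2ub f a B : expansion f a -> (fock_sqnorm phi f <= B%:E)%E ->
  l2ub (fun m => s m * a m) B.
Proof.
move=> fa HB K; rewrite -lee_fin; apply: le_trans HB.
apply: le_trans (fock_sqnorm_ge phi_rot phi_meas moment_fin K fa).
by rewrite lee_fin; apply: ler_sum => m _; rewrite modulus_s.
Qed.

(** One initial segment of indices serves for all targets T, so that coefficients and squared moduli
    are reindexed consistently. *)
Let family_index S : finite_in (range lambda) S -> exists K, forall (T : nmodType) (F : R[i] -> T),
  \sum_(l <- S) F l = \sum_(n < K | lambda n \in S) F (lambda n).
Proof.
move=> [uS rS].
have [K HK] : exists K, forall l, l \in S -> exists2 n, (n < K)%N & lambda n = l.
  elim: S {uS} rS => [|l S IH] rS; first by exists 0%N.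
  have [n _ nl] := rS l (mem_head l S).
  have [|K HK] := IH; first by move=> x xS; apply: rS; rewrite inE xS orbT.
  exists (maxn n.+1 K) => x; rewrite inE => /orP[/eqP ->|/HK [k kK <-]].
    by exists n => //; rewrite leq_max leqnn.
  by exists k => //; rewrite leq_max kK orbT.
exists K => T F.
rewrite -(big_mkord (fun n => lambda n \in S) (fun n => F (lambda n))) -big_filter.
rewrite -(big_map lambda xpredT F); apply: perm_big; apply: uniq_perm => //.
  by rewrite map_inj_uniq // filter_uniq // iota_uniq.
move=> l; apply/idP/mapP => [lS|[n + ->]]; last by rewrite mem_filter => /andP[].
have [n nK nl] := HK l lS; exists n => //.
by rewrite mem_filter nl lS mem_index_iota.
Qed.

Let from_family S a : finite_in (range lambda) S -> exists K (b : nat -> R[i]),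
  (\sum_(l <- S) modulus (a l) ^+ 2 = \sum_(n < K) modulus (b n) ^+ 2) /\
  forall m, s m * (\sum_(l <- S) a l * nker_coef l m) = comb V b K m.
Proof.
move=> /family_index [K HK]; exists K, (fun n => if lambda n \in S then a (lambda n) else 0).
split=> [|m].
  rewrite HK big_mkcond /=; apply: eq_bigr => n _; case: ifP => // _.
  by rewrite modulus0 expr0n.
rewrite HK big_mkcond mulr_sumr /=; apply: eq_bigr => n _; rewrite -s_nker_coef.
by case: ifP => _; rewrite ?mulr0 ?mul0r // mulrCA.
Qed.

Let to_family K (b : nat -> R[i]) : exists S a, [/\ finite_in (range lambda) S,
  (\sum_(l <- S) modulus (a l) ^+ 2 = \sum_(n < K) modulus (b n) ^+ 2) &
  forall m, s m * (\sum_(l <- S) a l * nker_coef l m) = comb V b K m].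
Proof.
(* By injectivity the sum has at most one term, and it is 0 away from the points used. *)
pose a l := \sum_(n < K | lambda n == l) b n.
have aE n : (n < K)%N -> a (lambda n) = b n.
  move=> nK; rewrite /a (bigD1 (Ordinal nK)) //= big1 ?addr0 // => k.
  by rewrite inj_eq // => /andP[/eqP kE]; rewrite -val_eqE /= kE eqxx.
have sumE (T : nmodType) (F : R[i] -> T) :
    \sum_(l <- map lambda (iota 0 K)) F l = \sum_(n < K) F (lambda n).
  by rewrite big_map -(big_mkord xpredT (fun n => F (lambda n))) /index_iota subn0.
exists (map lambda (iota 0 K)), a; split.
- split; first by rewrite map_inj_uniq ?iota_uniq.
  by move=> l /mapP [n _ ->]; exists n.
- by rewrite sumE; apply: eq_bigr => n _; rewrite aE.
- move=> m; rewrite sumE mulr_sumr; apply: eq_bigr => n _.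
  by rewrite aE // mulrCA s_nker_coef.
Qed.

Let diff_expansion f a S b : expansion f a ->
  expansion (fun w => f w - lin_comb nker S b w) (fun m => a m - \sum_(l <- S) b l * nker_coef l m).
Proof.
move=> fa; have := expansionD fa (expansionZ (-1) (lin_comb_expansion S b)).
by congr expansion; apply/funext => z; rewrite mulN1r.
Qed.

Let rapid (x : nat -> R[i]) B : l2ub x B -> exists f, expansion f (fun m => x m / s m).
Proof.
move=> HB; apply: expansion_exists => r r0.
have [M HM] := c_growth (exprn_gt0 2 r0).
have M0 : 0 <= M.
  by apply: le_trans (HM 0%N); rewrite expr0 divr_ge0 // ltW.
exists (Num.sqrt B * Num.sqrt M) => m.
have B0 := l2ub_ge0 HB.
rewrite modulus_div modulus_real ger0_norm ?sqrtr_ge0 // -mulrA; apply: ler_pM.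
- exact: modulus_ge0.
- by rewrite mulr_ge0 ?invr_ge0 ?sqrtr_ge0 ?exprn_ge0 // ltW.
- rewrite -ler_sqr ?nnegrE ?modulus_ge0 ?sqrtr_ge0 // sqr_sqrtr //.
  apply: le_trans (HB m.+1); rewrite big_ord_recr /= lerDr.
  by apply: sumr_ge0 => *; exact: sqr_ge0.
- rewrite -ler_sqr ?nnegrE ?sqrtr_ge0 //; last first.
    by rewrite mulr_ge0 ?invr_ge0 ?sqrtr_ge0 ?exprn_ge0 // ltW.
  rewrite sqr_sqrtr // exprMn exprVn sqr_sqrtr ?(ltW (c_gt0 m)) // mulrC.
  by rewrite -exprM mulnC exprM.
Qed.

(** Sending f to the sequence sqrt(c_m) a_m is an isometry onto l^2 that maps the normalized kernel
    at lambda_n to row n; surjectivity is [rapid]. *)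
Lemma riesz_basis_l2riesz : riesz_basis phi (range lambda) nker <->
  exists2 C : R, 0 < C & l2riesz V C.
Proof.
split.
  move=> [_ [dense [C C0 bounds]]]; exists C => //; split.
  - move=> K b; have [S [a [fS <- E]]] := to_family K b; have [_ up] := bounds S a fS.
    by have := sqnorm_l2ub (lin_comb_expansion S a) up; congr l2ub; apply/funext => m; rewrite E.
  - move=> K b B HB; have [S [a [fS <- E]]] := to_family K b; have [lo _] := bounds S a fS.
    rewrite -ler_pdivrMl // -lee_fin; apply: le_trans lo _.
    apply: (sqnorm_le (lin_comb_expansion S a)).
    by have := HB; congr l2ub; apply/funext => m; rewrite E.
  - move=> x B HB e e0; have [f fx] := rapid HB.
    have sx m : s m * (x m / s m) = x m by rewrite mulrC divfK.
    have Ff : fock_space phi f.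
      apply: (fock_space_expansion phi_rot phi_meas moment_fin fx (B := B)) => K.
      apply: le_trans (HB K); apply: ler_sum => m _; by rewrite -{2}(sx m) modulus_s.
    have se : 0 < Num.sqrt e by rewrite sqrtr_gt0.
    have [S [a [fS]]] := dense f Ff _ se; rewrite sqr_sqrtr ?(ltW e0) // => /ltW He.
    have [K [b [_ E]]] := from_family a fS; exists K, b.
    have := sqnorm_l2ub (diff_expansion S a fx) He.
    by congr l2ub; apply/funext => m; rewrite mulrBr sx E.
move=> [C C0 [up lo dense]]; split=> [l _|].
  have [E _] := repr_kernel_reproduces phi_rot phi_meas moment_fin c_gt0 c_growth l.
  have := fock_spaceZ phi_rot phi_meas moment_fin (kernel_norm phi l)%:C^-1 E.
  by congr (fock_space _ _); apply/funext => z; rewrite /normalized_kernel mulrC.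
split.
  move=> f Ff e e0; have [a fa] := entire_expansion Ff.1.
  have Ffin : fock_sqnorm phi f = (fine (fock_sqnorm phi f))%:E.
    by rewrite fineK // ge0_fin_numE ?fock_sqnorm_ge0 //; case: Ff.
  have HB : l2ub (fun m => s m * a m) (fine (fock_sqnorm phi f)).
    by apply: (sqnorm_l2ub fa); rewrite -Ffin.
  have e2 : 0 < e ^+ 2 / 2 by rewrite divr_gt0 ?exprn_gt0.
  have [K [b Hb]] := dense _ _ HB _ e2.
  have [S [a' [fS _ E]]] := to_family K b; exists S, a'; split=> //.
  apply: le_lt_trans (_ : _ <= (e ^+ 2 / 2)%:E)%E _.
    apply: (sqnorm_le (diff_expansion S a' fa)).
    by have := Hb; congr l2ub; apply/funext => m; rewrite mulrBr E.
  by rewrite lte_fin ltr_pdivrMr // ltr_pMr ?exprn_gt0 // ltr1n.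
exists C => // S a fS; have [K [b [-> E]]] := from_family a fS.
have upS : (fock_sqnorm phi (lin_comb nker S a) <= (C * \sum_(n < K) modulus (b n) ^+ 2)%:E)%E.
  apply: (sqnorm_le (lin_comb_expansion S a)).
  by have := up K b; congr l2ub; apply/funext => m; rewrite E.
split=> //.
have fin : fock_sqnorm phi (lin_comb nker S a) = (fine (fock_sqnorm phi (lin_comb nker S a)))%:E.
  by rewrite fineK // ge0_fin_numE ?fock_sqnorm_ge0 // (le_lt_trans upS) // ltry.
rewrite fin lee_fin ler_pdivrMl //; apply: lo.
have : (fock_sqnorm phi (lin_comb nker S a) <= (fine (fock_sqnorm phi (lin_comb nker S a)))%:E)%E.
  by rewrite -fin.
by move=> /(sqnorm_l2ub (lin_comb_expansion S a)); congr l2ub; apply/funext => m; rewrite E.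
Qed.

End RieszBasisCoefficients.

(** * From block averages to sums over arbitrary intervals *)

Section Averages.
Context {R : realType}.

(** The interval is cut into blocks of length N. An incomplete last block costs N B, and one more B
    pays for the index 0, which no block contains because blocks start at n + 1. *)
Lemma block_mean_sum (delta : nat -> R) (N : nat) (d B : R) : (0 < N)%N -> 0 < d ->
  (forall k, `|delta k| <= B) ->
  (forall n, `|\sum_(n.+1 <= k < (n + N).+1) delta k| <= N%:R * d) ->
  forall n m, (n <= m)%N ->
    `|\sum_(n <= k < m) delta k| <= d * (m - n)%:R + (N.+1%:R * B).
Proof.
move=> N0 d0 HB HN.
have B0 : 0 <= B by apply: le_trans (HB 0%N); exact: normr_ge0.
have short n L : `|\sum_(n <= k < n + L) delta k| <= L%:R * B.
  apply: le_trans (ler_norm_sum _ _ _) _.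
  apply: le_trans (ler_sum _ (fun k _ => HB k)) _.
  by rewrite sumr_const_nat addKn mulr_natl.
have from1 L : forall n, `|\sum_(n.+1 <= k < n.+1 + L) delta k| <= d * L%:R + N%:R * B.
  elim/ltn_ind: L => L IH n.
  have [LN|NL] := ltnP L N.
    apply: le_trans (short _ _) _; apply: ler_wpDl; first by rewrite mulr_ge0 // ltW.
    by rewrite ler_wpM2r // ler_nat ltnW.
  rewrite (@big_cat_nat _ _ _ (n + N).+1) /=; last 2 first.
  - by rewrite ltnS leq_addr.
  - by rewrite -addSn leq_add2l.
  apply: le_trans (ler_normD _ _) _.
  have h1 := HN n; have := IH (L - N)%N _ (n + N)%N; rewrite ltn_subrL N0 (leq_trans N0 NL).
  move=> /(_ isT); rewrite addSn -addnA subnKC // -addSn natrB // => h2.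
  apply: le_trans (lerD h1 h2) _; lra.
move=> n m nm; case: n nm => [|n] nm; last first.
  have := from1 (m - n.+1)%N n; rewrite subnKC // => h; apply: le_trans h _.
  by rewrite lerD2l ler_wpM2r // ler_nat.
case: m nm => [|m] _; first by rewrite big_geq // normr0 subn0 mulr0 add0r mulr_ge0.
rewrite big_ltn // subn0; apply: le_trans (ler_normD _ _) _.
have := from1 m 0%N; rewrite add1n => h; apply: le_trans (lerD (HB 0%N) h) _.
by rewrite -!natr1; lra.
Qed.

End Averages.

(** * Growth and separation for the logarithmic weight *)

Section LogWeight.
Context {R : realType}.
Variable alpha : R.
Hypothesis alpha0 : 0 < alpha.
Local Notation c := (cmoment (log_weight alpha)).

Lemma cmoment_log_growth (r : R) : 0 < r -> exists M : R, forall m, r ^+ m / c m <= M.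
Proof.
move=> r0; have [C C0 HC] := cmoment_bounds alpha0.
(* alpha (ln r)^2 / 2 is the maximum over m of m ln r - m^2 / (2 alpha). *)
exists (C * expR (alpha * ln r ^+ 2 / 2)) => m.
have /andP[cm _] := HC m.
have g0 : 0 < gauss alpha m := expR_gt0 _.
have c0 : 0 < c m by apply: lt_le_trans cm; rewrite mulr_gt0 ?invr_gt0.
rewrite ler_pdivrMr //.
have e0 : 0 <= C * expR (alpha * ln r ^+ 2 / 2) by rewrite mulr_ge0 ?expR_ge0 // ltW.
apply: le_trans (ler_wpM2l e0 cm).
have -> : C * expR (alpha * ln r ^+ 2 / 2) * (C^-1 * gauss alpha m) =
    expR (alpha * ln r ^+ 2 / 2) * gauss alpha m by field; rewrite gt_eqF.
rewrite -{1}(lnK (x := r)) ?posrE // -expRM_natl -expRD ler_expR.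
set l := ln r; rewrite -[m.+1%:R]natr1.
have m0 : 0 <= m%:R :> R by [].
have h1 : 0 <= (alpha * l - m%:R) ^+ 2 / (2 * alpha).
  by rewrite divr_ge0 ?sqr_ge0 // mulr_ge0 // ltW.
have h2 : 0 <= (2 * m%:R + 1) / (2 * alpha).
  by rewrite divr_ge0 ?addr_ge0 ?mulr_ge0 // ltW.
rewrite -subr_ge0.
have -> : alpha * l ^+ 2 / 2 + (m%:R + 1) ^+ 2 / (2 * alpha) - m%:R * l =
  (alpha * l - m%:R) ^+ 2 / (2 * alpha) + (2 * m%:R + 1) / (2 * alpha).
  by field; rewrite gt_eqF.
exact: addr_ge0.
Qed.

(** The constant added to the minimum is harmless as all moduli are at least |lambda_0| > 0. The
    minimum may be replaced by |lambda_n| because points of very different moduli are far apart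
    anyway. *)
Lemma d_rho_separatedP (lambda : nat -> R[i]) : injective lambda ->
  (forall n, 0 < modulus (lambda n)) ->
  {homo (fun n => modulus (lambda n)) : m n / (m <= n)%N >-> m <= n} ->
  d_rho_separated alpha (range lambda) <->
  exists2 e : R, 0 < e & forall n k, n != k ->
    e * modulus (lambda n) <= modulus (lambda n - lambda k).
Proof.
move=> inj rho0 mono.
pose a := Num.sqrt (2 * alpha).
have a0 : 0 < a by rewrite sqrtr_gt0 mulr_gt0.
split.
  rewrite /d_rho_separated; set A := [set _ | _] => inf0.
  have [e e0 He] : exists2 e : R, 0 < e & (e%:E <= ereal_inf A)%E.
    case: (ereal_inf A) inf0 => [r r0|_|//]; first by exists r; rewrite -?lte_fin.
    by exists 1 => //; rewrite leey.
  have sep n k : n != k -> e / a * Num.min (modulus (lambda n)) (modulus (lambda k)) <= modulus (lambda n - lambda k).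
    move=> nk; have : (e%:E <= (d_rho alpha (lambda n) (lambda k))%:E)%E.
      apply: le_trans He _; apply: ereal_inf_lbound; exists (lambda n), (lambda k); split=> //.
      by rewrite inj_eq.
    rewrite lee_fin /d_rho -/a; set mn := Num.min _ _.
    have mn0 : 0 < mn by rewrite lt_min !rho0.
    rewrite ler_pdivlMr ?addr_gt0 // => h.
    rewrite mulrAC ler_pdivrMr // [leRHS]mulrC; apply: le_trans h.
    by rewrite ler_pM2l // lerDr ltW.
  have q0 : 0 < e / a by rewrite divr_gt0.
  move: (e / a) q0 sep => q q0 sep; have q1 : 0 < 1 + q by rewrite addr_gt0.
  (* Adding q times |lambda_n| - |lambda_k| <= |lambda_n - lambda_k| to q |lambda_k| <= |lambda_n -
     lambda_k| gives q |lambda_n| <= (1 + q) |lambda_n - lambda_k|. *)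
  exists (q / (1 + q)); first by rewrite divr_gt0.
  move=> n k nk; have := sep n k nk.
  rewrite [leLHS in _ -> leLHS <= _]mulrAC ler_pdivrMr // => h.
  have z0 := modulus_ge0 (lambda n - lambda k).
  have h1 := ler_wpM2l (ltW q0) (modulusB_ge (lambda n) (lambda k)).
  have h2 : 0 <= q * modulus (lambda n - lambda k) by rewrite mulr_ge0 // ltW.
  move: h; rewrite minElt mulrBr in h1 *; case: ifP => _; move: h1 h2 z0;
  by move: (modulus _) (modulus _) (modulus _) => x y z; lra.
move=> [e e0 sep]; pose r0 := modulus (lambda 0%N).
(* The function s / (a + s) is increasing, and the minimum of two moduli is at least r0. *)
have p0 : 0 < a * e * r0 / (a + r0).
  by rewrite divr_gt0 ?addr_gt0 ?mulr_gt0 ?rho0.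
apply: lt_le_trans (_ : (a * e * r0 / (a + r0))%:E <= _)%E; first by rewrite lte_fin.
apply: le_ereal_inf_tmp => _ [_ [_ [[n _ <-] [k _ <-] nk ->]]].
have nk' : n != k by apply: contra nk => /eqP ->.
rewrite lee_fin /d_rho -/a; set mn := Num.min _ _.
have r00 : 0 < r0 := rho0 0%N.
have mn0 : r0 <= mn by rewrite le_min !mono.
have mnp : 0 < mn by apply: lt_le_trans mn0.
have h : e * mn <= modulus (lambda n - lambda k).
  by apply: le_trans (sep n k nk'); rewrite ler_pM2l // ge_min lexx.
move: (modulus (lambda n - lambda k)) h => x h; clear sep; clearbody a r0 mn.
have amn : 0 < a + mn by rewrite addr_gt0.
have ar0 : 0 < a + r0 by rewrite addr_gt0.
rewrite ler_pdivrMr // [leRHS]mulrAC ler_pdivlMr //.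
have h' : a * (e * mn) <= a * x by rewrite ler_pM2l.
apply: le_trans (ler_wpM2r (ltW ar0) h').
have aea : 0 <= a * e * a by rewrite !mulr_ge0 // ltW.
have := ler_wpM2l aea mn0; nra.
Qed.

End LogWeight.

Theorem theorem1p1 (R : realType) (alpha : R) (halpha : 0 < alpha)
    (delta theta : nat -> R) (lambda : nat -> R[i])
    (hlambda : forall n,
       lambda n = (gamma_ alpha n * expR (delta n))%:C * expi (theta n))
    (hinj : injective lambda)
    (hmono : forall n, modulus (lambda n) <= modulus (lambda n.+1)) :
  riesz_basis (log_weight alpha) (range lambda)
    (normalized_kernel (log_weight alpha))
  <->
  [/\ d_rho_separated alpha (range lambda),
      bounded_fun delta &
      exists (N : nat) (d : R),
        [/\ (1 <= N)%N, 0 < d,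
            (ereal_sup (range (fun n : nat =>
               (N%:R^-1 * `|\sum_(n.+1 <= k < (n + N).+1) delta k|)%:E))
             <= d%:E)%E
          & d < 1 / (4 * alpha)]].
Proof.
set phi := log_weight alpha.
have a2 : 0 < 2 * alpha by rewrite mulr_gt0.
have a4 : 0 < 4 * alpha by rewrite mulr_gt0.
have rhoE n : modulus (lambda n) = expR (n.+1%:R / (2 * alpha) + delta n).
  by rewrite hlambda modulusM modulus_expi mulr1 modulus_real /gamma_ -expRD gtr0_norm ?expR_gt0.
have rho0 n : 0 < modulus (lambda n) by rewrite rhoE expR_gt0.
have mono : {homo (fun n => modulus (lambda n)) : m n / (m <= n)%N >-> m <= n}.
  by apply: homo_leq => //; exact: le_trans.
have levelE n : level alpha (modulus (lambda n)) - n.+1%:R = 2 * alpha * delta n.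
  by rewrite /level rhoE expRK; field; rewrite gt_eqF.
have devE n : dev alpha lambda n = delta n.
  by rewrite /dev levelE mulrC mulKf // gt_eqF.
have [C0 C0_gt0 hC0] := cmoment_bounds halpha.
have c0 m : 0 < cmoment phi m by exact: c_gt0 C0_gt0 hC0 m.
have growth := cmoment_log_growth halpha.
have rot := log_weight_rot alpha; have meas := measurable_log_weight alpha.
have fin := moment_fin halpha.
pose kn n := kernel_norm phi (lambda n).
have kn0 n : 0 < kn n by exact: kernel_norm_gt0.
have kn_ge n m : modulus (lambda n) ^+ m / Num.sqrt (cmoment phi m) <= kn n.
  exact: kernel_norm_ge.
have kn_le n B : (forall K, \sum_(m < K) (modulus (lambda n) ^+ m) ^+ 2 / cmoment phi m <= B) ->
    kn n ^+ 2 <= B.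
  by move=> HB; exact: kernel_norm_le.
have [toL2 fromL2] := riesz_basis_l2riesz rot meas fin c0 growth hinj.
have [sepE toSep] := d_rho_separatedP halpha hinj rho0 mono.
split.
  move=> /toL2 [C Cpos rC].
  have [S S0 HS] := index_bounded halpha C0_gt0 hC0 rho0 kn0 kn_ge kn_le Cpos rC mono.
  split.
  - apply: toSep.
    exact: (riesz_separated halpha C0_gt0 hC0 rho0 kn0 kn_ge S0 HS Cpos rC).
  - exists (S / (2 * alpha)); split; first exact: num_real.
    move=> x Sx n _ /=; apply: le_trans (ltW Sx); rewrite ler_pdivlMr //.
    by have := HS n; rewrite levelE normrM gtr0_norm // mulrC.
  - have [eta eta0 [K HK]] := riesz_mean halpha C0_gt0 hC0 rho0 mono kn0 kn_ge hinj S0 HS Cpos rC.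
    (* N is so large that K / N uses up at most half of the margin eta. *)
    pose N := (Num.truncn (`|K| / (eta / 2))).+1.
    have e2 : 0 < eta / 2 by rewrite divr_gt0.
    have N0 : 0 < N%:R :> R by rewrite ltr0n.
    have NK : K <= N%:R * (eta / 2).
      apply: le_trans (ler_norm K) _; rewrite -ler_pdivrMr //; apply: ltW.
      have : 0 <= `|K| / (eta / 2) by rewrite divr_ge0 // ltW.
      by move=> /truncn_itv /andP[].
    (* The second entry keeps d positive in case 1 / (4 alpha) - eta / 2 is not. *)
    exists N, (Num.max (1 / (4 * alpha) - eta / 2) (1 / (4 * alpha) / 2)); split=> //.
    + by rewrite lt_max orbC !divr_gt0.
    + apply: ge_ereal_sup => _ [n _ <-]; rewrite lee_fin le_max; apply/orP; left.
      rewrite ler_pdivrMl //; have := HK n (n + N)%N (leq_addr _ _); rewrite addKn.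
      under eq_bigr do rewrite devE; move=> h; apply: le_trans h _; lra.
    + have p4 : 0 < 1 / (4 * alpha) by rewrite divr_gt0.
      by rewrite gt_max ltrBlDr ltrDl e2 ltr_pdivrMr // ltr_pMr // ltr1n.
move=> [/sepE [e e0 sep] [M [_ HM]] [N [d [N1 d0 sup_le d_lt]]]]; apply: fromL2.
(* [bounded_fun] yields a bound by every number strictly above M; this one is also positive. *)
have M1 : M < `|M| + 1 by apply: le_lt_trans (ler_norm M) _; rewrite ltrDl.
have bnd n : `|delta n| <= `|M| + 1 by exact: HM M1 n I.
have N0 : 0 < N%:R :> R by rewrite ltr0n.
have blocks n : `|\sum_(n.+1 <= k < (n + N).+1) delta k| <= N%:R * d.
  rewrite -ler_pdivrMl // -lee_fin; apply: le_trans sup_le.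
  by apply: ereal_sup_ubound; exists n.
have mean := block_mean_sum N1 d0 bnd blocks.
have S0 : 0 <= 2 * alpha * (`|M| + 1) by rewrite mulr_ge0 ?addr_ge0 // ltW.
have HS n : `|level alpha (modulus (lambda n)) - n.+1%:R| <= 2 * alpha * (`|M| + 1).
  by rewrite levelE normrM gtr0_norm // ler_pM2l.
have eta0 : 0 < 1 / (4 * alpha) - d by rewrite subr_gt0.
apply: (separated_mean_riesz (Km := N.+1%:R * (`|M| + 1)) halpha C0_gt0 hC0 rho0 mono kn0 kn_ge kn_le hinj S0 HS e0 sep eta0).
move=> n m nm; rewrite subKr; under eq_bigr do rewrite devE.
exact: mean.
Qed.
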